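(* The taut polynomial of a finite veering triangulation is symmetric. That is, if $\mathcal V$ is a finite veering triangulation of a connected 3-manifold $M$, then there is a unit $u\in\mathbb{Z}[H_M]$ with $\Theta_{\mathcal V}=u\,\overline{\Theta_{\mathcal V}}$.
   Context: For $P=\sum_{h\in H_M}a_h\cdot h\in\mathbb{Z}[H_M]$, $\overline P=\sum_{h\in H_M}a_h\cdot h^{-1}$; $P$ is symmetric if $P=u\overline P$ for some unit $u\in\mathbb{Z}[H_M]$. Veering triangulations. $M$ is a connected oriented 3-manifold. An ideal triangulation of $M$ is a decomposition of (the interior of) $M$ into ideal tetrahedra; $T,F,E$ denote the sets of tetrahedra, triangles and edges. An ideal tetrahedron with cooriented faces is transverse taut if the coorientation points out of two faces (top faces) and into the other two (bottom faces). The common edge of the top faces is the top diagonal, the common edge of the bottom faces is the bottom diagonal, the other four edges are equatorial. The tetrahedron is immediately below its top faces and immediately above its bottom faces. Diagonals get angle $\pi$, equatorial edges get angle $0$. A triangulation is transverse taut if its triangles are cooriented so that every tetrahedron is transverse taut and the angles around every edge sum to $2\pi$. It is veering if moreover its edges are coloured red or blue so that in every tetrahedron, drawn (respecting the orientation of $M$) as a flat quadrilateral with face coorientations pointing towards the viewer, top diagonal vertical and bottom diagonal horizontal, the equatorial edges of positive slope are red and those of negative slope are blue (no condition on diagonals). It is finite if $T$ is finite. Veering triangulations lift to covers. Taut polynomial. The upper large edge of a triangle $f$ is the edge of $f$ that is the bottom diagonal of the tetrahedron immediately above $f$. $H_M = H_1(M;\mathbb{Z})/\text{torsion}$, written multiplicatively;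 $M^{fab}$ is the regular cover of $M$ with deck group $H_M$, with induced veering triangulation $\mathcal V^{fab}$. Choosing lifts, identify triangles and edges of $\mathcal V^{fab}$ with $H_M\times F$ and $H_M\times E$. Let $D:\mathbb{Z}[H_M]^F\to\mathbb{Z}[H_M]^E$ be the homomorphism sending a triangle with upper large edge $h_0\cdot e_0$ and other edges $h_1\cdot e_1,h_2\cdot e_2$ to $h_0\cdot e_0-h_1\cdot e_1-h_2\cdot e_2$. Then $\Theta_{\mathcal V}\in\mathbb{Z}[H_M]$, well defined up to a unit, is the greatest common divisor of the maximal ($|E|\times|E|$) minors of $D$ ($0$ if all vanish). *)

(* Defs.v *)
From HB Require Import structures.
From mathcomp Require Import all_boot all_order fingroup perm all_algebra.
From mathcomp Require Import finmap monalg.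
From mathcomp Require Import boolp.
From mathcomp Require classical_sets.
From Stdlib Require Import Relation_Operators.

Set Implicit Arguments.
Unset Strict Implicit.
Unset Printing Implicit Defensive.

Import GRing.Theory.
Local Open Scope ring_scope.

(* The integral group ring of an abelian group [H], written additively; the
   basis element attached to [h : H] is [<< 1 *g h >>].  The ring structure that
   [monalg] puts on [{malg R[K]}] is not available here: it requires a monoid [K]
   without nontrivial invertible elements. *)

Definition group_ring (H : zmodType) : Type := {malg int[H]}.

HB.instance Definition _ (H : zmodType) :=
  GRing.Zmodule.copy (group_ring H) {malg int[H]}.

Section GroupRing.
Variable H : zmodType.
Implicit Types (p q r : group_ring H) (h k : H).

Definition gr_one : group_ring H := << 1 *g 0 >>.

Definition gr_mul p q : group_ring H :=
  \sum_(h <- msupp p) \sum_(k <- msupp q) << p@_h * q@_k *g h + k >>.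

Lemma gr_mulw (d1 d2 : {fset H}) p q :
  (msupp p `<=` d1)%fset -> (msupp q `<=` d2)%fset ->
  gr_mul p q = \sum_(h <- d1) \sum_(k <- d2) << p@_h * q@_k *g h + k >>.
Proof.
move=> le_d1 le_d2; rewrite /gr_mul (big_fset_incl _ le_d1) /=.
  apply/eq_bigr=> h _; apply/big_fset_incl => // k _ /mcoeff_outdom ->.
  by rewrite mulr0 monalgU0.
move=> h _ /mcoeff_outdom ph; rewrite big1 // => k _.
by rewrite ph mul0r monalgU0.
Qed.

Lemma gr_mulUU (a b : int) h k :
  gr_mul << a *g h >> << b *g k >> = << a * b *g h + k >>.
Proof. by rewrite (gr_mulw msuppU_le msuppU_le) !big_seq_fset1 !mcoeffUU. Qed.

Lemma gr_mulC : commutative gr_mul.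
Proof.
move=> p q; rewrite /gr_mul exchange_big /=; apply/eq_bigr => h _.
by apply/eq_bigr => k _; rewrite mulrC addrC.
Qed.

Lemma gr_mulDl : left_distributive gr_mul +%R.
Proof.
move=> p q r.
rewrite [in RHS](gr_mulw (fsubsetUl _ (msupp q)) (fsubset_refl (msupp r))).
rewrite [in RHS](gr_mulw (fsubsetUr (msupp p) _) (fsubset_refl (msupp r))).
rewrite (@gr_mulw _ _ (p + q) r (msuppD_le p q) (fsubset_refl (msupp r))).
rewrite -big_split /=; apply/eq_bigr => h _.
rewrite -big_split /=; apply/eq_bigr => k _.
by rewrite mcoeffD mulrDl monalgUD.
Qed.

Lemma gr_mulDr : right_distributive gr_mul +%R.
Proof. by move=> p q r; rewrite gr_mulC gr_mulDl !(gr_mulC p). Qed.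

Lemma gr_mul0 : left_zero 0 gr_mul.
Proof. by move=> p; rewrite /gr_mul msupp0 big_seq_fset0. Qed.

Lemma gr_mulr0 : right_zero 0 gr_mul.
Proof. by move=> p; rewrite gr_mulC gr_mul0. Qed.

Lemma gr_mul_suml (I : Type) (s : seq I) (F : I -> group_ring H) q :
  gr_mul (\sum_(i <- s) F i) q = \sum_(i <- s) gr_mul (F i) q.
Proof.
exact: (big_morph (gr_mul^~ q) (fun _ _ => gr_mulDl _ _ _) (gr_mul0 q)).
Qed.

Lemma gr_mul_sumr (I : Type) (s : seq I) (F : I -> group_ring H) q :
  gr_mul q (\sum_(i <- s) F i) = \sum_(i <- s) gr_mul q (F i).
Proof.
exact: (big_morph (gr_mul q) (fun _ _ => gr_mulDr _ _ _) (gr_mulr0 q)).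
Qed.

Lemma gr_mul1 : left_id gr_one gr_mul.
Proof.
move=> p; rewrite [RHS]monalgE [in LHS](monalgE p) gr_mul_sumr.
by apply/eq_bigr => h _; rewrite gr_mulUU mul1r add0r.
Qed.

Lemma gr_mulA : associative gr_mul.
Proof.
have mulUUU a b c h k l : gr_mul << a *g h >> (gr_mul << b *g k >> << c *g l >>)
    = gr_mul (gr_mul << a *g h >> << b *g k >>) << c *g l >>.
  by rewrite !gr_mulUU mulrA addrA.
move=> p q r; rewrite (monalgE p) (monalgE q) (monalgE r).
have sl I s F g : gr_mul (\sum_(i <- s) F i) g = \sum_(i <- s) gr_mul (F i) g
  := @gr_mul_suml I s F g.
have sr I s F g : gr_mul g (\sum_(i <- s) F i) = \sum_(i <- s) gr_mul g (F i)
  := @gr_mul_sumr I s F g.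
move: gr_mul mulUUU sl sr => m mulUUU sl sr.
rewrite !sl; apply/eq_bigr => h _; rewrite [LHS]sr.
rewrite [X in m X _]sr sl; apply/eq_bigr => k _.
by rewrite !sr; apply/eq_bigr => l _.
Qed.

Lemma gr_one_neq0 : gr_one != 0 :> group_ring H.
Proof. by rewrite monalgU_eq0 oner_eq0. Qed.

HB.instance Definition _ := GRing.Zmodule_isComNzRing.Build (group_ring H)
  gr_mulA gr_mulC gr_mul1 gr_mulDl gr_one_neq0.

Definition gr_unit : {pred group_ring H} := fun p => `[< exists q, q * p = 1 >].

Definition gr_inv p : group_ring H :=
  if p \in gr_unit then classical_sets.xget p (fun q => q * p = 1) else p.

Lemma gr_mulVp : {in gr_unit, left_inverse 1 gr_inv *%R}.
Proof.
move=> p pU; rewrite /gr_inv pU.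
exact: (@classical_sets.xgetPex _ p (fun q => q * p = 1) (asboolW pU)).
Qed.

Lemma gr_unitPl p q : q * p = 1 -> p \in gr_unit.
Proof. by move=> qp; apply/asboolP; exists q. Qed.

Lemma gr_inv_out : {in [predC gr_unit], gr_inv =1 id}.
Proof. by move=> p; rewrite inE /gr_inv => /negbTE ->. Qed.

HB.instance Definition _ := GRing.ComNzRing_hasMulInverse.Build (group_ring H)
  gr_mulVp gr_unitPl gr_inv_out.

Definition gr_bar p : group_ring H := \sum_(h <- msupp p) << p@_h *g - h >>.

Definition gr_symmetric p :=
  exists2 u : group_ring H, u \is a GRing.unit & p = u * gr_bar p.

End GroupRing.

Definition ring_dvd (R : comNzRingType) (a b : R) := exists c, b = c * a.

Definition is_gcd (R : comNzRingType) (S : R -> Prop) (g : R) :=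
  (forall a, S a -> ring_dvd g a) /\
  (forall d, (forall a, S a -> ring_dvd d a) -> ring_dvd d g).

Definition maximal_minor (R : comNzRingType) m n (A : 'M[R]_(m, n)) (a : R) :=
  exists2 f : 'I_m -> 'I_n, injective f & a = \det (colsub f A).

(* The vertices of every tetrahedron are labelled by ['I_4], compatibly with its
   orientation, and face [i] is the one opposite to vertex [i].  Face [i] of [t]
   is glued to face [glue t i i] of [adj t i], vertex [v != i] going to vertex
   [glue t i v]. *)

Record gluing (T : Type) := Gluing {
  adj : T -> 'I_4 -> T;
  glue : T -> 'I_4 -> 'S_4
}.

(* [(t, (i, j))] is the edge of [t] common to its faces [i] and [j] (so
   [i != j]), seen as a wedge around that edge entered through face [i] and left
   through face [j]. *)
Notation angle T := (T * ('I_4 * 'I_4))%type.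

Section Edges.
Variables (T : Type) (G : gluing T).

(* Leave the wedge through face [j] and enter the next one around the edge. *)
Definition rot (a : angle T) : angle T :=
  let: (t, (i, j)) := a in (adj G t j, (glue G t j j, glue G t j i)).

Definition flip (a : angle T) : angle T := (a.1, (a.2.2, a.2.1)).

Definition same_edge : angle T -> angle T -> Prop :=
  clos_refl_sym_trans _ (fun a b => b = rot a \/ b = flip a).

End Edges.

Section Finite.
Variables (T : finType) (G : gluing T).

Definition edge_of (a : angle T) : {set angle T} :=
  [set b | `[< same_edge G a b >]].

Definition edges : {set {set angle T}} :=
  [set edge_of a | a : angle T & a.2.1 != a.2.2].

(* Since all gluing permutations are odd, the vertex labelling orients the
   glued-up space; as no face is glued to itself, no edge can then be identified
   with its own reverse, so that, away from the vertices, this space is a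
   3-manifold. *)
Record ideal_triangulation : Prop := IdealTriangulation {
  adjK : forall t i, adj G (adj G t i) (glue G t i i) = t;
  glueK : forall t i,
    glue G (adj G t i) (glue G t i i) = ((glue G t i)^-1)%g;
  glue_free : forall t i, (adj G t i, glue G t i i) <> (t, i);
  glue_odd : forall t i, odd_perm (glue G t i);
  triang_connected :
    forall s t, connect (fun s t => [exists i, adj G s i == t]) s t
}.

(* [up t i]: the coorientation of face [i] points out of [t]. *)
Variable up : T -> 'I_4 -> bool.

Definition top_diagonal (a : angle T) := up a.1 a.2.1 && up a.1 a.2.2.
Definition bottom_diagonal (a : angle T) := ~~ up a.1 a.2.1 && ~~ up a.1 a.2.2.

Record transverse_taut : Prop := TransverseTaut {
  up_adj : forall t i, up (adj G t i) (glue G t i i) = ~~ up t i;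
  two_top : forall t, #|[set i | up t i]| = 2%N;
  (* every angle occurs twice, as [a] and as [flip a] *)
  angle_sum : forall e, e \in edges ->
    #|[set a in e | (a.2.1 < a.2.2)%N
                    && (top_diagonal a || bottom_diagonal a)]| = 2%N
}.

(* Triangles are recorded by the tetrahedron immediately above them. *)
Definition triangles : {set T * 'I_4} := [set f | ~~ up f.1 f.2].

Inductive edge_colour := Red | Blue.

(* Label the vertices of the flat quadrilateral by the compass points
   N = [s 0], S = [s 1], W = [s 2], E = [s 3]; the top diagonal is NS, i.e. the
   top faces are the ones opposite to W and E.  With the top diagonal towards
   the viewer, (N, S, W, E) is positively oriented, i.e. [s] is even. *)
Definition veering (colour : {set angle T} -> edge_colour) : Prop :=
  forall (t : T) (s : 'S_4), ~~ odd_perm s -> up t (s 2%R) -> up t (s 3%R) ->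
  [/\ (* NW *) colour (edge_of (t, (s 1%R, s 3%R))) = Red,
      (* SE *) colour (edge_of (t, (s 0%R, s 2%R))) = Red,
      (* NE *) colour (edge_of (t, (s 1%R, s 2%R))) = Blue
    & (* SW *) colour (edge_of (t, (s 0%R, s 3%R))) = Blue].

End Finite.

Record veering_triangulation (T : finType) := VeeringTriangulation {
  vt_gluing :> gluing T;
  vt_up : T -> 'I_4 -> bool;
  vt_colour : {set angle T} -> edge_colour;
  vt_triang : ideal_triangulation vt_gluing;
  vt_taut : transverse_taut vt_gluing vt_up;
  vt_veering : veering vt_gluing vt_up vt_colour
}.

(* The manifold [M] (the glued-up space without its vertices) deformation
   retracts onto the 2-complex dual to the triangulation, whose vertices, edges
   and 2-cells are the tetrahedra, triangles and edges; its homology is computed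
   there.  A 1-chain is a combination of oriented dual edges; [(t, i)] is the one
   leaving [t] through its face [i], and the two orientations of a dual edge are
   made opposite by the relations [backtrack]. *)

Section Homology.
Variables (T : finType) (G : gluing T).

Local Notation chain := {ffun T * 'I_4 -> int}.

Definition dual_edge (s : T * 'I_4) : chain := [ffun s' => (s' == s)%:R].

Definition point (t : T) : {ffun T -> int} := [ffun t' => (t' == t)%:R].

Definition boundary (c : chain) : {ffun T -> int} :=
  \sum_(s : T * 'I_4) (point (adj G s.1 s.2) - point s.1) *~ c s.

Definition backtrack (s : T * 'I_4) : chain :=
  dual_edge s + dual_edge (adj G s.1 s.2, glue G s.1 s.2 s.2).

(* The boundary of the 2-cell dual to the edge at [a]. *)
Definition loop (a : angle T) : chain :=
  \sum_(b <- fingraph.orbit (rot G) a) dual_edge (b.1, b.2.2).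

Definition null_chain (c : chain) : Prop :=
  exists (k : angle T -> int) (l : T * 'I_4 -> int),
    c = \sum_(a : angle T | a.2.1 != a.2.2) loop a *~ k a
        + \sum_(s : T * 'I_4) backtrack s *~ l s.

Definition torsion_chain : {pred chain} :=
  fun c => `[< exists2 n, (0 < n)%N & null_chain (c *+ n) >].

Lemma torsion_chain_zmod_closed : zmod_closed torsion_chain.
Proof.
have null0 : null_chain 0.
  by exists (fun=> 0), (fun=> 0); rewrite !big1 ?addr0.
have nullB c d : null_chain c -> null_chain d -> null_chain (c - d).
  move=> [k [l ->]] [k' [l' ->]].
  exists (fun a => k a - k' a), (fun s => l s - l' s).
  rewrite opprD addrACA -!sumrB.
  by congr (_ + _); apply/eq_bigr => x _; rewrite mulrzBr.
have nullMn n c : null_chain c -> null_chain (c *+ n).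
  move=> nc; elim: n => [|n IHn]; first by rewrite mulr0n.
  by rewrite mulrSr -[c in X in _ + X]opprK -(sub0r c); apply/nullB/nullB.
split=> [|c d /asboolP[m m0 mc] /asboolP[n n0 nd]].
  by apply/asboolP; exists 1%N.
apply/asboolP; exists (m * n)%N; first by rewrite muln_gt0 m0.
rewrite mulrnBl {2}mulnC !mulrnA.
by apply: nullB; apply: nullMn.
Qed.

HB.instance Definition _ :=
  GRing.isZmodClosed.Build chain torsion_chain torsion_chain_zmod_closed.

Definition chain_class : zmodType := Quotient.quot torsion_chain.

Definition class_of (c : chain) : chain_class := (\pi_chain_class c)%qT.

Definition cycle_class : {pred chain_class} :=
  fun x => `[< exists2 c, boundary c = 0 & class_of c = x >].

Lemma boundaryB c d : boundary (c - d) = boundary c - boundary d.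
Proof.
rewrite /boundary -sumrB; apply/eq_bigr => s _.
by rewrite !ffunE mulrzBr.
Qed.

Lemma boundary_dual_edge s :
  boundary (dual_edge s) = point (adj G s.1 s.2) - point s.1.
Proof.
rewrite /boundary (bigD1 s) //= ffunE eqxx mulr1z big1 ?addr0 // => s' ne.
by rewrite ffunE (negbTE ne) mulr0z.
Qed.

Lemma class_ofB c d : class_of (c - d) = class_of c - class_of d.
Proof. exact: raddfB. Qed.

Lemma cycle_class_zmod_closed : zmod_closed cycle_class.
Proof.
split=> [|x y /asboolP[c c0 <-] /asboolP[d d0 <-]]; apply/asboolP.
  by exists 0; [rewrite -(subrr 0) boundaryB subrr | exact: raddf0].
by exists (c - d); [rewrite boundaryB c0 d0 subrr | exact: class_ofB].
Qed.

HB.instance Definition _ :=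
  GRing.isZmodClosed.Build chain_class cycle_class cycle_class_zmod_closed.

Record H1_free := H1Free { h1_val :> chain_class; _ : h1_val \in cycle_class }.

HB.instance Definition _ := [isSub for h1_val].
HB.instance Definition _ := [Choice of H1_free by <:].
HB.instance Definition _ := [SubChoice_isSubZmodule of H1_free by <:].

(* The tetrahedra of the cover of [M] that corresponds to the kernel of
   [pi_1(M) -> H_1(M; Z) / torsion]: classes of paths of tetrahedra starting
   at [t0], given by their end tetrahedron and the class of the chain they
   carry; the deck group [H1_free] acts by translation. *)
Record fab_tet (t0 : T) := FabTet {
  fab_proj : T;
  fab_class : chain_class;
  fab_tetP :
    exists2 c, boundary c = point fab_proj - point t0 & class_of c = fab_class
}.

Section Cover.
Variable t0 : T.
Implicit Types (x : fab_tet t0) (h : H1_free).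

Lemma fab_adj_subproof x i :
  exists2 c, boundary c = point (adj G (fab_proj x) i) - point t0
           & class_of c = fab_class x + class_of (dual_edge (fab_proj x, i)).
Proof.
case: (fab_tetP x) => c bc <-; exists (c - - dual_edge (fab_proj x, i)).
  rewrite -[- dual_edge _]sub0r !boundaryB bc boundary_dual_edge.
  rewrite -[X in boundary X](subrr 0) boundaryB subrr sub0r opprK.
  by rewrite addrC addrA subrK.
by rewrite opprK; exact: raddfD.
Qed.

Lemma fab_deck_subproof h x :
  exists2 c, boundary c = point (fab_proj x) - point t0
           & class_of c = h1_val h + fab_class x.
Proof.
case: (fab_tetP x) => c bc <-; case: h => y /= /asboolP[d bd <-].
exists (c - (0 - d)); last by rewrite sub0r opprK addrC; exact: raddfD.
rewrite !boundaryB bc bd.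
by rewrite -[X in boundary X](subrr 0) boundaryB subrr !subr0.
Qed.

Definition fab_gluing : gluing (fab_tet t0) := {|
  adj := fun x i => FabTet (fab_adj_subproof x i);
  glue := fun x i => glue G (fab_proj x) i
|}.

Definition fab_deck h x : fab_tet t0 := FabTet (fab_deck_subproof h x).

Definition fab_deck_angle h (a : angle (fab_tet t0)) : angle (fab_tet t0) :=
  (fab_deck h a.1, a.2).

Definition fab_proj_angle (a : angle (fab_tet t0)) : angle T :=
  (fab_proj a.1, a.2).

End Cover.

End Homology.

Section TautPolynomial.
Variables (T : finType) (V : veering_triangulation T) (t0 : T).

Local Notation G := (vt_gluing V).
Local Notation up := (vt_up V).
Local Notation E := (edges G).
Local Notation F := (triangles up).
Local Notation H := (H1_free G).
Local Notation Tfab := (fab_tet G t0).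

(* A lift of every edge of [V] to the cover (represented by one of its angles),
   and of every triangle (recorded by the tetrahedron above it). *)
Definition edge_lift (lE : {set angle T} -> angle Tfab) : Prop :=
  forall e, e \in E -> edge_of G (fab_proj_angle (lE e)) = e.

Definition triangle_lift (lF : T * 'I_4 -> Tfab * 'I_4) : Prop :=
  forall f, f \in F -> (fab_proj (lF f).1, (lF f).2) = f.

Variables (lE : {set angle T} -> angle Tfab) (lF : T * 'I_4 -> Tfab * 'I_4).

(* The [h : H] such that the edge of the cover at [a] is [h] times the chosen
   lift of the edge of [V] below it. *)
Definition edge_coord (a : angle Tfab) : H :=
  classical_sets.xget 0 (fun h =>
    same_edge (fab_gluing G t0)
      (fab_deck_angle h (lE (edge_of G (fab_proj_angle a)))) a).

(* Seen from the tetrahedron [x] above it, the edges of a triangle [(x, i)] are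
   the [(x, (i, j))], [j != i]; its upper large edge is the one which is the
   bottom diagonal of [x]. *)
Definition taut_coeff (f : Tfab * 'I_4) (e : {set angle T}) : group_ring H :=
  \sum_(j : 'I_4 | (j != f.2)
                   && (edge_of G (fab_proj f.1, (f.2, j)) == e))
     << (if bottom_diagonal up (fab_proj f.1, (f.2, j)) then 1 else -1)
        *g edge_coord (f.1, (f.2, j)) >>.

Definition taut_matrix : 'M[group_ring H]_(#|E|, #|F|) :=
  \matrix_(e, f) taut_coeff (lF (enum_val f)) (enum_val e).

End TautPolynomial.

(* [Theta] is only defined up to a unit: this is the property of being one of its
   representatives, for some choice of base tetrahedron and lifts. *)
Definition is_taut_polynomial (T : finType) (V : veering_triangulation T)
    (Theta : group_ring (H1_free V)) : Prop :=
  exists (t0 : T) (lE : {set angle T} -> angle (fab_tet V t0))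
         (lF : T * 'I_4 -> fab_tet V t0 * 'I_4),
    [/\ edge_lift lE, triangle_lift lF
      & is_gcd (maximal_minor (taut_matrix lE lF)) Theta].

(* Main.v *)
From HB Require Import structures.
Require Import Defs.
From mathcomp Require Import all_boot all_order all_algebra.
From mathcomp Require Import fingroup perm finmap monalg ring boolp.
From Stdlib Require Import Relation_Operators.

(* Since [Theta] is a gcd of the maximal minors of [D], it suffices that every
   maximal minor [m] is symmetric up to a monomial.  We work in the group ring of
   the free part of the 1-chains modulo boundaries, where edges and tetrahedra of
   the cover get coordinates.  Let [Dop] be the matrix of the triangulation with
   all coorientations reversed: an edge is then counted positively in a triangle
   when it is its lower large edge.  As the upper and lower large edges of a
   triangle have the same colour and the third edge has the other one,
   [Dop = S D G] with [S] a diagonal of signs and [G] a monomial permutation, so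
   that [D] and [Dop] have the same minors up to monomials.

   Ladders permute the triangles; for [P = 1 - (weighted ladder permutation)] one
   finds [D P = W pi], where [pi] sends a triangle to the tetrahedron above it.
   If [B] is the monomial matrix of bottom diagonals then [X = W B^*] satisfies
   [Xop = X^*], and so does [X + D c r Dop^*] for any [c] and [r] (with [c] and [r]
   exchanged and starred).  By a Pluecker relation
     det (X + D c r Dop^* ) det [f | K] = det (D f) det (P + c r Dop^* B pi) u
   with [K] spanning the kernel of [D] and [u] a monomial.  Here [det [f | K]] and,
   after splitting off the kernel and cokernel of [P], the last determinant are
   products of determinants of matrices whose rows have at most two nonzero
   monomials, and such determinants are symmetric, by contraction along a row.
   For the kernel part this holds because the entries only depend on the half-edges,
   whose values are constant while an edge climbs to its bottom diagonal.  The
   relation and its analogue for [Dop] yield [bar m ^ 2 = +- h m ^ 2], whence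
   [bar m = +- h' m], as the group is orderable.  When [H_1] has rank 0 the bar is
   the identity; otherwise [K] is injective by connectedness. *)

Set Implicit Arguments.
Unset Strict Implicit.
Unset Printing Implicit Defensive.

Import Order.TTheory GRing.Theory Num.Theory.
Local Open Scope ring_scope.

(** * Determinants *)

Section LinearAlgebra.
Local Open Scope quotient_scope.
Variable R : idomainType.

Lemma det0Pc n (A : 'M[R]_n) :
  reflect (exists2 v : 'cV[R]_n, v != 0 & A *m v = 0) (\det A == 0).
Proof.
rewrite -det_tr; apply: (iffP det0P) => -[v v0 vA0]; exists v^T.
- by rewrite trmx_eq0.
- by rewrite -[A]trmxK -trmx_mul vA0 trmx0.
- by rewrite trmx_eq0.
- by rewrite -trmx_mul vA0 trmx0.
Qed.

Lemma plucker a b (D : 'M[R]_(a, a + b)) (f g : 'M[R]_(a + b, a))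
    (K : 'M[R]_(a + b, b)) :
  D *m K = 0 ->
  \det (D *m f) * \det (row_mx g K) = \det (D *m g) * \det (row_mx f K).
Proof.
move=> DK0; set U := row_mx f K; set V := row_mx g K.
have [U0|U0] := eqVneq (\det U) 0.
  rewrite U0 mulr0; apply/eqP; rewrite mulf_eq0.
  move/eqP/det0Pc: U0 => -[v v0]; rewrite -[v]vsubmxK mul_row_col => Uv.
  have [x0|x0] := eqVneq (usubmx v) 0.
    apply/orP; right; apply/det0Pc; exists v => //.
    by rewrite -[v]vsubmxK mul_row_col x0 mulmx0 -[RHS]Uv x0 mulmx0.
  apply/orP; left; apply/det0Pc; exists (usubmx v) => //.
  by move/(congr1 (mulmx D)): Uv; rewrite mulmxDr !mulmxA DK0 mul0mx addr0 mulmx0.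
pose X1 := usubmx (\adj U); pose X2 := dsubmx (\adj U).
have adjE : \adj U = col_mx X1 X2 by rewrite vsubmxK.
have DX : \det U *: D = D *m f *m X1.
  rewrite -mul_mx_scalar -mul_mx_adj mulmxA mul_mx_row DK0 adjE.
  by rewrite mul_row_col mul0mx addr0.
have := mul_adj_mx U; rewrite adjE mul_col_row scalar_mx_block.
case/eq_block_mx => _ X1K _ X2K.
have e1 : \det U ^+ a * \det (D *m g) = \det (D *m f) * \det (X1 *m g).
  by rewrite -detZ -det_mulmx scalemxAl DX mulmxA.
have e2 : \det (\adj U) * \det V = \det (X1 *m g) * \det U ^+ b.
  by rewrite -det_mulmx adjE mul_col_row X1K X2K det_lblock det_scalar.
have e3 : \det U * \det (\adj U) = \det U ^+ (a + b).
  by rewrite -det_mulmx mul_mx_adj det_scalar.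
apply: (mulfI (expf_neq0 (a + b) U0)); rewrite -{1}e3.
transitivity (\det U * \det (D *m f) * (\det (\adj U) * \det V)); first by ring.
by rewrite e2 exprD; transitivity (\det U * \det U ^+ b * (\det (D *m f) * \det (X1 *m g)));
  [ring | rewrite -e1; ring].
Qed.

Section DegeneratePerturbation.
Variables (N m : nat) (P : 'M[R]_N) (s c c0 : 'M[R]_(N, m)).
Variables (l r0 r : 'M[R]_(m, N)).
Hypotheses (Ps : P *m s = 0) (lP : l *m P = 0).
Hypotheses (r0s : r0 *m s = 1%:M) (lc0 : l *m c0 = 1%:M).

Lemma det_perturb : exists b : bool,
  \det (P + c *m r) = (-1) ^+ b * \det (P + c0 *m r0) * \det (l *m c) * \det (r *m s).
Proof.
pose P1 := P + c0 *m r0.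
pose J : 'M[R]_(m + m) := block_mx 0 1%:M 1%:M 0.
have [z Jz] : exists z : bool, \det J = (-1) ^+ z.
  have : \det J ^+ 2 == 1.
    rewrite expr2 -det_mulmx mulmx_block !mul0mx !mul1mx !addr0 add0r.
    by rewrite -scalar_mx_block det1.
  by rewrite sqrf_eq1 => /orP[] /eqP ->; [exists false | exists true].
pose Z : 'M[R]_(N + (m + m)) :=
  block_mx P1 (row_mx c0 c) (col_mx (- r) r0) J.
have dZ : \det Z = \det (P + c *m r) * \det J.
  pose A : 'M[R]_(N + (m + m)) := block_mx 1%:M 0 (col_mx (- r0) r) 1%:M.
  have : \det (Z *m A) = \det Z by rewrite det_mulmx det_lblock !det1 !mulr1.
  move<-; rewrite /Z /A mulmx_block !mulmx1 !mulmx0 !add0r mul_row_col.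
  rewrite mulmxN /J mul_block_col !mul1mx !mul0mx add0r addr0.
  rewrite add_col_mx addNr addrN col_mx0 det_ublock /P1.
  by congr (\det _ * _); rewrite addrA addrK.
have dZ' : \det Z = \det P1 * (\det (- (l *m c)) * \det (r *m s)).
  pose A : 'M[R]_(N + (m + m)) := block_mx 1%:M (row_mx (- s) 0) 0 1%:M.
  pose B : 'M[R]_(N + (m + m)) := block_mx 1%:M 0 (col_mx 0 (- l)) 1%:M.
  have : \det (B *m Z *m A) = \det Z.
    by rewrite !det_mulmx det_lblock det_ublock !det1 !mulr1 mul1r.
  move<-; rewrite /B /Z /A [X in X *m _]mulmx_block !mul1mx !mul0mx !addr0.
  have P1s : P1 *m s = c0 by rewrite mulmxDl Ps add0r -mulmxA r0s mulmx1.
  have lP1 : l *m P1 = r0 by rewrite mulmxDr lP add0r mulmxA lc0 mul1mx.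
  rewrite !mul_col_mx !mul0mx !mulNmx lP1 mul_mx_row lc0 /J.
  rewrite add_col_mx add0r addNr.
  rewrite -mul_col_mx -block_mxEv mulmx_block !mulmx1 !mulmx0 !addr0.
  rewrite mul_mx_row mulmx0 mulmxN P1s add_row_mx addNr add0r.
  have -> : col_mx (- r) 0 *m row_mx (- s) 0 +
     (col_mx 0 (- row_mx 1%:M (l *m c)) + block_mx 0 1%:M 1%:M 0)
     = block_mx (r *m s) 1%:M 0 (- (l *m c)) :> 'M_(m + m).
    rewrite mul_col_row !mul0mx mulmx0 mulNmx mulmxN opprK.
    rewrite (_ : col_mx 0 _ = block_mx 0 0 (- 1%:M) (- (l *m c))); last first.
      by rewrite opp_row_mx block_mxEv row_mx0.
    by rewrite !add_block_mx !addr0 !add0r addNr.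
  pose A1 : 'M[R]_(N + (m + m)) :=
    block_mx 1%:M (row_mx 0 c) 0 (block_mx 1%:M 1%:M 0 (- (l *m c))).
  pose A2 : 'M[R]_(N + (m + m)) :=
    block_mx P1 0 (col_mx (- r) 0) (block_mx (r *m s) 0 0 1%:M).
  transitivity (\det (A1 *m A2)).
    congr (\det _); rewrite /A1 /A2 mulmx_block [in RHS]mul_row_block.
    rewrite mulmx_block mul_row_col mul_block_col.
    rewrite !(mul1mx, mul0mx, mulmx0, mulmx1, addr0, add0r).
    by [].
  rewrite det_mulmx !det_ublock det_lblock det_ublock !det1 !mul1r mulr1.
  by ring.
have zz (x : R) : x = (-1) ^+ z * (x * (-1) ^+ z).
  by rewrite mulrCA -signr_addb addbb mulr1.
exists (z (+) odd m); rewrite signr_addb signr_odd [LHS]zz -Jz -dZ dZ'.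
by rewrite -scaleN1r detZ -/P1; ring.
Qed.
End DegeneratePerturbation.

Lemma fractionE (y : {fraction R}) :
  exists2 d : R, d != 0 & exists n, y * tofrac d = tofrac n.
Proof.
rewrite -[y]generic_quotient.reprK; move: (generic_quotient.repr y) => x.
exists (\d_x); first exact: denom_ratioP.
exists (\n_x).
unlock tofrac.
rewrite -[LHS]FracField.pi_mul; apply/eqmodP => /=.
rewrite FracField.equivfE /FracField.mulf /= !numden_Ratio ?mulr1 ?oner_neq0 //.
  by rewrite mulrC.
all: exact: denom_ratioP.
Qed.

Lemma rowsub_det_neq0 p q (M : 'M[R]_(p, q)) :
    (forall v : 'cV_q, M *m v = 0 -> v = 0) ->
  exists f : 'I_q -> 'I_p, injective f /\ \det (rowsub f M) != 0.
Proof.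
move=> injM; pose F := {fraction R}; pose M' := map_mx (@tofrac R) M.
have inj (v : 'cV[F]_q) : M' *m v = 0 -> v = 0.
  move=> Mv; pose dn i := fractionE (v i 0).
  have /fin_all_exists2[d d0 /fin_all_exists[n nE]] := fun i => fractionE (v i 0).
  pose D := \prod_i d i; have D0 : D != 0 by apply/prodf_neq0 => i _.
  pose w : 'cV[R]_q := \col_i (n i * \prod_(j | j != i) d j).
  have wE : map_mx (@tofrac R) w = tofrac D *: v.
    apply/colP => i; rewrite !mxE (_ : D = d i * \prod_(j | j != i) d j).
      by rewrite !tofracM -nE -mulrA mulrC.
    by rewrite /D (bigD1 i).
  have : w = 0.
    apply: injM; have : map_mx (@tofrac R) (M *m w) = 0.
      by rewrite map_mxM wE -scalemxAr Mv scaler0.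
    by move/colP => Mw; apply/colP => i; apply/eqP; have := Mw i;
      rewrite [LHS]mxE [RHS]mxE [X in _ == X]mxE => /eqP; rewrite tofrac_eq0.
  move/(congr1 (map_mx (@tofrac R))); rewrite wE map_mx0 => /eqP.
  by rewrite scaler_eq0 tofrac_eq0 (negPf D0) => /eqP.
have ffM : row_full M'.
  rewrite -cokermx_eq0; apply/eqP/matrixP => i j; rewrite [RHS]mxE.
  have /colP/(_ i) : col j (cokermx M') = 0; last by rewrite !mxE.
  by apply: inj; rewrite colE mulmxA mulmx_coker mul0mx.
exists (fullrankfun ffM); split.
  by move=> i j; rewrite !ffunE /= => /maxrankfun_inj /cast_ord_inj.
have := fullrowsub_unit ffM.
by rewrite unitmxE unitfE -map_mxsub det_map_mx tofrac_eq0.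
Qed.
End LinearAlgebra.

(** * Matrices whose rows are sums of two monomials *)

Section MonomialMatrices.
Variables (C : zmodType) (R : idomainType).
Variables (bar : {rmorphism R -> R}) (x : C -> R).
Hypotheses (x0 : x 0 = 1) (xD : forall c d, x (c + d) = x c * x d).
Hypothesis (bar_x : forall c, bar (x c) = x (- c)).

Definition monomial (p : R) := exists (b : bool) (c : C), p = (-1) ^+ b * x c.
Definition mon0 (p : R) := p = 0 \/ monomial p.
Definition bar_sym (p : R) := exists2 u, monomial u & bar p = u * p.

Lemma xNK c : x (- c) * x c = 1. Proof. by rewrite -xD addNr x0. Qed.

Lemma monomial1 : monomial 1.
Proof. by exists false, 0; rewrite x0 mulr1. Qed.

Lemma monomialx c : monomial (x c).
Proof. by exists false, c; rewrite mul1r. Qed.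

Lemma monomial_sign (b : bool) : monomial ((-1) ^+ b).
Proof. by exists b, 0; rewrite x0 mulr1. Qed.

Lemma monomialM p q : monomial p -> monomial q -> monomial (p * q).
Proof.
move=> [b [c ->]] [b' [c' ->]]; exists (b (+) b'), (c + c').
by rewrite signr_addb xD; ring.
Qed.

Lemma monomialN p : monomial p -> monomial (- p).
Proof.
by move=> /(monomialM (monomial_sign true)); rewrite mulN1r.
Qed.

Lemma bar_sign (b : bool) : bar ((-1) ^+ b) = (-1) ^+ b.
Proof. by rewrite rmorphXn rmorphN1. Qed.

Lemma bar_monomial p : monomial p -> monomial (bar p).
Proof.
by move=> [b [c ->]]; exists b, (- c); rewrite rmorphM bar_sign bar_x.
Qed.

Lemma monomialV p : monomial p -> bar p * p = 1.
Proof.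
move=> [b [c ->]]; rewrite rmorphM bar_sign bar_x mulrACA xNK mulr1.
by rewrite -signr_addb addbb.
Qed.

Lemma monomial_neq0 p : monomial p -> p != 0.
Proof.
move=> /monomialV pV; apply: contraTneq isT => p0.
by move: pV; rewrite p0 mulr0 => /eqP; rewrite eq_sym oner_eq0.
Qed.

Lemma mon00 : mon0 0. Proof. by left. Qed.
Lemma mon0M p q : mon0 p -> mon0 q -> mon0 (p * q).
Proof.
move=> [->|mp] [->|mq]; rewrite ?mul0r ?mulr0; try by left.
by right; apply: monomialM.
Qed.
Lemma mon0N p : mon0 p -> mon0 (- p).
Proof. by move=> [->|mp]; [left; rewrite oppr0 | right; apply: monomialN]. Qed.

Lemma bar_symM p q : bar_sym p -> bar_sym q -> bar_sym (p * q).
Proof.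
move=> [u mu pE] [v mv qE]; exists (u * v); first exact: monomialM.
by rewrite rmorphM pE qE; ring.
Qed.

Lemma bar_sym0 : bar_sym 0.
Proof. by exists 1; [exact: monomial1 | rewrite rmorph0 mulr0]. Qed.

Lemma bar_sym_monomial p : monomial p -> bar_sym p.
Proof.
move=> mp; exists (bar p * bar p); last by rewrite -mulrA monomialV ?mulr1.
by apply: monomialM; apply: bar_monomial.
Qed.

Lemma bar_sym_mon0 p : mon0 p -> bar_sym p.
Proof. by move=> [->|/bar_sym_monomial//]; apply: bar_sym0. Qed.

(* [bar (u + v) = bar u * bar v * (v + u)] *)
Lemma bar_symD p q : mon0 p -> mon0 q -> bar_sym (p + q).
Proof.
move=> [->|mp] mq; first by rewrite add0r; apply: bar_sym_mon0.
case: mq => [->|mq]; first by rewrite addr0; apply: bar_sym_monomial.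
exists (bar p * bar q); first by apply: monomialM; apply: bar_monomial.
rewrite rmorphD; have pV := monomialV mp; have qV := monomialV mq.
have -> : bar p * bar q * (p + q) = bar p * p * bar q + bar p * (bar q * q) by ring.
by rewrite pV qV; ring.
Qed.

Lemma bar_symMl u p : monomial u -> bar_sym p -> bar_sym (u * p).
Proof. by move=> mu; apply: bar_symM; apply: bar_sym_monomial. Qed.

Definition row1 n (f : 'I_n -> R) :=
  exists j p, mon0 p /\ forall k, f k = p * (k == j)%:R.
Definition row2 n (f : 'I_n -> R) :=
  exists j p j' q, [/\ mon0 p, mon0 q & forall k, f k = p * (k == j)%:R + q * (k == j')%:R].

Lemma row1_row2 n (f : 'I_n -> R) : row1 f -> row2 f.
Proof.
move=> [j [p [mp fE]]]; exists j, p, j, 0; split=> //; first exact: mon00.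
by move=> k; rewrite mul0r addr0.
Qed.

Lemma row2_unlift n (f : 'I_n.+1 -> R) (j0 : 'I_n.+1) (i0 : 'I_n) :
  row2 f -> row2 (fun k => f (lift j0 k)).
Proof.
have red j p : mon0 p -> exists j1 p1, mon0 p1 /\
    forall k : 'I_n, p * (lift j0 k == j)%:R = p1 * (k == j1)%:R.
  move=> mp; case: (unliftP j0 j) => [j1 ->|->].
    by exists j1, p; split=> // k; rewrite (inj_eq lift_inj).
  exists i0, 0; split=> [|k]; first exact: mon00.
  by rewrite eq_sym (negPf (neq_lift _ _)) mulr0 mul0r.
move=> [j [p [j' [q [mp mq fE]]]]].
have [j1 [p1 [mp1 E1]]] := red j p mp; have [j2 [p2 [mp2 E2]]] := red j' q mq.
by exists j1, p1, j2, p2; split=> // k; rewrite fE E1 E2.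
Qed.

Lemma det_add_col n (M : 'M[R]_n) (j1 j2 : 'I_n) (w : R) : j1 != j2 ->
  \det (\matrix_(i, k) (M i k + w * M i j1 * (k == j2)%:R)) = \det M.
Proof.
move=> neq; pose E : 'M[R]_n := 1%:M + w *: delta_mx j1 j2.
have -> : (\matrix_(i, k) (M i k + w * M i j1 * (k == j2)%:R)) = M *m E.
  apply/matrixP => i k; rewrite /E mulmxDr mulmx1 !mxE; congr (_ + _).
  rewrite (bigD1 j1) //= big1 => [|l /negPf nl].
    by rewrite addr0 !mxE eqxx /=; ring.
  by rewrite !mxE nl /= !mulr0.
have {}dtr A : is_trig_mx A -> (forall i, A i i = 1) -> \det A = 1 :> R.
  by move=> /det_trig -> A1; rewrite big1.
have E1 i : E i i = 1.
  rewrite !mxE eqxx; case: eqP => [->|]; last by rewrite mulr0 addr0.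
  by rewrite (negPf neq) mulr0 addr0.
suff -> : \det (M *m E) = \det M * 1 by rewrite mulr1.
rewrite det_mulmx; congr (_ * _).
have [lt12|lt21] := ltnP j1 j2.
  rewrite -det_tr; apply: dtr => [|i]; last by rewrite mxE E1.
  apply/is_trig_mxP => i j ltij; rewrite !mxE.
  have /negPf -> : j != i by apply: contraTneq ltij => ->; rewrite ltnn.
  case: andP => [[/eqP e1 /eqP e2]|_]; last by rewrite mulr0 addr0.
  by move: ltij; rewrite e1 e2 ltnNge ltnW.
apply: dtr => //; apply/is_trig_mxP => i j ltij; rewrite !mxE.
have /negPf -> : i != j by apply: contraTneq ltij => ->; rewrite ltnn.
case: andP => [[/eqP e1 /eqP e2]|_]; last by rewrite mulr0 addr0.
by move: ltij; rewrite e1 e2 ltnNge lt21.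
Qed.

(* Eliminating the first row contracts the corresponding edge of the graph. *)
Lemma det_row2 n (M : 'M[R]_n) : (forall i, row2 (M i)) -> bar_sym (\det M).
Proof.
elim: n => [|n IHn] in M *.
  by move=> _; rewrite det_mx00; apply: bar_sym_monomial monomial1.
move=> rM; have single (A : 'M[R]_n.+1) j p : bar_sym p ->
    (forall k, A 0 k = p * (k == j)%:R) ->
    (forall i, row2 (fun k => A (lift 0 i) (lift j k))) -> bar_sym (\det A).
  move=> sp A0 rA; rewrite (expand_det_row A 0) (bigD1 j) //= big1 => [|k /negPf nk].
    rewrite addr0 A0 eqxx mulr1; apply: bar_symM => //; rewrite /cofactor.
    rewrite -signr_odd; apply: bar_symMl; first exact: monomial_sign.
    apply: IHn => i; case: (rA i) => a [p1 [b [q1 [m1 m2 E]]]].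
    by exists a, p1, b, q1; split=> // k; rewrite !mxE E.
  by rewrite A0 nk mulr0 mul0r.
have [j [p [j' [q [mp mq M0]]]]] := rM 0.
have [eqj|neqj] := eqVneq j j'.
  apply: (single M j (p + q)); first exact: bar_symD.
    by move=> k; rewrite M0 eqj mulrDl.
  by move=> i; apply: row2_unlift.
case: mp => [p0|mp].
  apply: (single M j' q); first exact: bar_sym_mon0.
    by move=> k; rewrite M0 p0 mul0r add0r.
  by move=> i; apply: row2_unlift.
pose w := - (bar p * q).
have mw : mon0 w by apply/mon0N/mon0M => //; right; apply: bar_monomial.
rewrite -(det_add_col M w neqj).
apply: (single _ j p); first exact: bar_sym_monomial.
  move=> k; rewrite mxE !M0 eqxx (negPf neqj) /w mulr0 addr0 mulr1.
  have := monomialV mp; case: (k == j'); last by rewrite !mulr0 !addr0.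
  rewrite !mulr1 mulNr mulrAC => ->; ring.
move=> i; have [a [u [b [v [mu mv Mi]]]]] := rM (lift 0 i).
have red a1 u1 : mon0 u1 -> exists a2 u2, mon0 u2 /\ forall k : 'I_n.+1,
    k != j -> u1 * (k == a1)%:R + w * (u1 * (j == a1)%:R) * (k == j')%:R
      = u2 * (k == a2)%:R.
  move=> mu1; have [->|na] := eqVneq a1 j.
    exists j', (w * u1); split=> [|k nk]; first exact: mon0M.
    by rewrite (negPf nk) mulr0 add0r mulr1.
  exists a1, u1; split=> // k _.
  by rewrite !mulr0 mul0r addr0.
have [a2 [u2 [mu2 E2]]] := red a u mu; have [b2 [v2 [mv2 F2]]] := red b v mv.
have : row2 (fun k : 'I_n.+1 => u2 * (k == a2)%:R + v2 * (k == b2)%:R).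
  by exists a2, u2, b2, v2; split.
move/(row2_unlift j i) => -[a3 [u3 [b3 [v3 [m3 m3' E3]]]]].
exists a3, u3, b3, v3; split=> // k; rewrite -E3 mxE !Mi -E2 ?neq_lift 1?eq_sym ?neq_lift //.
rewrite -F2 1?eq_sym ?neq_lift //; ring.
Qed.

Lemma det_col1_row2 k n (M : 'M[R]_n) :
    (forall j : 'I_n, (j < k)%N -> row1 (M^~ j)) ->
    (forall i, exists2 f, row2 f & forall j : 'I_n, (k <= j)%N -> M i j = f j) ->
  bar_sym (\det M).
Proof.
elim: k n => [|k IHk] n in M *.
  move=> _ rM; apply: det_row2 => i.
  have [f [a [u [b [v [mu mv fE]]]]] Mf] := rM i.
  by exists a, u, b, v; split=> // j; rewrite Mf.
case: n M => [|n] M cM rM.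
  by rewrite det_mx00; apply: bar_sym_monomial monomial1.
have [i [p [mp Mi]]] := cM ord0 isT.
rewrite (expand_det_col M ord0) (bigD1 i) //= big1 => [|l /negPf nl]; last first.
  by rewrite Mi nl mulr0 mul0r.
rewrite addr0 Mi eqxx mulr1; apply: bar_symM; first exact: bar_sym_mon0.
rewrite /cofactor -signr_odd; apply: bar_symMl; first exact: monomial_sign.
apply: IHk => [j ltj|i'].
  have [a [q [mq Mj]]] := cM (lift ord0 j) ltj.
  have [a'|e] := unliftP i a.
    by move=> e; exists a', q; split=> // l; rewrite !mxE Mj e (inj_eq lift_inj).
  exists j, 0; split=> [|l]; first exact: mon00.
  by rewrite !mxE Mj e eq_sym (negPf (neq_lift _ _)) mulr0 mul0r.
have [f f2 Mf] := rM (lift i i'); exists (fun j => f (lift ord0 j)).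
  exact: row2_unlift.
by move=> j lej; rewrite !mxE Mf.
Qed.

Lemma det_row_mx_sym a b (f : 'M[R]_(a + b, a)) (K : 'M[R]_(a + b, b)) :
    (forall j, row1 (f^~ j)) -> (forall i, row2 (K i)) ->
  bar_sym (\det (row_mx f K)).
Proof.
move=> f1 K2; apply: (det_col1_row2 (k := a)) => [j ja|i].
  have [i [p [mp fE]]] := f1 (Ordinal ja); exists i, p; split=> // l.
  by rewrite -fE -(row_mxEl f K); congr (fun_of_matrix _ _ _); apply: val_inj.
have [j [p [j' [q [mp mq KE]]]]] := K2 i.
exists (fun l => p * (l == rshift a j)%:R + q * (l == rshift a j')%:R).
  by exists (rshift a j), p, (rshift a j'), q; split.
move=> l lea; case: (split_ordP l) => l' lE; first by move: lea; rewrite lE leqNgt /= ltn_ord.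
by rewrite lE row_mxEr KE !eq_rshift.
Qed.

End MonomialMatrices.

(** * Weighted permutations and their kernels *)

Section WeightedPermutation.
Variables (C : zmodType) (R : idomainType).
Variables (bar : {rmorphism R -> R}) (x : C -> R).
Hypotheses (x0 : x 0 = 1) (xD : forall c d, x (c + d) = x c * x d).
Hypothesis (bar_x : forall c, bar (x c) = x (- c)).
Hypothesis (x_inj : forall c, x c = 1 -> c = 0).

Variables (N : nat) (sg : 'I_N -> 'I_N) (w : 'I_N -> C).
Hypothesis sg_inj : injective sg.

Definition hol (f : 'I_N) k := \sum_(i < k) w (iter i sg f).
Definition degenerate f := `[< forall k, iter k sg f = f -> hol f k = 0 >].
Definition base f := froot sg f.
Definition pot f := hol (base f) (findex sg (base f) f).
Definition degenerate_cycles := [set f | (base f == f) && degenerate f].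

Definition walk_mx : 'M[R]_N :=
  \matrix_(g, f) ((g == f)%:R - x (w f) * (g == sg f)%:R).

Lemma holS f k : hol f k.+1 = hol f k + w (iter k sg f).
Proof. by rewrite /hol big_ord_recr. Qed.

Lemma holD f k l : hol f (k + l) = hol f k + hol (iter k sg f) l.
Proof.
elim: l => [|l IHl]; first by rewrite addn0 /hol big_ord0 addr0.
by rewrite addnS !holS IHl -addrA addnC iterD.
Qed.

Lemma degenerate_sg f : degenerate (sg f) = degenerate f.
Proof.
have hol1 k : iter k sg f = f -> hol (sg f) k = hol f k.
  move=> e; apply: (addrI (w f)).
  have := holD f 1 k; rewrite [hol f 1]/hol big_ord_recr big_ord0 /= add0r => <-.
  by rewrite add1n holS e addrC.
apply/asboolP/asboolP => H k e.
  by rewrite -hol1 //; apply: H; rewrite -iterSr /= e.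
have {}e : iter k sg f = f by apply: sg_inj; rewrite -[RHS]e -iterSr.
by rewrite hol1 ?H.
Qed.

Lemma base_sg f : base (sg f) = base f.
Proof.
apply/esym/eqP; rewrite /base root_connect ?fconnect1 //.
exact: fconnect_sym.
Qed.

Lemma degenerate_iter f k : degenerate (iter k sg f) = degenerate f.
Proof. by elim: k => //= k IHk; rewrite degenerate_sg. Qed.

Lemma iter_findex_base f : iter (findex sg (base f) f) sg (base f) = f.
Proof.
apply: iter_findex; rewrite fconnect_sym //; exact: connect_root.
Qed.

Lemma degenerate_base f : degenerate (base f) = degenerate f.
Proof. by rewrite -[in RHS](iter_findex_base f) degenerate_iter. Qed.

Lemma hol_iter_eq f k l : degenerate f ->
  iter k sg f = iter l sg f -> hol f k = hol f l.
Proof.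
move=> df; wlog lekl : k l / (k <= l)%N => [H e|].
  by case/orP: (leq_total k l) => lekl; [|symmetry]; apply: H.
rewrite -(subnKC lekl) => e; rewrite holD.
have : degenerate (iter k sg f) by rewrite degenerate_iter.
move/asboolP/(_ (l - k)%N) => ->; first by rewrite addr0.
by rewrite -iterD addnC -e.
Qed.

Lemma pot_sg f : degenerate f -> pot (sg f) = pot f + w f.
Proof.
move=> df; rewrite /pot base_sg -[in w f](iter_findex_base f) -holS.
apply: hol_iter_eq; first by rewrite degenerate_base.
by rewrite iterS iter_findex_base -(base_sg f) iter_findex_base.
Qed.

Lemma pot_base f : base f = f -> pot f = 0.
Proof. by move=> bf; rewrite /pot bf findex0 /hol big_ord0. Qed.

Let m := #|degenerate_cycles|.
Let ev (j : 'I_m) : 'I_N := enum_val j.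
Let evP j : base (ev j) = ev j /\ degenerate (ev j).
Proof. by have := enum_valP j; rewrite inE => /andP[/eqP]. Qed.

Definition cycle_s : 'M[R]_(N, m) :=
  \matrix_(f, j) (x (pot f) * (degenerate f && (base f == ev j))%:R).
Definition cycle_l : 'M[R]_(m, N) :=
  \matrix_(j, f) (x (- pot f) * (degenerate f && (base f == ev j))%:R).
Definition cycle_c : 'M[R]_(N, m) :=
  \matrix_(f, j) (x (w (ev j)) * (f == sg (ev j))%:R).
Definition cycle_r : 'M[R]_(m, N) := \matrix_(j, f) (f == ev j)%:R.

Lemma walk_s : walk_mx *m cycle_s = 0.
Proof.
apply/matrixP => g j; rewrite !mxE -(f_finv sg_inj g); set f := finv sg g.
under eq_bigr do rewrite !mxE mulrBl.
rewrite sumrB (bigD1 (sg f)) //= eqxx mul1r big1 ?addr0; last first.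
  by move=> f' /negPf nf; rewrite eq_sym nf mul0r.
rewrite (bigD1 f) //= eqxx mulr1 big1 ?addr0; last first.
  by move=> f' nf; rewrite (inj_eq sg_inj) eq_sym (negPf nf) mulr0 mul0r.
rewrite degenerate_sg base_sg; case df: (degenerate f); last by rewrite !mulr0 subrr.
by rewrite pot_sg // xD; ring.
Qed.

Lemma l_walk : cycle_l *m walk_mx = 0.
Proof.
apply/matrixP => j f; rewrite !mxE.
under eq_bigr do rewrite !mxE mulrBr.
rewrite sumrB (bigD1 f) //= eqxx mulr1 big1 ?addr0; last first.
  by move=> f' /negPf nf; rewrite nf mulr0.
rewrite (bigD1 (sg f)) //= eqxx mulr1 big1 ?addr0; last first.
  by move=> f' /negPf nf; rewrite nf !mulr0.
rewrite degenerate_sg base_sg; case df: (degenerate f); last by rewrite !(mulr0, mul0r) subrr.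
by rewrite pot_sg // mulrAC -xD opprD subrK subrr.
Qed.

Lemma r_s : cycle_r *m cycle_s = 1%:M.
Proof.
apply/matrixP => i j; rewrite !mxE (bigD1 (ev i)) //= !mxE eqxx mul1r.
rewrite big1 ?addr0; last by move=> f /negPf nf; rewrite !mxE nf mul0r.
have [bi di] := evP i; rewrite di bi pot_base // x0 mul1r.
by rewrite (inj_eq enum_val_inj).
Qed.

Lemma l_c : cycle_l *m cycle_c = 1%:M.
Proof.
apply/matrixP => i j; rewrite !mxE (bigD1 (sg (ev j))) //= !mxE eqxx mulr1.
rewrite big1 ?addr0; last by move=> f /negPf nf; rewrite !mxE nf !mulr0.
have [bi di] := evP j; rewrite degenerate_sg di base_sg bi.
rewrite pot_sg // pot_base // add0r mulrAC -xD addNr x0 mul1r.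
by rewrite (inj_eq enum_val_inj) eq_sym.
Qed.

Lemma cut_mxE g f : (walk_mx + cycle_c *m cycle_r) g f =
  (g == f)%:R - (f \notin degenerate_cycles)%:R * x (w f) * (g == sg f)%:R.
Proof.
rewrite !mxE -addrA; congr (_ + _).
have [fd|fd] := boolP (f \in _); last first.
  rewrite mul1r big1 ?addr0 // => j _; rewrite !mxE.
  have /negPf -> : f != ev j by apply: contraNneq fd => ->; apply: enum_valP.
  by rewrite mulr0.
rewrite (bigD1 (enum_rank_in fd f)) //= !mxE /ev enum_rankK_in // eqxx mulr1.
rewrite big1 => [|j nj]; first by ring.
rewrite !mxE; have /negPf -> : f != ev j; last by rewrite mulr0.
apply: contraNneq nj => e; apply/eqP/enum_val_inj.
by rewrite enum_rankK_in // e.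
Qed.

Lemma cut_bar_sym : bar_sym bar x (\det (walk_mx + cycle_c *m cycle_r)).
Proof.
apply: det_row2 => // g.
exists g, 1, (finv sg g), (- ((finv sg g \notin degenerate_cycles)%:R * x (w (finv sg g)))).
split.
- by right; apply: monomial1.
- apply: mon0N => //; apply: mon0M => //; last by right; apply: monomialx.
  by case: (_ \notin _); [right; apply: monomial1 | left].
move=> f; rewrite cut_mxE mul1r eq_sym; congr (_ + _).
rewrite mulNr; have [->|nf] := eqVneq f (finv sg g).
  by rewrite f_finv // eqxx.
rewrite (_ : g == sg f = false) ?mulr0 //; apply: contraNF nf => /eqP ->.
by rewrite finv_f.
Qed.

Lemma cut_det_neq0 : \det (walk_mx + cycle_c *m cycle_r) != 0.
Proof.
apply/negP => /det0Pc[v v0 cut_v]; case/negP: v0; apply/eqP/colP => f0.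
have vS f : v (sg f) 0 = (f \notin degenerate_cycles)%:R * x (w f) * v f 0.
  have /colP/(_ (sg f)) := cut_v; rewrite !mxE => /eqP.
  under eq_bigr do rewrite cut_mxE mulrBl.
  rewrite sumrB subr_eq0 (bigD1 (sg f)) //= eqxx mul1r big1 ?addr0; last first.
    by move=> f' /negPf nf; rewrite eq_sym nf mul0r.
  rewrite (bigD1 f) //= eqxx mulr1 big1 ?addr0 => [/eqP //|f' nf].
  by rewrite (inj_eq sg_inj) eq_sym (negPf nf) mulr0 mul0r.
rewrite [RHS]mxE; have [df|ndf] := boolP (degenerate f0).
  pose r := base f0; have rL : r \in degenerate_cycles.
    by rewrite inE degenerate_base df andbT; apply/eqP/root_root/fconnect_sym.
  have v0 k : v (iter k.+1 sg r) 0 = 0.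
    elim: k => [|k IHk]; first by rewrite /= vS rL /= !mul0r.
    by rewrite iterS vS IHk mulr0.
  have := v0 (findex sg r f0 + (fingraph.order sg r).-1)%N; rewrite -addnS prednK ?order_gt0 //.
  by rewrite iterD (iter_order sg_inj) iter_findex_base.
have [k itk hk] : exists2 k, iter k sg f0 = f0 & hol f0 k != 0.
  apply: contrapT => H; move/asboolPn: ndf; apply => k itk; apply/eqP/negPn/negP => hk.
  by apply: H; exists k.
have vk l : v (iter l sg f0) 0 = x (hol f0 l) * v f0 0.
  elim: l => [|l IHl]; first by rewrite /hol big_ord0 x0 mul1r.
  rewrite iterS vS IHl holS xD inE degenerate_iter.
  by rewrite (negPf ndf) andbF mul1r; ring.
have /eqP := vk k; rewrite itk -subr_eq0 -{1}[v f0 0]mul1r -mulrBl mulf_eq0.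
case/orP => /eqP // /eqP; rewrite subr_eq0 eq_sym => /eqP/x_inj/eqP.
by rewrite (negPf hk).
Qed.

Record null_frame n (P : 'M[R]_n) d := NullFrame {
  nf_s : 'M[R]_(n, d); nf_l : 'M[R]_(d, n);
  nf_c : 'M[R]_(n, d); nf_r : 'M[R]_(d, n);
  nf_Ps : P *m nf_s = 0;
  nf_lP : nf_l *m P = 0;
  nf_rs : nf_r *m nf_s = 1%:M;
  nf_lc : nf_l *m nf_c = 1%:M;
  nf_sym : bar_sym bar x (\det (P + nf_c *m nf_r));
  nf_det : \det (P + nf_c *m nf_r) != 0;
  nf_s1 : forall (j : 'I_d) f, row1 x (nf_s f);
  nf_l1 : forall (j : 'I_d) f, row1 x (nf_l^~ f);
  nf_c1 : forall j, row1 x (nf_c^~ j)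
}.

Lemma signed_walk_frame (e : 'I_N -> bool) : exists d, inhabited (null_frame
  (\matrix_(g, f) ((g == f)%:R
     - (-1) ^+ (e f (+) e (sg f)) * x (w f) * (g == sg f)%:R)) d).
Proof.
pose E : 'M[R]_N := diag_mx (\row_f (-1) ^+ e f).
have EE : E *m E = 1%:M.
  rewrite /E mulmx_diag -[RHS]diag_const_mx; congr diag_mx.
  by apply/rowP => i; rewrite !mxE -signr_addb addbb.
set P := (\matrix_(g, f) _); have PE : P = E *m walk_mx *m E.
  apply/matrixP => g f; rewrite mul_mx_diag mul_diag_mx !mxE.
  have [->|nf] := eqVneq g f.
    rewrite mulrBr mulrBl mulr1 -signr_addb addbb; congr (_ - _).
    case: eqP => [ef|]; last by rewrite !mulr0 mul0r.
    by rewrite -ef addbb !mulr1 mul1r mulrAC -signr_addb addbb mul1r.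
  case: eqP => [->|]; last by rewrite !(mulr0, subr0) mul0r.
  by rewrite signr_addb !sub0r !mulr1; ring.
have row1E n f p (g : 'I_n -> R) : p = (-1) ^+ e f -> row1 x g -> row1 x (fun k => p * g k).
  move=> -> [j [q [mq gE]]]; exists j, ((-1) ^+ e f * q); split.
    by apply: mon0M => //; right; apply: monomial_sign.
  by move=> k; rewrite gE mulrA.
have row1_eq n (g h : 'I_n -> R) : g =1 h -> row1 x g -> row1 x h.
  by move=> gh [j [q [mq gE]]]; exists j, q; split=> // k; rewrite -gh.
have cyc1 (j0 : 'I_m) f (p : C) (g : 'I_m -> R) :
    (forall k, g k = x p * (degenerate f && (base f == ev k))%:R) -> row1 x g.
  move=> gE; have [j jE|nj] := pickP (fun j => degenerate f && (base f == ev j)).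
    exists j, (x p); split; first by right; apply: monomialx.
    move=> k; rewrite gE; case/andP: jE => -> /eqP -> /=.
    by rewrite (inj_eq enum_val_inj) eq_sym.
  by exists j0, 0; split; [left|move=> k; rewrite gE nj mulr0 mul0r].
exists m; constructor.
pose S := E *m cycle_s; pose L := cycle_l *m E; pose c1 := E *m cycle_c.
pose r1 := cycle_r *m E.
have dE : P + c1 *m r1 = E *m (walk_mx + cycle_c *m cycle_r) *m E.
  by rewrite PE mulmxDr mulmxDl !mulmxA.
have detE : \det E * \det E = 1 by rewrite -det_mulmx EE det1.
apply: (@NullFrame _ P m S L c1 r1).
- by rewrite PE /S mulmxA -(mulmxA _ E E) EE mulmx1 -mulmxA walk_s mulmx0.
- by rewrite PE /L !mulmxA -(mulmxA _ E E) EE mulmx1 l_walk mul0mx.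
- by rewrite /r1 /S mulmxA -(mulmxA _ E E) EE mulmx1 r_s.
- by rewrite /L /c1 mulmxA -(mulmxA _ E E) EE mulmx1 l_c.
- by rewrite dE !det_mulmx mulrAC detE mul1r; apply: cut_bar_sym.
- by rewrite dE !det_mulmx mulrAC detE mul1r cut_det_neq0.
- move=> j0 f; apply: (row1_eq _ (fun k => (-1) ^+ e f * cycle_s f k)).
    by move=> k; rewrite /S /E mul_diag_mx !mxE.
  apply: (row1E _ f) => //; apply: (cyc1 j0 f) => k.
  by rewrite mxE.
- move=> j0 f; apply: (row1_eq _ (fun k => (-1) ^+ e f * cycle_l k f)).
    by move=> k; rewrite /L /E mul_mx_diag !mxE mulrC.
  apply: (row1E _ f) => //; apply: (cyc1 j0 f) => k.
  by rewrite mxE.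
- move=> j; exists (sg (ev j)), ((-1) ^+ e (sg (ev j)) * x (w (ev j))); split.
    by apply: mon0M => //; right; [apply: monomial_sign | apply: monomialx].
  move=> k; rewrite /c1 /E mul_diag_mx !mxE.
  by case: eqP => [->|_]; rewrite ?mulr1 ?mulr0.
Qed.

End WeightedPermutation.

(** * The duality argument *)

(* A veering triangulation with [n] tetrahedra, read off the flat quadrilaterals:
   [eb t], [ea t] are the edges of the bottom and top diagonals of [t], of colours
   [be t], [al t] (blue is [true]), and [eq_ t m w] is its equatorial edge between
   vertex N or S ([m = false] or [true]) and vertex W or E ([w = false] or
   [true]).  The [c?] fields give the position of these edges in the cover, in
   units where [t] sits at [0].  Crossing the top face [(t, w)] of [t], the one
   with vertices N, S, [w], leads to the bottom face [gl (t, w) = (t', m)] of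
   [t'], the one with vertices [m], W, E, with displacement [dl (t, w)]; [gl_U],
   [gl_L] and [gl_S] identify the three edges of these faces. *)
Record flat_veering (C : zmodType) (n : nat) := FlatVeering {
  eb : 'I_n -> 'I_n; cb : 'I_n -> C;
  ea : 'I_n -> 'I_n; ca : 'I_n -> C;
  eq_ : 'I_n -> bool -> bool -> 'I_n; cq : 'I_n -> bool -> bool -> C;
  be : 'I_n -> bool; al : 'I_n -> bool; ec : 'I_n -> bool;
  gl : 'I_n * bool -> 'I_n * bool; dl : 'I_n * bool -> C;
  eb_inj : injective eb;
  ea_inj : injective ea;
  gl_inj : injective gl;
  ec_b : forall t, ec (eb t) = be t;
  ec_a : forall t, ec (ea t) = al t;
  ec_q : forall t m w, ec (eq_ t m w) = m (+) w;
  gl_col : forall t w, be (gl (t, w)).1 = al t;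
  gl_U : forall t w, let: (t', m) := gl (t, w) in
    eb t' = eq_ t (w (+) al t) w /\ cb t' + dl (t, w) = cq t (w (+) al t) w;
  gl_L : forall t w, let: (t', m) := gl (t, w) in
    eq_ t' m (m (+) be t') = ea t /\ cq t' m (m (+) be t') + dl (t, w) = ca t;
  gl_S : forall t w, let: (t', m) := gl (t, w) in
    eq_ t' m (~~ (m (+) be t')) = eq_ t (~~ (w (+) al t)) w /\
    cq t' m (~~ (m (+) be t')) + dl (t, w) = cq t (~~ (w (+) al t)) w
}.

Lemma xnorK (a b : bool) : ~~ (~~ (a (+) b) (+) b) = a.
Proof. by case: a b => [] []. Qed.

Definition ladder C n (v : flat_veering C n) (f : 'I_n * bool) :=
  gl v (f.1, ~~ (f.2 (+) be v f.1)).

(* [hw t m w] records how the edge [eq_ t m w] climbs to the tetrahedron having it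
   as bottom diagonal, and which of the ends W, E of that diagonal is the end [w]
   of the edge; [hn] does the same for the end [m]. *)
Record climbing C n (v : flat_veering C n) := Climbing {
  hw : 'I_n -> bool -> bool -> 'I_n * bool;
  hn : 'I_n -> bool -> bool -> 'I_n * bool;
  hw_e : forall t m w, eb v (hw t m w).1 = eq_ v t m w;
  hn_hw : forall t m w, hn t m w = ((hw t m w).1, ~~ (hw t m w).2);
  hw_U : forall t w, let: (t', m) := gl v (t, w) in
    hw t (w (+) al v t) w = (t', ~~ (m (+) be v t'));
  hw_S : forall t w, let: (t', m) := gl v (t, w) in
    hw t (~~ (w (+) al v t)) w = hw t' m (~~ (m (+) be v t'));
  hinge : forall f, exists k,
    let t := (iter k (ladder v) f).1 in al v t != be v t
}.

Record opposite C n (v v' : flat_veering C n) : Prop := Opposite {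
  op_eb : eb v' =1 ea v; op_cb : cb v' =1 ca v;
  op_ea : ea v' =1 eb v; op_ca : ca v' =1 cb v;
  op_eq : forall t m w, eq_ v' t w m = eq_ v t m w;
  op_cq : forall t m w, cq v' t w m = cq v t m w;
  op_be : be v' =1 al v; op_al : al v' =1 be v; op_ec : ec v' =1 ec v;
  op_gl : forall f, gl v' (gl v f) = f;
  op_dl : forall f, dl v' (gl v f) = - dl v f
}.

Section Abstract.
Variables (C : zmodType) (R : idomainType).
Variables (bar : {rmorphism R -> R}) (x : C -> R).
Hypotheses (x0 : x 0 = 1) (xD : forall c d, x (c + d) = x c * x d).
Hypothesis (bar_x : forall c, bar (x c) = x (- c)).
Hypothesis (x_inj : forall c, x c = 1 -> c = 0).
Hypothesis (barK : involutive bar).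
Hypothesis bar_sym_sq : forall p u, p != 0 -> monomial x u ->
  bar p * bar p = u * (p * p) -> bar_sym bar x p.

Variable n : nat.
Notation ved := (flat_veering C n).

Definition fc (k : 'I_(n + n)) : 'I_n * bool :=
  match split k with inl i => (i, false) | inr i => (i, true) end.
Definition fk (f : 'I_n * bool) : 'I_(n + n) :=
  if f.2 then rshift n f.1 else lshift n f.1.
Lemma fcK : cancel fc fk.
Proof. by move=> k; rewrite /fc; case: split_ordP => i ->. Qed.
Lemma fkK : cancel fk fc.
Proof.
case=> i [] /=; rewrite /fc /fk /=; case: split_ordP => j.
- by move=> /eqP; rewrite eq_rlshift.
- by move=> /rshift_inj ->.
- by move=> /lshift_inj ->.
- by move=> /eqP; rewrite eq_lrshift.
Qed.

Lemma sum_fc (V : zmodType) (F : 'I_(n + n) -> V) :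
  \sum_k F k = \sum_t (F (fk (t, false)) + F (fk (t, true))).
Proof. by rewrite big_split big_split_ord. Qed.

Definition vec (o : 'I_n) (c : C) : 'cV[R]_n := x c *: delta_mx o 0.

Lemma vecE o c e : vec o c e 0 = x c * (e == o)%:R.
Proof. by rewrite !mxE eqxx andbT. Qed.

Definition star m k (A : 'M[R]_(m, k)) : 'M[R]_(k, m) := (map_mx bar A)^T.
Lemma starE m k (A : 'M[R]_(m, k)) i j : star A i j = bar (A j i).
Proof. by rewrite !mxE. Qed.
Lemma starM m k l (A : 'M[R]_(m, k)) (B : 'M_(k, l)) :
  star (A *m B) = star B *m star A.
Proof. by rewrite /star map_mxM trmx_mul. Qed.
Lemma starD m k (A B : 'M[R]_(m, k)) : star (A + B) = star A + star B.
Proof. by rewrite /star map_mxD linearD. Qed.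
Lemma starK m k (A : 'M[R]_(m, k)) : star (star A) = A.
Proof. by apply/matrixP => i j; rewrite !starE barK. Qed.
Lemma det_star m (A : 'M[R]_m) : \det (star A) = bar (\det A).
Proof. by rewrite /star det_tr det_map_mx. Qed.

Section Matrices.
Variable v : ved.

Definition vb t := vec (eb v t) (cb v t).
Definition va t := vec (ea v t) (ca v t).
Definition vq t m w := vec (eq_ v t m w) (cq v t m w).
Definition dcol (f : 'I_n * bool) : 'cV[R]_n :=
  vb f.1 - vq f.1 f.2 false - vq f.1 f.2 true.
Definition dlow (f : 'I_n * bool) : 'cV[R]_n :=
  va f.1 - vq f.1 false f.2 - vq f.1 true f.2.
Definition Dm : 'M[R]_(n, n + n) := \matrix_(e, k) dcol (fc k) e 0.
Definition Dop : 'M[R]_(n, n + n) := \matrix_(e, k) dlow (fc k) e 0.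

Definition sgf (k : 'I_(n + n)) := fk (ladder v (fc k)).
Definition wf (k : 'I_(n + n)) :=
  dl v ((fc k).1, ~~ ((fc k).2 (+) be v (fc k).1)).
Definition ef (k : 'I_(n + n)) := be v (fc k).1.
Definition Pm : 'M[R]_(n + n) := \matrix_(g, f) ((g == f)%:R
     - (-1) ^+ (ef f (+) ef (sgf f)) * x (wf f) * (g == sgf f)%:R).

Definition wcol t : 'cV[R]_n := vb t + (-1) ^+ (al v t (+) be v t) *: va t
  - vq t false (be v t) - vq t true (~~ be v t).
Definition Wm : 'M[R]_n := \matrix_(e, t) wcol t e 0.
Definition Bm : 'M[R]_n := \matrix_(e, t) vb t e 0.
Definition pim : 'M[R]_(n, n + n) := row_mx 1%:M 1%:M.
Definition iotam : 'M[R]_(n + n, n) := col_mx 1%:M 0.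
Definition kapm : 'M[R]_(n + n, n) := col_mx 1%:M (- 1%:M).
Definition Km := Pm *m kapm.
Definition Xm := Wm *m star Bm.
Definition XY d (c : 'M[R]_(n + n, d)) (r : 'M[R]_(d, n + n)) :=
  Xm + Dm *m c *m (r *m star Dop).
Definition Om d (c : 'M[R]_(n + n, d)) (r : 'M[R]_(d, n + n)) :=
  \det (Pm + c *m (r *m star Dop *m Bm *m pim)).

Lemma dcol_gl t w : x (dl v (t, w)) *: dcol (gl v (t, w)) =
  vq t (w (+) al v t) w - va t - vq t (~~ (w (+) al v t)) w.
Proof.
have := gl_U v t w; have := gl_L v t w; have := gl_S v t w.
have vecD o c d : x d *: vec o c = vec o (c + d).
  by rewrite /vec scalerA xD mulrC.
case: (gl v (t, w)) => s m [eS cS] [eL cL] [eU cU].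
rewrite /dcol !scalerBr !vecD /= eU cU -/(vq _ _ _).
rewrite /va -eL -cL [in RHS]/vq -eS -cS.
case: (m (+) be v s) => /=; last by rewrite -addrA.
by rewrite -!addrA; congr (_ + _); rewrite addrC.
Qed.

Lemma ladder_inj : injective (ladder v).
Proof.
case=> [t m] [t1 m1] /gl_inj [<-] /eqP; rewrite (inj_eq negb_inj).
by case: (be v t) m m1 => [] [] [].
Qed.

Lemma sgf_inj : injective sgf.
Proof.
by move=> k l /(can_inj fkK)/ladder_inj/(can_inj fcK).
Qed.

Lemma DP : Dm *m Pm = Wm *m pim.
Proof.
apply/matrixP => e k; rewrite !mxE.
transitivity (Dm e k - (-1) ^+ (ef k (+) ef (sgf k)) * x (wf k) * Dm e (sgf k)).
  under eq_bigr do rewrite [Pm _ _]mxE mulrBr.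
  rewrite sumrB (bigD1 k) //= eqxx mulr1 big1 ?addr0; last first.
    by move=> f' /negPf nf; rewrite nf mulr0.
  congr (_ - _); rewrite (bigD1 (sgf k)) //= eqxx mulr1 big1 ?addr0; last first.
    by move=> f' /negPf nf; rewrite nf !mulr0.
  by rewrite mulrC.
transitivity (Wm e (fc k).1).
  rewrite !mxE /sgf /wf /ef !fkK /ladder; case: (fc k) => t m /=.
  set w := ~~ _; rewrite gl_col.
  have := congr1 (fun A : 'cV_n => A e 0) (dcol_gl t w).
  rewrite !mxE -mulrA => ->; rewrite /w {w}.
  by case: (be v t) (al v t) m => [] [] [] /=; rewrite ?expr0 ?expr1; ring.
rewrite -(fcK k); case: (fc k) => t m; rewrite fkK /=.
rewrite (bigD1 t) //= big1 ?addr0; last first.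
  move=> i /negPf ni; rewrite /fk /=; case: m;
  by rewrite ?row_mxEl ?row_mxEr !mxE ni mulr0.
by rewrite /fk; case: m; rewrite /= ?row_mxEl ?row_mxEr [1%:M _ _]mxE eqxx mulr1.
Qed.

Lemma pi_kap : pim *m kapm = 0.
Proof. by rewrite mul_row_col mulmxN mulmx1 addrN. Qed.
Lemma pi_iota : pim *m iotam = 1%:M.
Proof. by rewrite mul_row_col mulmx0 mulmx1 addr0. Qed.

Lemma DK : Dm *m Km = 0.
Proof. by rewrite /Km mulmxA DP -mulmxA pi_kap mulmx0. Qed.

Lemma BB : star Bm *m Bm = 1%:M.
Proof.
apply/matrixP => t s; rewrite !mxE (bigD1 (eb v t)) //= big1 ?addr0; last first.
  by move=> e /negPf ne; rewrite starE !mxE ne mulr0 rmorph0 mul0r.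
rewrite starE !mxE !eqxx /= mulr1 bar_x andbT (inj_eq (@eb_inj _ _ v)).
by case: eqP => [->|_]; rewrite ?mulr0 // mulr1 -xD addNr x0.
Qed.

Lemma BB' : Bm *m star Bm = 1%:M.
Proof. exact: mulmx1C BB. Qed.

Definition unit_det := \det (row_mx (iotam *m star Bm) kapm).

Lemma unit_detE : unit_det = (-1) ^+ odd n * \det (star Bm).
Proof.
rewrite /unit_det /iotam mul_col_mx mul1mx mul0mx -block_mxEh det_ublock.
by rewrite -scaleN1r detZ det1 mulr1 mulrC signr_odd.
Qed.

Lemma unit_det_neq0 : unit_det != 0.
Proof.
rewrite unit_detE mulf_neq0 ?signr_eq0 //; apply/eqP => d0.
by have /eqP := congr1 determinant BB; rewrite det_mulmx d0 mul0r det1 eq_sym oner_eq0.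
Qed.

Lemma unit_det_sym : bar_sym bar x unit_det.
Proof.
rewrite unit_detE; apply: (bar_symMl x0 xD bar_x).
  exact: monomial_sign.
apply: (det_row2 x0 xD bar_x) => t; apply: row1_row2.
exists (eb v t), (x (- cb v t)); split; first by right; apply: monomialx.
by move=> e; rewrite starE !mxE andbT rmorphM bar_x rmorph_nat.
Qed.

Lemma XY_det d (c : 'M[R]_(n + n, d)) (r : 'M[R]_(d, n + n)) (f : 'M[R]_(n + n, n)) :
  \det (XY c r) * \det (row_mx f Km) = \det (Dm *m f) * (Om c r * unit_det).
Proof.
set R0 := r *m star Dop.
have := plucker (Pm *m iotam *m star Bm + c *m R0) f DK.
rewrite mulmxDr !mulmxA DP -(mulmxA _ pim) pi_iota mulmx1 -/Xm.
rewrite -(mulmxA (Dm *m c)) -/R0 => ->; congr (_ * _).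
rewrite -det_mulmx; congr (\det _); rewrite mul_mx_row.
congr (row_mx _ _).
  rewrite mulmxDl !mulmxA -/R0 -[_ *m pim *m iotam]mulmxA pi_iota mulmx1.
  by rewrite -(mulmxA _ Bm) BB' mulmx1.
by rewrite mulmxDl -!mulmxA pi_kap !mulmx0 addr0.
Qed.

Lemma Km_row2 k : row2 x (Km k).
Proof.
pose g := finv sgf k.
pose p i : R := if (fc i).2 then -1 else 1.
have kapE i t : kapm i t = p i * (t == (fc i).1)%:R.
  rewrite /kapm /p -{1}(fcK i); case: (fc i) => s [];
  by rewrite /fk /= ?col_mxEu ?col_mxEd !mxE eq_sym ?mul1r ?mulN1r.
have mp i : mon0 x (p i).
  rewrite /p; right; have m1 := monomial1 x0.
  by case: ifP => _ //; apply: monomialN.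
exists (fc k).1, (p k), (fc g).1,
  (- ((-1) ^+ (ef g (+) ef k) * x (wf g) * p g)); split=> //.
  apply/(mon0N x0 xD)/(mon0M xD) => //; apply/(mon0M xD); right.
    exact: monomial_sign.
  exact: monomialx.
move=> t; rewrite mxE -[k in LHS](f_finv sgf_inj) -/g.
under eq_bigr do rewrite mxE mulrBl.
rewrite sumrB (bigD1 (sgf g)) //= eqxx mul1r big1 ?addr0; last first.
  by move=> i /negPf ni; rewrite eq_sym ni mul0r.
rewrite (bigD1 g) //= eqxx mulr1 big1 ?addr0; last first.
  by move=> i ni; rewrite (inj_eq sgf_inj) eq_sym (negPf ni) mulr0 mul0r.
by rewrite /g f_finv ?kapE ?mulNr -?mulrA //; apply: sgf_inj.
Qed.

Lemma Km_inj : (forall z : 'I_n -> R, (forall t w, exists b : bool,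
      z (gl v (t, w)).1 = (-1) ^+ b * x (dl v (t, w)) * z t) -> z =1 fun=> 0) ->
  forall z : 'cV[R]_n, Km *m z = 0 -> z = 0.
Proof.
move=> nontriv z; rewrite /Km -mulmxA => Pz; apply/colP => t; rewrite [RHS]mxE.
apply: (nontriv (fun t => z t 0)) => {t} t w; set y := kapm *m z in Pz.
have yE i : y i 0 = (-1) ^+ (fc i).2 * z (fc i).1 0.
  rewrite /y /kapm mul_col_mx mul1mx mulNmx mul1mx -{1}(fcK i).
  by case: (fc i) => u []; rewrite /fk /= ?col_mxEu ?col_mxEd ?mxE ?expr1 ?expr0 ?mulN1r ?mul1r.
pose k := fk (t, ~~ (w (+) be v t)).
have kE : sgf k = fk (gl v (t, w)) by rewrite /sgf /k fkK /ladder /= xnorK.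
have wE : wf k = dl v (t, w) by rewrite /wf /k fkK /= xnorK.
have /colP/(_ (sgf k)) := Pz; rewrite !mxE.
under eq_bigr do rewrite mxE mulrBl.
rewrite sumrB (bigD1 (sgf k)) //= eqxx mul1r big1 ?addr0; last first.
  by move=> i /negPf ni; rewrite eq_sym ni mul0r.
rewrite (bigD1 k) //= eqxx mulr1 big1 ?addr0; last first.
  by move=> i ni; rewrite (inj_eq sgf_inj) eq_sym (negPf ni) mulr0 mul0r.
move/eqP; rewrite subr_eq0 !yE {1 2}kE wE !fkK ?/k ?fkK /= => /eqP zE.
exists ((gl v (t, w)).2 (+) (ef k (+) ef (sgf k)) (+) ~~ (w (+) be v t)).
rewrite -[LHS](signrMK (gl v (t, w)).2) zE !signr_addb; ring.
Qed.

Section Climb.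
Variables (cl : climbing v) (d : nat) (s : 'M[R]_(n + n, d)).
Hypothesis Ps : Pm *m s = 0.

Section Column.
Variable j : 'I_d.

(* The row of [s] at the face [f], normalised so that the ladder carries it along
   without signs. *)
Definition us (f : 'I_n * bool) := (-1) ^+ be v f.1 * s (fk f) j.
Definition half (o : 'I_n * bool) (c : C) :=
  x (cb v o.1 - c) * us (o.1, ~~ (o.2 (+) be v o.1)).

Lemma us_ladder t w :
  us (gl v (t, w)) = x (dl v (t, w)) * us (t, ~~ (w (+) be v t)).
Proof.
pose f : 'I_n * bool := (t, ~~ (w (+) be v t)).
have fE : ladder v f = gl v (t, w).
  by rewrite /ladder /= xnorK.
have wE : wf (fk f) = dl v (t, w).
  by rewrite /wf fkK /= xnorK.
have /matrixP/(_ (sgf (fk f)) j) := Ps; rewrite !mxE.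
under eq_bigr do rewrite mxE mulrBl.
rewrite sumrB (bigD1 (sgf (fk f))) //= eqxx mul1r big1 ?addr0; last first.
  by move=> i /negPf ni; rewrite eq_sym ni mul0r.
rewrite (bigD1 (fk f)) //= eqxx mulr1 big1 ?addr0; last first.
  by move=> i ni; rewrite (inj_eq sgf_inj) eq_sym (negPf ni) mulr0 mul0r.
move/eqP; rewrite subr_eq0 => /eqP; rewrite wE {1}/sgf fkK fE => sE.
rewrite /us sE /ef /sgf !fkK fE /= signr_addb.
rewrite -[RHS](signrMK (be v (gl v (t, w)).1)); ring.
Qed.

Lemma halfD o c e : half o (c + e) = x (- e) * half o c.
Proof. by rewrite /half opprD addrA (xD (_ - c)) [x _ * x _]mulrC mulrA. Qed.

Lemma half_U t w : half (hw cl t (w (+) al v t) w) (cq v t (w (+) al v t) w)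
  = us (t, ~~ (w (+) be v t)).
Proof.
have := hw_U cl t w; have := gl_U v t w; have := us_ladder t w.
case: (gl v (t, w)) => t1 m E [_ cE] ->; rewrite /half /=.
by rewrite xnorK E mulrA -xD -cE opprD addrA addrN add0r addNr x0 mul1r.
Qed.

(* Along the ladder, [half] at the head [w] is transported unchanged; it is known
   as soon as the two diagonals of a tetrahedron have different colours, since the
   third edge of one face is then the upper large edge of the next. *)
Lemma half_S t w : half (hw cl t (~~ (w (+) al v t)) w) (cq v t (~~ (w (+) al v t)) w)
  = us (t, ~~ (w (+) be v t)).
Proof.
have step u z t1 m : gl v (u, z) = (t1, m) ->
    half (hw cl t1 m (~~ (m (+) be v t1))) (cq v t1 m (~~ (m (+) be v t1)))
      = us (t1, m) ->
    half (hw cl u (~~ (z (+) al v u)) z) (cq v u (~~ (z (+) al v u)) z)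
      = us (u, ~~ (z (+) be v u)).
  move=> E; have := hw_S cl u z; have := gl_S v u z; have := us_ladder u z.
  rewrite E => uE [_ <-] ->; rewrite halfD uE => ->.
  by rewrite mulrA -xD addNr x0 mul1r.
have [k] := hinge cl (gl v (t, w)).
elim: k t w => [|k IHk] t w /=; case E: (gl v (t, w)) => [t1 m] /= hg;
  apply: (step _ _ _ _ E); set w1 := ~~ (m (+) be v t1).
  have -> : m = w1 (+) al v t1.
    by rewrite /w1; case: (al v t1) (be v t1) m {w1 E} hg => [] [] [].
  rewrite half_U; congr (us (_, _)).
  by rewrite /w1; case: (al v t1) (be v t1) m {w1 E} hg => [] [] [].
have [eqc|neqc] := eqVneq (al v t1) (be v t1); last first.
  have -> : m = w1 (+) al v t1.
    by rewrite /w1; case: (al v t1) (be v t1) m {w1 E hg} neqc => [] [] [].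
  rewrite half_U; congr (us (_, _)).
  by rewrite /w1; case: (al v t1) (be v t1) m {w1 E hg} neqc => [] [] [].
have mE : m = ~~ (w1 (+) al v t1) by rewrite eqc xnorK.
rewrite {1 2}mE IHk ?/w1 ?xnorK //.
by move: hg; rewrite -iterS iterSr.
Qed.

Lemma half_hw t m w : half (hw cl t m w) (cq v t m w) = us (t, ~~ (w (+) be v t)).
Proof.
have [->|nm] := eqVneq m (w (+) al v t); first exact: half_U.
have -> : m = ~~ (w (+) al v t) by case: m (w (+) _) nm => [] [].
exact: half_S.
Qed.

Let Y : 'M[R]_(n, d) := Bm *m (pim *m s).
Definition pairing (u : 'cV[R]_n) := (star u *m Y) 0 j.

Lemma pairing_vec o c : pairing (vec (eb v o.1) c) =
  (-1) ^+ be v o.1 * (half o c + half (o.1, ~~ o.2) c).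
Proof.
case: o => t k /=; rewrite /pairing mxE (bigD1 (eb v t)) //= big1 ?addr0; last first.
  by move=> e /negPf ne; rewrite starE vecE ne mulr0 rmorph0 mul0r.
rewrite starE vecE eqxx mulr1 bar_x /Y mulmxA mxE.
have -> : \sum_i (Bm *m pim) (eb v t) i * s i j =
   x (cb v t) * (s (fk (t, false)) j + s (fk (t, true)) j).
  transitivity (\sum_i Bm (eb v t) (fc i).1 * s i j).
    apply: eq_bigr => i _; congr (_ * _); rewrite mxE.
    have piE (l : 'I_n) : pim l i = (l == (fc i).1)%:R.
      rewrite -{1}(fcK i); case: (fc i) => u [];
      by rewrite /fk /= ?row_mxEl ?row_mxEr !mxE.
    rewrite (bigD1 (fc i).1) //= piE eqxx mulr1 big1 ?addr0 // => l /negPf nl.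
    by rewrite piE nl mulr0.
  rewrite sum_fc (bigD1 t) //= big1 ?addr0; last first.
    move=> u nu; rewrite !fkK /= !mxE /= (inj_eq (@eb_inj _ _ v)).
    by rewrite eq_sym (negPf nu) /= mulr0 !mul0r addr0.
  by rewrite !fkK /= !mxE !eqxx /= mulr1 mulrDr.
rewrite /half /us /= xD; case: k (be v t) => [] [] /=;
  rewrite ?expr0 ?expr1; ring.
Qed.

Lemma pairing_D u1 u2 : pairing (u1 + u2) = pairing u1 + pairing u2.
Proof. by rewrite /pairing starD mulmxDl mxE. Qed.
Lemma pairing_Z c (u : 'cV[R]_n) : pairing (c *: u) = bar c * pairing u.
Proof.
rewrite /pairing !mxE mulr_sumr; apply: eq_bigr => i _.
by rewrite !starE mxE rmorphM mulrA.
Qed.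
Lemma pairing_N u : pairing (- u) = - pairing u.
Proof. by rewrite -scaleN1r pairing_Z rmorphN1 mulN1r. Qed.

Lemma pairing_q t m w : pairing (vq t m w) = (-1) ^+ (m (+) w) *
  (us (t, ~~ (w (+) be v t)) + half (hn cl t m w) (cq v t m w)).
Proof.
rewrite /vq -(hw_e cl) pairing_vec -hn_hw half_hw.
by rewrite -(ec_b v) (hw_e cl) ec_q.
Qed.

Lemma pairing_b t : pairing (vb t) = (-1) ^+ be v t * (us (t, false) + us (t, true)).
Proof.
rewrite /vb (pairing_vec (t, be v t)) /half /= subrr x0 !mul1r addbb /= addrC.
by case: (be v t).
Qed.

(* The four half-edges at the two endpoints of the upper large edge cancel. *)
Lemma pairing_dlow t w : let: (t1, m) := gl v (t, w) in
  pairing (dlow (t, w)) = (-1) ^+ be v t1 * x (- dl v (t, w)) *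
    (half (hn cl t1 m (m (+) be v t1)) (cq v t1 m (m (+) be v t1))
     + half (hn cl t1 m (~~ (m (+) be v t1))) (cq v t1 m (~~ (m (+) be v t1)))).
Proof.
have vecD o c e : vec o (c + e) = x e *: vec o c.
  by rewrite /vec scalerA xD mulrC.
have : dlow (t, w) = va t - vq t (w (+) al v t) w - vq t (~~ (w (+) al v t)) w.
  rewrite /dlow /=; case: (w (+) _) => //=.
  by rewrite -!addrA; congr (_ + _); rewrite addrC.
have := gl_U v t w; have := gl_L v t w; have := gl_S v t w.
case: (gl v (t, w)) => t1 m [eS cS] [eL cL] [eU cU].
rewrite /va /vq -eL -cL -eU -cU -eS -cS !vecD -!scalerBr -!/(vq _ _ _) -/(vb t1).
move=> ->; rewrite pairing_Z bar_x !(pairing_D, pairing_N) pairing_b !pairing_q.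
case: (be v t1) m {eS cS eL cL eU cU} => [] [] /=; rewrite ?expr0 ?expr1; ring.
Qed.

End Column.

Definition Jm : 'M[R]_(n + n, d) := star Dop *m (Bm *m (pim *m s)).

Lemma Jm_two h : exists p1 f1 p2 f2, [/\ monomial x p1, monomial x p2
  & forall j, Jm h j = p1 * s f1 j + p2 * s f2 j].
Proof.
have JE j : Jm h j = pairing j (dlow (fc h)).
  by rewrite /Jm /pairing !mxE; apply: eq_bigr => e _; rewrite !starE !mxE.
case E : (fc h) JE => [t w] JE; have vE j := pairing_dlow j t w.
case: (gl v (t, w)) vE => t1 m vE.
pose p (o : 'I_n * bool) c : R := (-1) ^+ be v t1 * x (- dl v (t, w)) * (x (cb v o.1 - c) *
   (-1) ^+ be v o.1).
have mp o c : monomial x (p o c).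
  have ms (b : bool) : monomial x ((-1) ^+ b : R) by apply: monomial_sign.
  have mx c1 : monomial x (x c1) by apply: monomialx.
  by rewrite /p; do ?apply: (monomialM xD).
exists (p (hn cl t1 m (m (+) be v t1)) (cq v t1 m (m (+) be v t1))).
exists (fk ((hn cl t1 m (m (+) be v t1)).1, ~~ ((hn cl t1 m (m (+) be v t1)).2
  (+) be v (hn cl t1 m (m (+) be v t1)).1))).
exists (p (hn cl t1 m (~~ (m (+) be v t1))) (cq v t1 m (~~ (m (+) be v t1)))).
exists (fk ((hn cl t1 m (~~ (m (+) be v t1))).1, ~~ ((hn cl t1 m (~~ (m (+) be v t1))).2
  (+) be v (hn cl t1 m (~~ (m (+) be v t1))).1))).
split=> // j; rewrite JE vE /half /us /p /=; ring.
Qed.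

Lemma Jm_row2 h : (forall f, row1 x (s f)) -> row2 x (Jm h).
Proof.
move=> s1; have [p1 [f1 [p2 [f2 [m1 m2 JE]]]]] := Jm_two h.
have [j1 [q1 [mq1 E1]]] := s1 f1; have [j2 [q2 [mq2 E2]]] := s1 f2.
exists j1, (p1 * q1), j2, (p2 * q2); split.
- by apply: mon0M => //; right.
- by apply: mon0M => //; right.
- by move=> k; rewrite JE E1 E2 !mulrA.
Qed.

Lemma Jm_row2l (q : nat) (c : 'M[R]_(q, n + n)) i : row1 x (c i) ->
  (forall f, row1 x (s f)) -> row2 x ((c *m Jm) i).
Proof.
move=> [h [p [mp cE]]] s1; have [j1 [q1 [j2 [q2 [m1 m2 JE]]]]] := Jm_row2 h s1.
exists j1, (p * q1), j2, (p * q2); split; [exact: mon0M|exact: mon0M|].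
move=> k; rewrite mxE (bigD1 h) //= big1 ?addr0; last first.
  by move=> l /negPf nl; rewrite cE nl mulr0 mul0r.
by rewrite cE eqxx mulr1 JE mulrDr !mulrA.
Qed.

Lemma Jm_inj (f : 'M[R]_(n + n, n)) (r : 'M[R]_(d, n + n)) :
  (forall z : 'cV[R]_n, Km *m z = 0 -> z = 0) -> \det (Dop *m f) != 0 ->
  r *m s = 1%:M -> forall z : 'cV[R]_d, Jm *m z = 0 -> z = 0.
Proof.
move=> Kinj fD rs z Jz; set y := Bm *m (pim *m (s *m z)).
have y0 : y = 0.
  have Dy : star (Dop *m f) *m y = 0.
    by rewrite starM -mulmxA (_ : star Dop *m y = 0) ?mulmx0 // -Jz /Jm /y !mulmxA.
  have : \det (star (Dop *m f)) != 0.
    by rewrite det_star; apply: contraNneq fD => e; rewrite -[\det _]barK e rmorph0.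
  by move/det0Pc => H; apply/eqP/negPn/negP => y0; apply: H; exists y.
have ps0 : pim *m (s *m z) = 0.
  by rewrite -[LHS]mul1mx -BB -mulmxA -/y y0 mulmx0.
pose u := usubmx (s *m z).
have szE : s *m z = kapm *m u.
  move: ps0; rewrite -[s *m z]vsubmxK -/u mul_row_col !mul1mx.
  move/eqP; rewrite addrC addr_eq0 => /eqP ->.
  by rewrite /kapm mul_col_mx mul1mx mulNmx mul1mx.
have u0 : u = 0.
  by apply: Kinj; rewrite /Km -mulmxA -szE mulmxA Ps mul0mx.
by rewrite -[z]mul1mx -rs -mulmxA szE u0 !mulmx0.
Qed.

End Climb.

Lemma Om_frame d (F : null_frame bar x Pm d) (c : 'M[R]_(n + n, d)) r :
  exists b : bool, Om c r = (-1) ^+ b *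
    \det (Pm + nf_c F *m nf_r F) * \det (nf_l F *m c) * \det (r *m Jm (nf_s F)).
Proof.
have [b bE] := det_perturb c (r *m star Dop *m Bm *m pim)
  (nf_Ps F) (nf_lP F) (nf_rs F) (nf_lc F).
by exists b; rewrite /Om bE /Jm !mulmxA.
Qed.

(* A matrix [c] with fewer columns than the corank of [Pm] cannot make it
   invertible. *)
Lemma Om_small d e (F : null_frame bar x Pm d) (c : 'M[R]_(n + n, e)) r :
  Om c r != 0 -> (d <= e)%N.
Proof.
move=> O0; rewrite leqNgt; apply/negP => led.
have inj (z : 'cV[R]_d) : (r *m Jm (nf_s F)) *m z = 0 -> z = 0.
  move=> Jz; rewrite -[z]mul1mx -(nf_rs F) -mulmxA.
  suff -> : nf_s F *m z = 0 by rewrite mulmx0.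
  apply/eqP/negPn/negP => sz0; move/det0Pc: O0; apply; exists (nf_s F *m z) => //.
  rewrite mulmxDl mulmxA (nf_Ps F) mul0mx add0r -mulmxA.
  by rewrite [X in c *m X](_ : _ = 0) ?mulmx0 // -Jz /Jm !mulmxA.
have [g [ginj _]] := rowsub_det_neq0 inj.
by have := max_card (mem (codom g)); rewrite card_codom // !card_ord leqNgt led.
Qed.

End Matrices.

Lemma XmE v : Xm v = \sum_t wcol v t *m star (vb v t).
Proof.
apply/matrixP => e e'; rewrite summxE !mxE; apply: eq_bigr => t _.
by rewrite [in RHS]mxE big_ord1 !starE [Wm _ _ _]mxE [Bm _ _ _]mxE.
Qed.

Lemma sum_bb v : \sum_t vb v t *m star (vb v t) = 1%:M.
Proof.
rewrite -(BB' v); apply/matrixP => e e'; rewrite summxE [RHS]mxE.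
apply: eq_bigr => t _.
by rewrite [LHS]mxE big_ord1 !starE [Bm _ _ _]mxE [in RHS]mxE.
Qed.

Lemma exists_border v d (F : null_frame bar x (Pm v) d) (f : 'M[R]_(n + n, n)) :
    climbing v -> (forall z : 'cV[R]_n, Km v *m z = 0 -> z = 0) ->
    \det (Dop v *m f) != 0 ->
  exists2 g : 'I_d -> 'I_(n + n), Om v (nf_c F) (rowsub g 1%:M) != 0
    & bar_sym bar x (Om v (nf_c F) (rowsub g 1%:M)).
Proof.
move=> cl Kinj fD; have Jinj := Jm_inj (nf_Ps F) Kinj fD (nf_rs F).
have [g [_ g0]] := rowsub_det_neq0 Jinj; exists g.
  have [b ->] := Om_frame F (nf_c F) (rowsub g 1%:M).
  by rewrite nf_lc det1 mulr1 -rowsubE !mulf_neq0 ?signr_eq0 ?nf_det.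
have [b ->] := Om_frame F (nf_c F) (rowsub g 1%:M).
rewrite nf_lc det1 mulr1 -rowsubE -mulrA; apply: bar_symMl => //.
  exact: monomial_sign.
apply: bar_symM => //; first exact: nf_sym.
apply: det_row2 => // i; have s1 := nf_s1 F i.
have [a [p [a' [q [mp mq JE]]]]] := Jm_row2 cl (nf_Ps F) (g i) s1.
by exists a, p, a', q; split=> // k; rewrite mxE JE.
Qed.

Section Duality.
Variables (v v' : ved).
Hypothesis op : opposite v v'.

Lemma vb_op t : vb v' t = va v t.
Proof. by rewrite /vb (op_eb op) (op_cb op). Qed.
Lemma va_op t : va v' t = vb v t.
Proof. by rewrite /va /vb (op_ea op) (op_ca op). Qed.
Lemma vq_op t m w : vq v' t w m = vq v t m w.
Proof. by rewrite /vq (op_eq op) (op_cq op). Qed.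

Lemma dcol_op f : dcol v' f = dlow v f.
Proof. by rewrite /dcol /dlow vb_op !vq_op. Qed.
Lemma dlow_op f : dlow v' f = dcol v f.
Proof. by rewrite /dcol /dlow va_op !vq_op. Qed.
Lemma Dm_op : Dm v' = Dop v.
Proof. by apply/matrixP => e k; rewrite [LHS]mxE [RHS]mxE dcol_op. Qed.
Lemma Dop_op : Dop v' = Dm v.
Proof. by apply/matrixP => e k; rewrite [LHS]mxE [RHS]mxE dlow_op. Qed.

Lemma sum_glue :
  \sum_t (vq v t false (be v t) + vq v t true (~~ be v t)) *m star (vb v t) =
  \sum_t va v t *m star (vq v t (al v t) false + vq v t (~~ al v t) true).
Proof.
pose G (f : 'I_n * bool) := vq v f.1 f.2 (f.2 (+) be v f.1) *m star (vb v f.1).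
transitivity (\sum_f G f).
  rewrite -(pair_bigA _ (fun t m => G (t, m))) /=; apply: eq_bigr => t _.
  by rewrite big_bool /= mulmxDl addrC.
rewrite (reindex_inj (@gl_inj _ _ v)) /=.
rewrite (eq_bigr (fun f => G (gl v (f.1, f.2)))); last by case.
rewrite -(pair_bigA _ (fun t m => G (gl v (t, m)))) /=; apply: eq_bigr => t _.
have GE w : G (gl v (t, w)) = va v t *m star (vq v t (w (+) al v t) w).
  have vecD o c e : vec o (c + e) = x e *: vec o c.
    by rewrite /vec scalerA xD mulrC.
  have := gl_U v t w; have := gl_L v t w.
  case: (gl v (t, w)) => t1 m [eL cL] [eU cU]; rewrite /G /=.
  rewrite [in RHS]/vq /va -eL -cL -eU -cU !vecD -/(vq _ _ _ _) -/(vb v t1).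
  rewrite -scalemxAl (_ : star (_ *: _) = x (- dl v (t, w)) *: star (vb v t1)).
    by rewrite -scalemxAr scalerA -xD addrN x0 scale1r.
  by apply/matrixP => i j; rewrite starE !mxE rmorphM bar_x.
by rewrite big_bool /= !GE starD mulmxDr addrC.
Qed.

Lemma Xm_op : Xm v' = star (Xm v).
Proof.
have star_sum (I : finType) (F : I -> 'M[R]_n) : star (\sum_i F i) = \sum_i star (F i).
  by apply/matrixP => i j; rewrite starE !summxE rmorph_sum; apply: eq_bigr => k _; rewrite starE.
have starZ a b (p : R) (A : 'M[R]_(a, b)) : star (p *: A) = bar p *: star A.
  by apply/matrixP => i j; rewrite !starE !mxE rmorphM.
have XE (u : ved) : Xm u = 1%:M
   + \sum_t (-1) ^+ (al u t (+) be u t) *: (va u t *m star (vb u t))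
   - \sum_t (vq u t false (be u t) + vq u t true (~~ be u t)) *m star (vb u t).
  rewrite XmE -(sum_bb u) -big_split -sumrB; apply: eq_bigr => t _.
  by rewrite /wcol -[_ - _ - _]addrA -opprD !mulmxBl !mulmxDl scalemxAl.
rewrite (XE v') (XE v) sum_glue !(starD, star_sum).
rewrite (_ : star 1%:M = 1%:M); last first.
  by apply/matrixP => i j; rewrite starE !mxE rmorph_nat eq_sym.
congr (_ + _ + _).
  apply: eq_bigr => t _; rewrite [RHS]starZ starM starK va_op vb_op (op_al op) (op_be op).
  by rewrite bar_sign addbC.
rewrite -scaleN1r -[in RHS]scaleN1r [RHS]starZ rmorphN1 star_sum; congr (_ *: _).
apply: eq_bigr => t _; rewrite starM starK vb_op (op_be op) !vq_op.
by [].
Qed.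

Lemma XY_op d (c : 'M[R]_(n + n, d)) (r : 'M[R]_(d, n + n)) :
  XY v' (star r) (star c) = star (XY v c r).
Proof.
by rewrite /XY Xm_op [RHS]starD; congr (_ + _); rewrite !starM starK Dm_op Dop_op !mulmxA.
Qed.

Lemma op_minor (u : 'I_n -> 'I_(n + n)) : exists2 f : 'M[R]_(n + n, n),
  forall j, row1 x (f^~ j) &
  exists2 p, monomial x p & \det (Dop v *m f) = p * \det (colsub u (Dm v)).
Proof.
pose S : 'M[R]_n := diag_mx (\row_e (-1) ^+ ec v e).
pose h j := finv (gl v) (fc (u j)).
pose a j : R := - ((-1) ^+ al v (h j).1 * x (- dl v (h j))).
exists (\matrix_(k, j) (a j * (k == fk (h j))%:R)).
  move=> j; exists (fk (h j)), (a j); split; last by move=> k; rewrite mxE.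
  right; apply: monomialN => //; apply: monomialM => //; last exact: monomialx.
  exact: monomial_sign.
exists (\det S).
  rewrite det_diag; apply: (big_ind (monomial x)).
  - exact: monomial1.
  - by move=> p q; apply: monomialM.
  - by move=> e _; rewrite mxE; apply: monomial_sign.
rewrite -det_mulmx; congr (\det _); apply/matrixP => e j.
rewrite mxE (bigD1 (fk (h j))) //= big1 ?addr0; last first.
  by move=> k /negPf nk; rewrite !mxE nk !mulr0.
rewrite mul_diag_mx [Dop _ _ _]mxE fkK [X in _ * X]mxE eqxx mulr1.
rewrite [RHS]mxE [X in _ = X * _]mxE [X in _ = _ * X]mxE [X in _ = _ * X]mxE.
rewrite /a /h -[in RHS](f_finv (@gl_inj _ _ v) (fc (u j))).
case: (finv _ _) => t w /=.
have := congr1 (fun A : 'cV_n => A e 0) (dcol_gl v t w).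
rewrite [LHS]mxE => E.
have -> : dcol v (gl v (t, w)) e 0 = x (- dl v (t, w)) *
   (vq v t (w (+) al v t) w - va v t - vq v t (~~ (w (+) al v t)) w) e 0.
  by rewrite -E mulrA -xD addNr x0 mul1r.
have -> : dlow v (t, w) =
    va v t - vq v t (w (+) al v t) w - vq v t (~~ (w (+) al v t)) w.
  rewrite /dlow /=; case: (w (+) _) => //=.
  by rewrite -!addrA; congr (_ + _); rewrite addrC.
have subE (A B D : 'cV[R]_n) : (A - B - D) e 0 = A e 0 - B e 0 - D e 0.
  by rewrite !mxE.
have sgE o c b : ec v o = b -> (-1) ^+ ec v e * vec o c e 0 = (-1) ^+ b * vec o c e 0.
  by rewrite vecE; case: eqP => [->|_] <- //; rewrite !mulr0.
rewrite {E} !subE mulrCA !mulrBr.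
rewrite (sgE _ _ (al v t) (ec_a v t)) (sgE _ _ (al v t)); last first.
  by rewrite ec_q; case: w (al v t) => [] [].
rewrite (sgE _ _ (~~ al v t)); last first.
  by rewrite ec_q; case: w (al v t) => [] [].
rewrite /va /vq signrN.
move: (vec _ _ e 0) (vec _ _ e 0) (vec _ _ e 0) => A1 A2 A3; ring.
Qed.

Lemma flat_veering_minor_sym (cl : climbing v) (cl' : climbing v')
    (K0 : forall z : 'cV[R]_n, Km v *m z = 0 -> z = 0)
    (K0' : forall z : 'cV[R]_n, Km v' *m z = 0 -> z = 0) (u : 'I_n -> 'I_(n + n)) :
  bar_sym bar x (\det (colsub u (Dm v))).
Proof.
set m := \det _; have [->|m0] := eqVneq m 0; first exact: bar_sym0.
have [d [F]] := signed_walk_frame x0 xD bar_x x_inj (wf v) (@sgf_inj v) (ef v).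
have [d' [F']] := signed_walk_frame x0 xD bar_x x_inj (wf v') (@sgf_inj v') (ef v').
rewrite -/(Pm v) in F; rewrite -/(Pm v') in F'.
pose f : 'M[R]_(n + n, n) := colsub u 1%:M.
have fE : Dm v *m f = colsub u (Dm v) by rewrite mulmx_colsub mulmx1.
have f1 j : row1 x (f^~ j).
  exists (u j), 1; split; first by right; apply: monomial1.
  by move=> k; rewrite !mxE mul1r.
have [f' f'1 [p mp pE]] := op_minor u; rewrite -/m in pE.
have Dop0 : \det (Dop v *m f') != 0.
  by rewrite pE mulf_neq0 // (monomial_neq0 x0 xD bar_x).
have Dop0' : \det (Dop v' *m f) != 0 by rewrite Dop_op fE.
have [g O0 Os] := exists_border F cl K0 Dop0.
have [g' O0' Os'] := exists_border F' cl' K0' Dop0'.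
set c := nf_c F in O0 Os; set r := rowsub g 1%:M in O0 Os.
set c' := nf_c F' in O0' Os'; set r' := rowsub g' 1%:M in O0' Os'.
pose k := \det (row_mx f (Km v)); pose k' := \det (row_mx f' (Km v')).
have ks : bar_sym bar x k by apply: det_row_mx_sym => // i; apply: Km_row2.
have ks' : bar_sym bar x k' by apply: det_row_mx_sym => // i; apply: Km_row2.
have H := XY_det v c r f; rewrite fE -/k -/m in H.
have H' := XY_det v' c' r' f'; rewrite Dm_op pE -/k' in H'.
have nz (q q1 q2 q3 q4 : R) : q * q1 = q2 * (q3 * q4) ->
    q2 != 0 -> q3 != 0 -> q4 != 0 -> q != 0 /\ q1 != 0.
  move=> E q20 q30 q40; apply/andP.
  by rewrite -negb_or -mulf_eq0 E !mulf_neq0.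
have nz' (q q1 q2 q3 q4 : R) : q * q1 = q2 * (q3 * q4) ->
    q != 0 -> q1 != 0 -> q3 != 0.
  move=> E q0 q10; apply: contraTneq (mulf_neq0 q0 q10) => e.
  by rewrite E e mul0r mulr0 negbK.
have u0 := unit_det_neq0 v; have u0' := unit_det_neq0 v'.
have pm0 : p * m != 0 by rewrite mulf_neq0 // (monomial_neq0 x0 xD bar_x).
have [X0 k0] := nz _ _ _ _ _ H m0 O0 u0.
have [X0' k0'] := nz _ _ _ _ _ H' pm0 O0' u0'.
have bar0 q : (bar q == 0) = (q == 0).
  by apply/eqP/eqP => [e|->]; rewrite ?rmorph0 // -[q]barK e rmorph0.
have G := XY_det v' (star r) (star c) f'.
rewrite XY_op det_star Dm_op pE -/k' in G.
have G' := XY_det v (star r') (star c') f.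
rewrite fE -/k -/m in G'.
have XG : \det (XY v (star r') (star c')) != 0.
  have := XY_op (star r') (star c'); rewrite !starK => e.
  by move: X0'; rewrite e det_star bar0.
have OG : Om v' (star r) (star c) != 0 by apply: nz' G _ k0'; rewrite bar0.
have OG' : Om v (star r') (star c') != 0 by apply: nz' G' XG k0.
have ed : d = d'.
  by apply/eqP; rewrite eqn_leq (Om_small F OG') (Om_small F' OG).
have F2 : null_frame bar x (Pm v') d by rewrite ed; exact: F'.
have OGs : bar_sym bar x (Om v' (star r) (star c)).
  have [b ->] := Om_frame F2 (star r) (star c).
  rewrite -!mulrA; apply: bar_symMl => //; first exact: monomial_sign.
  apply: bar_symM => //; first exact: nf_sym.
  apply: bar_symM => //; last first.
    apply: det_row2 => // i; apply: (Jm_row2l cl' (nf_Ps F2)); last exact: nf_s1 F2 i.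
    have [j [q [mq cE]]] := nf_c1 F i; exists j, (bar q); split.
      case: mq => [->|/(bar_monomial bar_x)]; [left; exact: rmorph0|by right].
    by move=> l; rewrite starE cE rmorphM rmorph_nat.
  rewrite -det_tr; apply: det_row2 => // i; apply: row1_row2.
  have [j [q [mq lE]]] := nf_l1 F2 i (g i); exists j, q; split=> // l.
  rewrite mxE mxE (bigD1 (g i)) //= big1 => [|h nh].
    by rewrite addr0 starE !mxE eqxx rmorph1 mulr1 lE.
  by rewrite starE !mxE eq_sym (negPf nh) rmorph0 mulr0.
have us := unit_det_sym v; have us' := unit_det_sym v'.
set o := Om v c r * unit_det v in H; set o' := Om v' (star r) (star c) * unit_det v' in G.
have [e me oE] : bar_sym bar x o by apply: bar_symM.
have [h mh kE] := ks.
have [a ma aE] : bar_sym bar x (o * k') by do ?apply: bar_symM.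
have [b mb bE] : bar_sym bar x (o' * k) by do ?apply: bar_symM.
have oo0 : (o * k') * (o' * k) != 0 by rewrite !mulf_neq0.
have eq1 : bar m * bar o * k' = p * m * o' * bar k.
  by rewrite -rmorphM -H -G rmorphM mulrAC.
pose y := bar e * p * h.
have my : monomial x y by do ?apply: monomialM => //; apply: bar_monomial.
have eq2 : bar m * (o * k') = y * (m * (o' * k)).
  rewrite -[LHS]mul1r -(monomialV x0 xD bar_x me).
  transitivity (bar e * (bar m * (e * o) * k')); first by ring.
  by rewrite -oE eq1 kE /y; ring.
have eq3 : m * (a * (o * k')) = bar y * (bar m * (b * (o' * k))).
  transitivity (bar (bar m * (o * k'))); first by rewrite rmorphM barK aE.
  by rewrite eq2 rmorphM [bar (m * _)]rmorphM bE.
apply: (bar_sym_sq m0 (u := bar (bar y * b) * (y * a))).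
  apply: monomialM => //; last by apply: monomialM.
  by apply: bar_monomial => //; apply: monomialM => //; apply: bar_monomial.
have V : bar (bar y * b) * (bar y * b) = 1.
  by apply: (monomialV x0 xD bar_x); apply: monomialM => //; apply: bar_monomial.
apply: (mulIf oo0); rewrite -[LHS]mul1r -V.
transitivity (bar (bar y * b) * ((bar m * (o * k')) * (bar y * (bar m * (b * (o' * k)))))).
  by ring.
by rewrite -eq3 eq2; ring.
Qed.
End Duality.
End Abstract.

(** * Group rings *)

Section GroupRingMap.
Variables (K L : zmodType) (f : {additive K -> L}).
Implicit Types p q : group_ring K.

Definition gr_map p : group_ring L := \sum_(h <- msupp p) << p@_h *g f h >>.

Lemma gr_mapw (d : {fset K}) p : (msupp p `<=` d)%fset ->
  gr_map p = \sum_(h <- d) << p@_h *g f h >>.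
Proof.
move=> led; apply: big_fset_incl => // h _ /mcoeff_outdom ->.
by rewrite monalgU0.
Qed.

Lemma gr_map_is_zmod_morphism : zmod_morphism gr_map.
Proof.
move=> p q; pose d := (msupp p `|` msupp q)%fset.
rewrite !(@gr_mapw d) ?fsubsetUl ?fsubsetUr //.
  by rewrite -sumrB; apply: eq_bigr => h _; rewrite mcoeffB monalgUB.
apply: fsubset_trans (msuppB_le _ _) _.
exact: fsubset_refl.
Qed.
HB.instance Definition _ :=
  GRing.isZmodMorphism.Build (group_ring K) (group_ring L) gr_map
    gr_map_is_zmod_morphism.

Lemma gr_mapU a h : gr_map << a *g h >> = << a *g f h >>.
Proof.
rewrite (@gr_mapw [fset h]%fset) ?msuppU_le // big_seq_fset1.
by rewrite mcoeffUU.
Qed.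

Lemma gr_map_is_monoid_morphism : monoid_morphism gr_map.
Proof.
split; first by rewrite /GRing.one /= /gr_one gr_mapU raddf0.
move=> p q; rewrite [in RHS](monalgE p) [in RHS](monalgE q).
rewrite -[p * q]/(gr_mul p q) /gr_mul raddf_sum [gr_map (\sum_(i <- _) _)]raddf_sum.
rewrite [X in _ * X]raddf_sum mulr_suml; apply: eq_bigr => h _.
rewrite raddf_sum mulr_sumr; apply: eq_bigr => k _ /=.
by rewrite !gr_mapU -[RHS]/(gr_mul _ _) gr_mulUU raddfD.
Qed.
HB.instance Definition _ :=
  GRing.isMonoidMorphism.Build (group_ring K) (group_ring L) gr_map
    gr_map_is_monoid_morphism.

End GroupRingMap.

Definition gx (H : zmodType) (c : H) : group_ring H := << 1 *g c >>.

Section Bar.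
Variable H : zmodType.
Implicit Types p : group_ring H.

Lemma gx0 : gx 0 = 1 :> group_ring H. Proof. by []. Qed.
Lemma gxD c d : gx (c + d) = gx c * gx d :> group_ring H.
Proof. by rewrite -[RHS]/(gr_mul _ _) gr_mulUU mulr1. Qed.
Lemma gx_inj c : gx c = 1 :> group_ring H -> c = 0.
Proof.
move=> /malgP/(_ c); rewrite mcoeffUU -gx0 mcoeffU.
by case: eqP => // _ /eqP; rewrite oner_eq0.
Qed.

Lemma mcoeff_gr_mul p q g :
  (p * q)@_g = \sum_(h <- msupp p) \sum_(k <- msupp q) p@_h * q@_k *+ (h + k == g).
Proof.
rewrite -[p * q]/(gr_mul p q) /gr_mul raddf_sum; apply: eq_bigr => h _.
by rewrite raddf_sum; apply: eq_bigr => k _ /=; rewrite mcoeffU.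
Qed.

Lemma mcoeff_gx_mul c p g : (gx c * p)@_g = p@_(g - c).
Proof.
rewrite mcoeff_gr_mul msuppU oner_eq0 big_seq_fset1 mcoeffUU.
have E k : (c + k == g) = (k == g - c) by rewrite addrC eq_sym -subr_eq eq_sym.
have [gc|gc] := boolP (g - c \in msupp p).
  rewrite (big_fsetD1 _ gc) /= E eqxx mul1r big1_fset ?addr0 // => k.
  by rewrite in_fsetD1 E => /andP[/negPf ->].
rewrite big1_seq ?mcoeff_outdom // => k /andP[_ kp].
by rewrite E; case: eqP kp gc => // -> ->.
Qed.

Lemma gr_bar_zmod : zmod_morphism (@gr_bar H).
Proof. exact: gr_map_is_zmod_morphism. Qed.
Lemma gr_bar_monoid : monoid_morphism (@gr_bar H).
Proof. exact: gr_map_is_monoid_morphism. Qed.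

HB.instance Definition _ :=
  GRing.isZmodMorphism.Build (group_ring H) (group_ring H) (@gr_bar H) gr_bar_zmod.
HB.instance Definition _ :=
  GRing.isMonoidMorphism.Build (group_ring H) (group_ring H) (@gr_bar H)
    gr_bar_monoid.

Lemma gr_barU a h : gr_bar << a *g h >> = << a *g - h >> :> group_ring H.
Proof. exact: gr_mapU. Qed.

Lemma gr_bar_gx c : gr_bar (gx c) = gx (- c) :> group_ring H.
Proof. exact: gr_barU. Qed.

Lemma mcoeff_gr_bar p g : (gr_bar p)@_g = p@_(- g).
Proof.
rewrite /gr_bar raddf_sum /= [in RHS](monalgE p) raddf_sum /=.
by apply: eq_bigr => h _; rewrite !mcoeffU eqr_oppLR.
Qed.
Lemma gr_barK : involutive (@gr_bar H).
Proof. by move=> p; apply/malgP => g; rewrite !mcoeff_gr_bar opprK. Qed.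
End Bar.

Section OrderedGroup.
Variables (C : zmodType) (pos : C -> Prop).
Hypothesis pos0 : ~ pos 0.
Hypothesis posD : forall a b, pos a -> pos b -> pos (a + b).
Hypothesis posT : forall a, a != 0 -> pos a \/ pos (- a).
Implicit Types p q : group_ring C.

Definition leading p h :=
  p@_h != 0 /\ forall k, p@_k != 0 -> k != h -> pos (h - k).

Lemma pos_asym a : pos a -> pos (- a) -> False.
Proof. by move=> pa /(posD pa); rewrite addrN. Qed.

Lemma leadingP p : p != 0 -> exists h, leading p h.
Proof.
move=> p0; have max (s : seq C) : s != [::] ->
    exists2 h, h \in s & forall k, k \in s -> k != h -> pos (h - k).
  elim: s => // a [|b s] IHs _.
    by exists a; rewrite ?mem_head // => k; rewrite inE => /eqP ->; rewrite eqxx.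
  have [h hs hP] := IHs isT.
  have [ah|ah] := eqVneq a h.
    exists h; first by rewrite inE hs orbT.
    by move=> k; rewrite inE ah => /predU1P[->|]; [rewrite eqxx|exact: hP].
  have [pah|pha] : pos (a - h) \/ pos (h - a).
    by rewrite -[h - a]opprB; apply: posT; rewrite subr_eq0.
    exists a; first exact: mem_head.
    move=> k; rewrite inE => /predU1P[->|ks]; first by rewrite eqxx.
    have [-> //|kh] := eqVneq k h.
    by move=> _; rewrite -(subrK h a) -addrA; apply: posD => //; apply: hP.
  exists h; first by rewrite inE hs orbT.
  by move=> k; rewrite inE => /predU1P[-> //|]; apply: hP.
have [|h hs hP] := max (enum_fset (msupp p)).
  apply: contraNneq p0 => e; apply/eqP/malgP => k.
  by rewrite mcoeff0 mcoeff_outdom // -[_ \in _]/(k \in enum_fset (msupp p)) e.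
exists h; split; first by rewrite mcoeff_neq0.
by move=> k; rewrite mcoeff_neq0; apply: hP.
Qed.

Lemma leading_unique p h k : leading p h -> leading p k -> h = k.
Proof.
move=> [h0 hP] [k0 kP]; apply/eqP/negPn/negP => hk.
apply: (@pos_asym (h - k)); first by apply: hP => //; rewrite eq_sym.
by rewrite opprB; apply: kP.
Qed.

Lemma leadingM p q h k : leading p h -> leading q k ->
  leading (p * q) (h + k) /\ (p * q)@_(h + k) = p@_h * q@_k.
Proof.
move=> [h0 hP] [k0 kP].
have E : (p * q)@_(h + k) = p@_h * q@_k.
  rewrite mcoeff_gr_mul (big_fsetD1 h) -?mcoeff_neq0 //=.
  rewrite (big_fsetD1 k) -?mcoeff_neq0 //= eqxx mulr1n.
  rewrite big1_fset ?addr0 => [|k']; last first.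
    rewrite in_fsetD1 (inj_eq (addrI h)) => /andP[/negPf -> _] _.
    by rewrite mulr0n.
  rewrite big1_fset ?addr0 // => h'; rewrite in_fsetD1 => /andP[h'h h's] _.
  rewrite big1_seq // => k' /andP[_ k's].
  case: eqP => // e; exfalso.
  have hp : pos (h - h') by apply: hP => //; rewrite mcoeff_neq0.
  have d : k - k' = - (h - h').
    by apply/eqP; rewrite opprB subr_eq addrAC e addrAC subrr add0r.
  have [kk|kk] := eqVneq k' k.
    move: d; rewrite kk subrr => /esym/eqP; rewrite oppr_eq0 => /eqP d.
    by apply: pos0; rewrite -d.
  apply: (pos_asym hp); rewrite -d; apply: kP => //.
  by rewrite mcoeff_neq0.
split=> //; split; first by rewrite E mulf_neq0.
move=> g; rewrite mcoeff_gr_mul => g0 gn.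
have [h' [k' [h's k's e]]] : exists h' k', [/\ p@_h' != 0, q@_k' != 0 & h' + k' = g].
  apply: contrapT => H; move/eqP: g0; apply.
  rewrite big1_seq // => h' /andP[_ h's]; rewrite big1_seq // => k' /andP[_ k's].
  case: eqP => // e; case: H; exists h', k'.
  by rewrite !mcoeff_neq0.
rewrite -e opprD addrACA.
have [hh|hh] := eqVneq h' h; have [kk|kk] := eqVneq k' k.
- by move: gn; rewrite -e hh kk eqxx.
- by rewrite hh subrr add0r; apply: kP.
- by rewrite kk subrr addr0; apply: hP.
- by apply: posD; [apply: hP | apply: kP].
Qed.

Lemma gr_integral p q : p * q = 0 -> (p == 0) || (q == 0).
Proof.
move=> pq; apply/orP; have [_|p0] := eqVneq p 0; first by left.
have [_|q0] := eqVneq q 0; first by right.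
have [[h hP] [k kP]] := (leadingP p0, leadingP q0).
by have [[]] := leadingM hP kP; rewrite pq mcoeff0 eqxx.
Qed.

Lemma leading_gx c : leading (gx c) c.
Proof.
split; first by rewrite mcoeffUU oner_eq0.
by move=> k; rewrite mcoeffU; have [//|] := eqVneq c k => _ /eqP.
Qed.

Lemma leadingN p h : leading p h -> leading (- p) h.
Proof.
move=> [h0 hP]; split; first by rewrite mcoeffN oppr_eq0.
by move=> k; rewrite mcoeffN oppr_eq0; apply: hP.
Qed.

Lemma leading_monomial (b : bool) c p h : leading p h ->
    leading ((-1) ^+ b * gx c * p) (c + h) /\
    ((-1) ^+ b * gx c * p)@_(c + h) = (-1) ^+ b * p@_h.
Proof.
move=> lp; have [l1 E] := leadingM (leading_gx c) lp; rewrite mcoeffUU mul1r in E.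
case: b; rewrite ?expr1 ?expr0 ?mulN1r ?mul1r; split=> //.
  by rewrite mulNr; apply: leadingN.
by rewrite mulNr mcoeffN E.
Qed.

Lemma gr_bar_sq p (b : bool) c : p != 0 ->
    gr_bar p * gr_bar p = (-1) ^+ b * gx c * (p * p) ->
  exists (b' : bool) c', gr_bar p = (-1) ^+ b' * gx c' * p.
Proof.
move=> p0 E; have [h hP] := leadingP p0.
have bp0 : gr_bar p != 0.
  by apply: contraNneq p0 => e; rewrite -[p]gr_barK e raddf0.
have [k kP] := leadingP bp0.
have [pp ppE] := leadingM hP hP; have [bb bbE] := leadingM kP kP.
have [l lE] := leading_monomial b c pp.
rewrite -E in l lE; have ke := leading_unique bb l.
have b0 : b = false.
  move: lE; rewrite -ke bbE ppE; case: (b) => //.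
  rewrite expr1 mulN1r => /eqP; rewrite -subr_eq0 opprK -!expr2 paddr_eq0 ?sqr_ge0 //.
  by rewrite !sqrf_eq0 => /andP[_]; have [/negPf ->] := hP.
have cE : c = (k - h) + (k - h).
  by rewrite addrACA -opprD ke addrK.
rewrite b0 expr0 mul1r in E.
have : (gr_bar p - gx (k - h) * p) * (gr_bar p + gx (k - h) * p) = 0.
  transitivity (gr_bar p * gr_bar p - (gx (k - h) * gx (k - h)) * (p * p)); first by ring.
  by rewrite -gxD -cE E subrr.
move/gr_integral/orP => [|] /eqP e.
  exists false, (k - h); rewrite mul1r.
  by apply/eqP; rewrite -subr_eq0 e.
exists true, (k - h); rewrite expr1 mulN1r.
by apply/eqP; rewrite -subr_eq0 mulNr opprK e.
Qed.
End OrderedGroup.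

Section ChainOrder.
Variables (T : finType) (G : gluing T).
Local Notation S := (T * 'I_4)%type.
Local Notation chain := {ffun S -> int}.
Local Notation J := (angle T + S)%type.

Definition generator (j : J) : chain :=
  match j with
  | inl a => if a.2.1 != a.2.2 then loop G a else 0
  | inr s => backtrack G s
  end.

Lemma null_chainE c : null_chain G c <->
  exists k : J -> int, c = \sum_j generator j *~ k j.
Proof.
have E (k : angle T -> int) (l : S -> int) :
    \sum_(a : angle T | a.2.1 != a.2.2) loop G a *~ k a
        + \sum_(s : S) backtrack G s *~ l s =
    \sum_j generator j *~ (match j with inl a => k a | inr s => l s end).
  rewrite big_sumType /= big_mkcond; congr (_ + _).
  by apply: eq_bigr => a _; case: ifP; rewrite ?mul0rz.
split=> [[k [l ->]]|[k ->]]; first by rewrite E; eexists.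
exists (k \o inl), (k \o inr); rewrite E; apply: eq_bigr => -[] //.
Qed.

Definition chain_row (c : chain) : 'rV[rat]_#|{: S}| :=
  \row_i (c (enum_val i))%:~R.
Definition gen_mx : 'M[rat]_(#|{: J}|, #|{: S}|) :=
  \matrix_(j, i) (generator (enum_val j) (enum_val i))%:~R.
Definition chain_coord (c : chain) := chain_row c *m cokermx gen_mx.

Lemma chain_coord_zmod : zmod_morphism chain_coord.
Proof.
move=> c d; rewrite /chain_coord -mulmxBl; congr (_ *m _).
by apply/rowP => i; rewrite !mxE !ffunE rmorphB.
Qed.
HB.instance Definition _ := GRing.isZmodMorphism.Build chain 'rV[rat]_#|{: S}|
  chain_coord chain_coord_zmod.

Lemma chain_coord_eq0 c : chain_coord c = 0 <-> c \in torsion_chain G.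
Proof.
have sumE (k : J -> int) n : (0 < n)%N -> c *+ n = \sum_j generator j *~ k j <->
    chain_row c = (\row_j ((k (enum_val j))%:~R / n%:R)) *m gen_mx.
  move=> n0; have nn0 : n%:R != 0 :> rat by rewrite pnatr_eq0 -lt0n.
  have gE i : \sum_j (\row_j ((k (enum_val j))%:~R / n%:R)) 0 j * gen_mx j i
     = ((\sum_j generator j *~ k j) (enum_val i))%:~R / n%:R :> rat.
    rewrite sum_ffunE rmorph_sum mulr_suml [RHS](reindex (@enum_val _ {: J})) /=; last first.
      exact/onW_bij/enum_val_bij.
    apply: eq_bigr => j _; rewrite !mxE mulrAC; congr (_ / _).
    rewrite -rmorphM; congr (_%:~R).
    by rewrite ffunMzE mulrzz mulrC.
  split=> [e|e].
    apply/rowP => i; rewrite [RHS]mxE gE -e ffunMnE mxE.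
    by rewrite rmorphMn /= -mulr_natr mulfK.
  apply/ffunP => s; have /rowP/(_ (enum_rank s)) := e.
  rewrite [RHS]mxE gE mxE enum_rankK => e1; apply: (@intr_inj rat).
  by rewrite ffunMnE rmorphMn /= -mulr_natr e1 divfK.
have -> : chain_coord c = 0 <-> (chain_row c <= gen_mx)%MS.
  by rewrite submxE; split=> [/eqP|/eqP].
rewrite [c \in _](_ : _ = `[< exists2 n, (0 < n)%N & null_chain G (c *+ n) >]) //.
split=> [/submxP[u uE]|/asboolP[n n0 /null_chainE[k /(sumE _ _ n0) ->]]]; last exact: submxMl.
pose D := \prod_j denq (u 0 j); have D0 : 0 < D by apply: prodr_gt0 => j _; apply: denq_gt0.
pose k (j : J) := numq (u 0 (enum_rank j)) * \prod_(i | i != enum_rank j) denq (u 0 i).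
apply/asboolP; exists `|D|%N; first by rewrite absz_gt0 gt_eqF.
apply/null_chainE; exists k; apply/(sumE k); first by rewrite absz_gt0 gt_eqF.
rewrite uE; congr (_ *m _); apply/rowP => j; rewrite mxE /k enum_valK.
have -> : `|D|%:R = D%:~R :> rat by rewrite pmulrn gtz0_abs.
rewrite /D [X in _ / X%:~R](bigD1 j) //= !intrM invfM mulrACA divq_num_den.
rewrite divff ?mulr1 // intr_eq0; apply/prodf_neq0 => i _.
by rewrite denq_eq0.
Qed.

Local Notation C := (chain_class G).

Lemma class_of_eq0 c : (class_of G c = 0) <-> c \in torsion_chain G.
Proof.
rewrite -[c in c \in _]subr0 Quotient.idealrBE; split=> [e|/eqP e].
  by apply/eqP; rewrite [LHS]e; exact/esym/raddf0.
by rewrite [LHS]e; exact: raddf0.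
Qed.

Definition coord (a : C) := chain_coord (generic_quotient.repr a).

Lemma class_of_repr a : class_of G (generic_quotient.repr a) = a.
Proof. exact: generic_quotient.reprK. Qed.

Lemma coordE c : coord (class_of G c) = chain_coord c.
Proof.
apply/eqP; rewrite -subr_eq0 -raddfB; apply/eqP/chain_coord_eq0/class_of_eq0.
by rewrite class_ofB class_of_repr subrr.
Qed.

Lemma coord_zmod : zmod_morphism coord.
Proof.
move=> a b; rewrite -{1}(class_of_repr a) -{1}(class_of_repr b).
by rewrite -class_ofB coordE raddfB.
Qed.
HB.instance Definition _ :=
  GRing.isZmodMorphism.Build C 'rV[rat]_#|{: S}| coord coord_zmod.

Lemma coord_eq0 a : coord a = 0 -> a = 0.
Proof. by rewrite -(class_of_repr a) coordE => /chain_coord_eq0/class_of_eq0. Qed.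

Definition pos (a : C) := exists i : 'I_#|{: S}|,
  0 < coord a 0 i /\ forall j : 'I_#|{: S}|, (j < i)%N -> coord a 0 j = 0.

Lemma pos0 : ~ pos 0.
Proof. by move=> [i [+ _]]; rewrite raddf0 mxE ltxx. Qed.

Lemma posD a b : pos a -> pos b -> pos (a + b).
Proof.
move=> [i [ai ajP]] [k [bk bjP]].
have aE j : coord (a + b) 0 j = coord a 0 j + coord b 0 j by rewrite raddfD mxE.
case: (ltngtP i k) => ik.
- exists i; split; first by rewrite aE bjP // addr0.
  by move=> j ji; rewrite aE ajP // bjP ?addr0 // (ltn_trans ji).
- exists k; split; first by rewrite aE ajP // add0r.
  by move=> j jk; rewrite aE bjP // ajP ?addr0 // (ltn_trans jk).
- have {}ik : i = k by apply: val_inj.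
  exists i; split; first by rewrite aE addr_gt0 // ik.
  by move=> j ji; rewrite aE ajP // bjP ?addr0 // -ik.
Qed.

Lemma posT a : a != 0 -> pos a \/ pos (- a).
Proof.
move=> a0; have [i0 i0P] : exists i, coord a 0 i != 0.
  apply: contrapT => H; move/eqP: a0; apply; apply: coord_eq0; apply/rowP => i.
  by rewrite [RHS]mxE; apply/eqP/negPn/negP => ai; apply: H; exists i.
case: (@arg_minnP _ i0 (fun i => coord a 0 i != 0) val) => // i ai imin.
have aj (j : 'I_#|{: S}|) : (j < i)%N -> coord a 0 j = 0.
  by move=> ji; apply/eqP; apply: contraTT ji => /imin; rewrite -leqNgt.
have NE j : coord (- a) 0 j = - coord a 0 j by rewrite raddfN mxE.
case: (ltgtP 0 (coord a 0 i)) ai => // ai _; [left|right]; exists i; split=> //.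
  by rewrite NE oppr_gt0.
by move=> j ji; rewrite NE aj ?oppr0.
Qed.

HB.instance Definition _ := GRing.ComUnitRing_isIntegral.Build (group_ring C)
  (gr_integral pos0 posD posT).

Definition cring : idomainType := group_ring C.
Definition cbar : {rmorphism cring -> cring} := @gr_bar C.
Definition cx : C -> cring := @gx C.

Lemma cbar_sym_sq (p u : cring) : p != 0 -> monomial cx u ->
  cbar p * cbar p = u * (p * p) -> bar_sym cbar cx p.
Proof.
move=> p0 [b [c ->]] E.
have [b' [c' E']] := @gr_bar_sq C pos pos0 posD posT (p : group_ring C) b c p0 E.
exists ((-1) ^+ b' * cx c'); [exists b', c'; reflexivity | apply: E'].
Qed.

End ChainOrder.

(** * From the triangulation to flat quadrilaterals *)

Section Compass.
(* The compass points of [veering]: N, S are [iN false], [iN true] and W, E are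
   [iW false], [iW true]. *)
Definition iN (b : bool) : 'I_4 := if b then 1 else 0.
Definition iW (b : bool) : 'I_4 := if b then 3%:R else 2%:R.

Definition swap4 (a b c : 'I_4) : 'I_4 :=
  if c == a then b else if c == b then a else c.
Definition parity4 (a b c : 'I_4) : bool :=
  (0 != a) (+) (1 != swap4 0 a b) (+) (2%:R != swap4 1 (swap4 0 a b) (swap4 0 a c)).

Lemma tperm_swap4 (a b c : 'I_4) : tperm a b c = swap4 a b c.
Proof.
rewrite /swap4; case: tpermP => [->|->|/eqP/negPf -> /eqP/negPf -> //].
  by rewrite eqxx.
by rewrite eqxx; case: eqP.
Qed.

Lemma ord4P (P : 'I_4 -> Prop) :
  P 0 -> P 1 -> P 2%:R -> P 3%:R -> forall i, P i.
Proof.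
move=> P0 P1 P2 P3 [[|[|[|[|//]]]] lti].
- by rewrite (_ : Ordinal lti = 0) //; apply: val_inj.
- by rewrite (_ : Ordinal lti = 1) //; apply: val_inj.
- by rewrite (_ : Ordinal lti = 2%:R) //; apply: val_inj.
- by rewrite (_ : Ordinal lti = 3%:R) //; apply: val_inj.
Qed.

Lemma odd_perm4 (s : 'S_4) : odd_perm s = parity4 (s 0) (s 1) (s 2%:R).
Proof.
pose s1 := (s * tperm 0 (s 0%R))%g.
pose s2 := (s1 * tperm 1%R (s1 1%R))%g.
pose s3 := (s2 * tperm 2%:R%R (s2 2%:R%R))%g.
have s10 : s1 0 = 0 by rewrite permM tpermR.
have s21 : s2 1 = 1 by rewrite permM tpermR.
have s20 : s2 0 = 0.
  rewrite permM s10 tpermD //.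
  by apply/eqP => e; have := @perm_inj _ s1 1 0; rewrite s10 e => /(_ erefl).
have s32 : s3 2%:R = 2%:R by rewrite permM tpermR.
have s30 : s3 0 = 0.
  rewrite permM s20 tpermD //.
  by apply/eqP => e; have := @perm_inj _ s2 2%:R 0; rewrite s20 e => /(_ erefl).
have s31 : s3 1 = 1.
  rewrite permM s21 tpermD //.
  by apply/eqP => e; have := @perm_inj _ s2 2%:R 1; rewrite s21 e => /(_ erefl).
have s3E : s3 = 1%g.
  apply/permP => i; rewrite perm1; elim/ord4P: i => //.
  have ne k : k != 3%:R -> s3 3%:R != s3 k by rewrite (inj_eq perm_inj) eq_sym.
  have := ne 0 isT; have := ne 1 isT; have := ne 2%:R isT; rewrite s30 s31 s32.
  by move: (s3 _); apply: ord4P.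
have : odd_perm s3 = false by rewrite s3E odd_perm1.
rewrite !odd_permM !odd_tperm !permM !tperm_swap4 /parity4.
by case: (odd_perm s) (0 != _) (1 != _) (2%:R != _) => [] [] [] [].
Qed.

Definition ords4 : seq 'I_4 := [:: 0; 1; 2%:R; 3%:R].
Lemma mem_ords4 i : i \in ords4. Proof. by move: i; apply: ord4P. Qed.

Definition val4 (a b c d i : 'I_4) : 'I_4 :=
  if i == 0 then a else if i == 1 then b else if i == 2%:R then c else d.

Lemma val4E (s : 'S_4) i : s i = val4 (s 0) (s 1) (s 2%:R) (s 3%:R) i.
Proof. by move: i; apply: ord4P. Qed.

Definition all_perm4 (P : 'I_4 -> 'I_4 -> 'I_4 -> 'I_4 -> bool) :=
  all (fun a => all (fun b => all (fun c => all (fun d =>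
    uniq [:: a; b; c; d] && parity4 a b c ==> P a b c d) ords4) ords4) ords4) ords4.

Lemma all_perm4P P : all_perm4 P -> forall s : 'S_4, odd_perm s ->
  P (s 0) (s 1) (s 2%:R) (s 3%:R).
Proof.
move=> /allP H s os.
have /allP/(_ _ (mem_ords4 (s 1))) := H (s 0) (mem_ords4 _).
move=> /allP/(_ _ (mem_ords4 (s 2%:R)))/allP/(_ _ (mem_ords4 (s 3%:R)))/implyP; apply.
by rewrite /= !inE !(inj_eq perm_inj) -odd_perm4 os.
Qed.

(* The two elements [i, j] other than [k, l], such that [(i, j, k, l)] is even *)
Definition others (k l : 'I_4) : 'I_4 * 'I_4 :=
  let r := [seq i <- ords4 | (i != k) && (i != l)] in
  let i := nth 0 r 0 in let j := nth 0 r 1 in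
  if parity4 i j k then (j, i) else (i, j).

Definition face_colour (be al : bool) (k l : 'I_4) : bool :=
  if (k < 2)%N && (l < 2)%N then be else if (1 < k)%N && (1 < l)%N then al
  else ((k == 1) || (l == 1)) (+) ((k == 3%:R) || (l == 3%:R)).

Definition others_check := all_perm4 (fun a b c d => all (fun k => all (fun l =>
  (k != l) ==> (others (val4 a b c d k) (val4 a b c d l) ==
     (val4 a b c d (others k l).2, val4 a b c d (others k l).1))) ords4) ords4).

Definition bools := [:: true; false].
Lemma mem_bools b : b \in bools. Proof. by case: b. Qed.

Definition glue_check := all_perm4 (fun a b c d =>
  all (fun w => all (fun m => all (fun be => all (fun al =>
  [&& val4 a b c d (iW (~~ w)) == iN (~~ m) &
    all (fun k => (k == iW (~~ w)) || (face_colour al al k (iW (~~ w)) ==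
       face_colour be be (val4 a b c d k) (iN (~~ m)))) ords4] ==>
  [&& be == al, val4 a b c d (iN (w (+) al)) == iW (m (+) al),
    val4 a b c d (iN (~~ (w (+) al))) == iN m &
    val4 a b c d (iW w) == iW (~~ (m (+) al))]) bools) bools) bools) bools).

Lemma others_odd (s : 'S_4) k l : odd_perm s -> k != l ->
  others (s k) (s l) = (s (others k l).2, s (others k l).1).
Proof.
move=> os kl; have /all_perm4P/(_ s os) : others_check by vm_compute.
move=> /allP/(_ _ (mem_ords4 k))/allP/(_ _ (mem_ords4 l)).
by rewrite -!val4E kl => /eqP.
Qed.

Lemma glue_odd_perm (s : 'S_4) w m be al : odd_perm s ->
    s (iW (~~ w)) = iN (~~ m) ->
    (forall k, k != iW (~~ w) ->
      face_colour al al k (iW (~~ w)) = face_colour be be (s k) (iN (~~ m))) ->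
  [/\ be = al, s (iN (w (+) al)) = iW (m (+) al),
     s (iN (~~ (w (+) al))) = iN m & s (iW w) = iW (~~ (m (+) al))].
Proof.
move=> os sw sk; have /all_perm4P/(_ s os) : glue_check by vm_compute.
move=> /allP/(_ _ (mem_bools w))/allP/(_ _ (mem_bools m)).
move=> /allP/(_ _ (mem_bools be))/allP/(_ _ (mem_bools al))/implyP.
rewrite -!val4E sw eqxx /= => H.
have /H/and4P[/eqP-> /eqP-> /eqP-> /eqP->] : all (fun k => (k == iW (~~ w)) ||
    (face_colour al al k (iW (~~ w)) ==
     face_colour be be (val4 (s 0) (s 1) (s 2%:R) (s 3%:R) k) (iN (~~ m)))) ords4; last by [].
apply/allP => k _; rewrite -val4E.
by have [//|/sk ->] := eqVneq k (iW (~~ w)); rewrite eqxx.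
Qed.

Lemma othersC k l : k != l -> others l k = ((others k l).2, (others k l).1).
Proof. by move=> kl; apply/eqP; move: k l kl; apply: ord4P; apply: ord4P. Qed.
Lemma others_NW n w : others (iN n) (iW w) =
  if n (+) w then (iN (~~ n), iW (~~ w)) else (iW (~~ w), iN (~~ n)).
Proof. by apply/eqP; case: n w => [] []. Qed.
Lemma others_WW w : others (iW (~~ w)) (iW w) = (iN (~~ w), iN w).
Proof. by apply/eqP; case: w. Qed.
Lemma others_NN n : others (iN (~~ n)) (iN n) = (iW (~~ n), iW n).
Proof. by apply/eqP; case: n. Qed.
Lemma others_neq k l : k != l -> (others k l).1 != (others k l).2.
Proof. by move: k l; apply: ord4P; apply: ord4P. Qed.
Lemma others_face k l i : k != l -> i != k -> i != l ->
  i = (others k l).1 \/ i = (others k l).2.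
Proof.
move=> kl ik il; suff /orP[] : (i == (others k l).1) || (i == (others k l).2).
- by move/eqP; left.
- by move/eqP; right.
by move: k l i kl ik il; apply: ord4P; apply: ord4P; apply: ord4P.
Qed.
End Compass.

Section Rotation.
Variables (T : finType) (G : gluing T).
Hypothesis HG : ideal_triangulation G.
Implicit Types (x y : angle T) (t : T).
Local Notation rot := (Defs.rot G).

Definition genuine x := x.2.1 != x.2.2.

Lemma flipK : involutive (@flip T).
Proof. by case=> t [i j]. Qed.

Lemma rot_flip x : rot (flip (rot (flip x))) = x.
Proof.
case: x => t [i j]; rewrite /flip /Defs.rot /=.
by rewrite (adjK HG) (glueK HG) !permK.
Qed.

Lemma rot_inj : injective rot.
Proof.
apply: (can_inj (g := fun x => flip (rot (flip x)))) => x.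
by have := rot_flip (flip x); rewrite flipK => ->; rewrite flipK.
Qed.

Lemma genuine_rot x : genuine (rot x) = genuine x.
Proof. by case: x => t [i j]; rewrite /genuine /= (inj_eq perm_inj) eq_sym. Qed.

Lemma genuine_flip x : genuine (flip x) = genuine x.
Proof. by rewrite /genuine eq_sym. Qed.

Lemma genuine_iter k x : genuine (iter k rot x) = genuine x.
Proof. by elim: k => //= k IHk; rewrite genuine_rot. Qed.

Lemma genuine_connect x y : fconnect rot x y -> genuine y = genuine x.
Proof. by move/iter_findex => <-; rewrite genuine_iter. Qed.

Lemma rot_neq_flip k x : genuine x -> iter k rot x <> flip x.
Proof.
elim/ltn_ind: k x => -[|[|k]] IHk [t [i j]] gx.
- by case=> ij _; rewrite /genuine /= ij eqxx in gx.
- move=> /= [et ej _]; apply: (glue_free HG (t := t) (i := j)).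
  by rewrite et ej.
- move=> e; apply: (IHk k _ (rot (t, (i, j)))) => //; first by rewrite genuine_rot.
  by apply: rot_inj; rewrite -iterS -iterSr e -[in RHS](flipK (t, (i, j))) rot_flip.
Qed.

Lemma connect_sym_rot : connect_sym (frel rot).
Proof. exact/fconnect_sym/rot_inj. Qed.

Lemma flip_connect x y : fconnect rot x y -> fconnect rot (flip x) (flip y).
Proof.
move/iter_findex => <-; move: (findex _ _ _) => k.
elim: k => [|k IHk] /=; first exact: connect0.
apply: connect_trans IHk _; rewrite connect_sym_rot.
apply: connect1; apply/eqP.
by have := rot_flip (flip (iter k rot x)); rewrite flipK.
Qed.

Lemma same_edgeP x y :
  same_edge G x y <-> fconnect rot x y \/ fconnect rot (flip x) y.
Proof.
split=> [|[|]].
- elim=> {x y} [x y [->|->]|x|x y _ [IH|IH]|x y z _ IH1 _ IH2].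
  + by left; apply: fconnect1.
  + by right; apply: connect0.
  + by left; apply: connect0.
  + by left; rewrite connect_sym_rot.
  + by right; rewrite connect_sym_rot -{1}[x]flipK flip_connect.
  + case: IH1 IH2 => H1 [H2|H2].
    * by left; apply: connect_trans H1 H2.
    * by right; apply: connect_trans (flip_connect H1) H2.
    * by right; apply: connect_trans H1 H2.
    * by left; apply: connect_trans H2; rewrite -[x]flipK flip_connect.
- move/iter_findex => <-; elim: (findex _ _ _) => [|k IHk]; first exact: rst_refl.
  by apply: rst_trans IHk _; apply: rst_step; left.
- move=> H; apply: (rst_trans _ _ x (flip x)); first by apply: rst_step; right.
  move/iter_findex: H => <-; elim: (findex _ _ _) => [|k IHk]; first exact: rst_refl.
  by apply: rst_trans IHk _; apply: rst_step; left.
Qed.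

Lemma flip_orbit x : genuine x -> ~~ fconnect rot x (flip x).
Proof.
move=> gx; apply/negP => /iter_findex; exact: rot_neq_flip.
Qed.

Lemma edge_ofP x y : (y \in edge_of G x) = fconnect rot x y || fconnect rot (flip x) y.
Proof. by rewrite inE; apply/asboolP/orP => /same_edgeP. Qed.

Lemma eq_edge_of x y : same_edge G x y -> edge_of G x = edge_of G y.
Proof.
move=> xy; apply/setP => z; rewrite !inE; apply: asbool_equiv_eq; split=> H.
  by apply: rst_trans H; apply: rst_sym.
exact: rst_trans H.
Qed.

Lemma edge_of_rot x : edge_of G (rot x) = edge_of G x.
Proof. by apply/esym/eq_edge_of; apply: rst_step; left. Qed.
Lemma edge_of_flip x : edge_of G (flip x) = edge_of G x.
Proof. by apply/esym/eq_edge_of; apply: rst_step; right. Qed.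

Local Notation C := (chain_class G).
Definition dlt (s : T * 'I_4) : C := class_of G (dual_edge s).

Lemma class_ofD c d : class_of G (c + d) = class_of G c + class_of G d.
Proof. exact: raddfD. Qed.

Lemma null_class c : null_chain G c -> class_of G c = 0.
Proof.
by move=> nc; apply/class_of_eq0/asboolP; exists 1%N.
Qed.

Lemma dlt_adj t i : dlt (adj G t i, glue G t i i) = - dlt (t, i).
Proof.
apply/eqP; rewrite -addr_eq0 addrC -class_ofD; apply/eqP/null_class.
exists (fun=> 0), (fun s => (s == (t, i))%:R).
rewrite big1 ?add0r; last by move=> a _; rewrite mulr0z.
rewrite (bigD1 (t, i)) //= eqxx mulr1z big1 ?addr0 // => s /negPf ->.
by rewrite mulr0z.
Qed.

Lemma dlt_loop x : genuine x ->
  \sum_(b <- fingraph.orbit rot x) dlt (b.1, b.2.2) = 0.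
Proof.
move=> gx; have -> : \sum_(b <- fingraph.orbit rot x) dlt (b.1, b.2.2) = class_of G (loop G x).
  rewrite /loop; elim: (fingraph.orbit _ _) => [|b s IHs].
    by rewrite !big_nil; apply/esym/raddf0.
  by rewrite !big_cons class_ofD IHs.
apply: null_class; exists (fun a => (a == x)%:R), (fun=> 0).
rewrite [X in _ + X]big1 ?addr0; last by move=> a _; rewrite mulr0z.
rewrite (bigD1 x) //= eqxx mulr1z big1 ?addr0 // => s /andP[_ /negPf ->].
by rewrite mulr0z.
Qed.

Section Diagonals.
Variable up : T -> 'I_4 -> bool.
Hypothesis HT : transverse_taut G up.
Local Notation top := (top_diagonal up).
Local Notation bottom := (bottom_diagonal up).

Lemma fconnect_rot x y : fconnect rot x (rot y) = fconnect rot x y.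
Proof.
rewrite connect_sym_rot (connect_sym_rot x y).
by rewrite -(same_connect1 connect_sym_rot (x := y)) //=.
Qed.

Lemma diag_flip x : (top (flip x) = top x) * (bottom (flip x) = bottom x).
Proof. by split; rewrite /top_diagonal /bottom_diagonal /= andbC. Qed.

Lemma card_diag x : genuine x ->
  #|[set y | fconnect rot x y & top y || bottom y]| = 2%N.
Proof.
move=> gx; have eE : edge_of G x \in edges G by apply/imsetP; exists x; rewrite ?inE.
rewrite -[RHS](angle_sum HT eE).
pose f y := if (y.2.1 < y.2.2)%N then y else flip y.
have gy y : fconnect rot x y -> genuine y by move/genuine_connect => ->.
have -> : [set a in edge_of G x | (a.2.1 < a.2.2)%N && (top a || bottom a)] =
    f @: [set y | fconnect rot x y & top y || bottom y].
  apply/setP => a; rewrite in_set edge_ofP.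
  apply/andP/imsetP => [[/orP[xa|xa] /andP[la da]]|[y]].
  - by exists a; rewrite ?inE ?xa // /f la.
  - exists (flip a); last by rewrite /f /= ltnNge (ltnW la) flipK.
    by rewrite inE !diag_flip da -{1}[x]flipK flip_connect.
  - rewrite inE => /andP[xy dy] ->; rewrite /f; case: ltnP => lty.
      by rewrite xy dy lty.
    rewrite flip_connect ?orbT // !diag_flip dy ltn_neqAle lty !andbT.
    by have := gy y xy; rewrite /genuine -val_eqE eq_sym; case: eqP.
rewrite card_in_imset // => y z; rewrite !inE => /andP[xy _] /andP[xz _].
have nf u v : fconnect rot x u -> fconnect rot x v -> u <> flip v.
  move=> xu xv e; have := flip_orbit (gy v xv); rewrite -e.
  by rewrite (same_connect connect_sym_rot (y := x)) ?xu // connect_sym_rot.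
rewrite /f; do 2 case: ifP => _ //.
- by move/(nf _ _ xy xz).
- by move/esym/(nf _ _ xz xy).
- by move/(can_inj flipK).
Qed.

Lemma card_top_bottom x : #|[set y | fconnect rot x y & top y]| =
  #|[set y | fconnect rot x y & bottom y]|.
Proof.
have E (P : pred (angle T)) : #|[set y | fconnect rot x y & P y]| =
    (\sum_(y | fconnect rot x y) P y)%N.
  by rewrite -sum1dep_card big_mkcondr.
pose m := (\sum_(y | fconnect rot x y) (up y.1 y.2.1 && ~~ up y.1 y.2.2))%N.
apply: (@addnI m); rewrite !E -!big_split /=.
transitivity (\sum_(y | fconnect rot x y) up y.1 y.2.1)%N.
  apply: eq_bigr => y _; rewrite /top_diagonal.
  by case: (up _ _) (up _ _) => [] [].
rewrite (reindex_inj rot_inj) /=; apply: eq_big => [y|[t [i j]] _].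
  by rewrite fconnect_rot.
rewrite /bottom_diagonal /= (up_adj HT).
by case: (up _ _) (up _ _) => [] [].
Qed.

Lemma unique_diag (b : bool) x : genuine x ->
  exists! y, fconnect rot x y /\ (if b then top y else bottom y).
Proof.
move=> gx; have c2 := card_diag gx; have ctb := card_top_bottom x.
have c1 : #|[set y | fconnect rot x y & top y]| = 1%N.
  apply: double_inj; rewrite -addnn [X in (_ + X)%N]ctb -cardsUI -[RHS]c2 -[RHS]addn0.
  congr (_ + _)%N.
    by apply: eq_card => y; rewrite !inE -andb_orr.
  apply/eqP; rewrite cards_eq0; apply/eqP/setP => y; rewrite !inE.
  by rewrite /top_diagonal /bottom_diagonal; case: (up _ _); rewrite ?andbF.
have : #|[set y | fconnect rot x y & if b then top y else bottom y]| == 1%N.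
  by case: b; rewrite -?ctb c1.
case/cards1P => y yE; exists y; split=> [|z [xz dz]].
  have : y \in [set y] by rewrite inE.
  by rewrite -yE inE => /andP[].
by apply/esym/eqP; rewrite -in_set1 -yE inE xz.
Qed.

End Diagonals.
End Rotation.

Section Labels.
Variables (T : finType) (G : gluing T) (up : T -> 'I_4 -> bool).
Hypotheses (HG : ideal_triangulation G) (HT : transverse_taut G up).
Implicit Types (x y : angle T) (t : T).
Local Notation rot := (Defs.rot G).
Variables (C : zmodType) (dlt : T * 'I_4 -> C).
Hypothesis dlt_adj : forall t i, dlt (adj G t i, glue G t i i) = - dlt (t, i).
Hypothesis dlt_loop : forall x, genuine x ->
  \sum_(b <- fingraph.orbit rot x) dlt (b.1, b.2.2) = 0.
Local Notation bottom := (bottom_diagonal up).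

Definition exit x : C := dlt (x.1, x.2.2).

Definition bot x := odflt x [pick y | fconnect rot x y && bottom y].

Lemma botP x : genuine x -> fconnect rot x (bot x) /\ bottom (bot x).
Proof.
move=> /(unique_diag HG HT false) [y [[xy by_] _]]; rewrite /bot.
by case: pickP => [z /andP[]|/(_ y)] //=; rewrite xy by_.
Qed.

Lemma bot_unique x y : genuine x -> fconnect rot x y -> bottom y -> bot x = y.
Proof.
move=> gx xy by_; have [z [_ zu]] := unique_diag HG HT false gx.
by rewrite -(zu _ (conj xy by_)) -(zu _ (botP gx)).
Qed.

Lemma bot_connect x y : genuine x -> fconnect rot x y -> bot y = bot x.
Proof.
move=> gx xy; have gy : genuine y by rewrite (genuine_connect xy).
have [xb bb] := botP gx; apply: bot_unique => //.
by rewrite -(same_connect (connect_sym_rot HG) xy).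
Qed.

Lemma bot_rot x : genuine x -> bot (rot x) = bot x.
Proof. by move=> gx; apply: bot_connect => //; apply: fconnect1. Qed.

Lemma bot_flip x : genuine x -> bot (flip x) = flip (bot x).
Proof.
move=> gx; have [xb bb] := botP gx; apply: bot_unique.
- by rewrite genuine_flip.
- exact: flip_connect.
- by rewrite diag_flip.
Qed.

Lemma bot_bottom x : genuine x -> bottom x -> bot x = x.
Proof. by move=> gx bx; apply: bot_unique. Qed.

Definition path_sum x k := \sum_(i < k) exit (iter i rot x).

Lemma path_sumD x k l : path_sum x (k + l) = path_sum x k + path_sum (iter k rot x) l.
Proof.
rewrite /path_sum big_split_ord /=; congr (_ + _).
by apply: eq_bigr => i _; rewrite addnC iterD.
Qed.

Lemma path_sum_order x : genuine x -> path_sum x (fingraph.order rot x) = 0.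
Proof.
move=> gx; rewrite /path_sum -[RHS](dlt_loop gx) /fingraph.orbit.
move: (fingraph.order _ _) => k; elim: k x {gx} => [|k IHk] x /=.
  by rewrite big_ord0 big_nil.
rewrite big_ord_recl big_cons /= -(IHk (rot x)).
by congr (_ + _); apply: eq_bigr => i _; rewrite -iterSr.
Qed.

Lemma path_sum_findex x k : genuine x ->
  path_sum x k = path_sum x (findex rot x (iter k rot x)).
Proof.
move=> gx; elim/ltn_ind: k => k IHk; pose o := fingraph.order rot x.
have [lt_ko|le_ok] := ltnP k o; first by rewrite findex_iter.
have o0 : (0 < o)%N by apply: fingraph.order_gt0.
rewrite -(subnKC le_ok) path_sumD path_sum_order // add0r.
rewrite addnC iterD !iter_order; try exact: rot_inj HG.
by apply: IHk; rewrite // ltn_subrL o0 (leq_trans o0).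
Qed.

Definition theta x := path_sum x (findex rot x (bot x)).

Lemma theta_bottom x : genuine x -> bottom x -> theta x = 0.
Proof.
by move=> gx bx; rewrite /theta bot_bottom // findex0 /path_sum big_ord0.
Qed.

Lemma exit_flip_rot x : exit (flip (rot x)) = - exit x.
Proof. by case: x => t [i j]; rewrite /exit /= dlt_adj. Qed.

Lemma theta_rot x : genuine x -> theta (rot x) = theta x - exit x.
Proof.
move=> gx; rewrite /theta bot_rot //; have [xb bb] := botP gx.
have rb : fconnect rot (rot x) (bot x).
  by rewrite -(same_fconnect1 (rot_inj HG) x).
set k := findex rot (rot x) (bot x).
have e : iter k.+1 rot x = bot x by rewrite iterSr iter_findex.
rewrite -[in RHS]e -path_sum_findex // -[k.+1]add1n path_sumD.
by rewrite {2}/path_sum big_ord1 /= addrC addKr.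
Qed.

Lemma theta_flip x : genuine x -> theta (flip x) = theta x.
Proof.
move: theta theta_rot theta_bottom => th thr thb gx; have [xb bb] := botP gx.
have step y : genuine y -> th (flip (rot y)) - th (rot y) = th (flip y) - th y.
  move=> gy; have E : rot (flip (rot y)) = flip y.
    by rewrite -{1}[y]flipK rot_flip.
  have gfy : genuine (flip (rot y)) by rewrite genuine_flip genuine_rot.
  have := thr _ gfy; rewrite E exit_flip_rot opprK (thr _ gy) => ->.
  by rewrite opprB addrA.
have it k : th (flip (iter k rot x)) - th (iter k rot x) = th (flip x) - th x.
  elim: k => [|k IHk]; first by [].
  by rewrite -IHk; apply: step; rewrite genuine_iter.
have gb : genuine (bot x) by rewrite (genuine_connect xb).
have tb0 : th (bot x) = 0 by apply: thb.
have fb0 : th (flip (bot x)) = 0 by apply: thb; rewrite ?genuine_flip ?diag_flip.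
have := it (findex rot x (bot x)); rewrite iter_findex // tb0 fb0 subrr.
by move/esym/eqP; rewrite subr_eq0 => /eqP.
Qed.

End Labels.

Opaque others.

Definition blue (c : edge_colour) : bool := if c is Blue then true else false.

Section Flat.
Variables (T : finType) (G : gluing T) (up : T -> 'I_4 -> bool).
Hypotheses (HG : ideal_triangulation G) (HT : transverse_taut G up).
Local Notation rot := (Defs.rot G).
Variables (C : zmodType) (dlt : T * 'I_4 -> C).
Hypothesis dlt_adj : forall t i, dlt (adj G t i, glue G t i i) = - dlt (t, i).
Local Notation n := #|T|.
Implicit Types (x y : angle T) (t : T).
Variables (theta : angle T -> C) (ei : angle T -> 'I_n) (ec : 'I_n -> bool).
Hypothesis theta_rot : forall x, genuine x -> theta (rot x) = theta x - exit dlt x.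
Hypothesis theta_flip : forall x, genuine x -> theta (flip x) = theta x.
Hypothesis ei_rot : forall x, genuine x -> ei (rot x) = ei x.
Hypothesis ei_flip : forall x, genuine x -> ei (flip x) = ei x.
Hypothesis ei_inj : forall x y, genuine x -> genuine y -> ei x = ei y ->
  fconnect rot x y \/ fconnect rot (flip x) y.
Variable s : T -> 'S_4.
Hypothesis s_even : forall t, ~~ odd_perm (s t).
Hypothesis s_top : forall t w, up t (s t (iW w)).
Hypothesis s_bot : forall t m, ~~ up t (s t (iN m)).
Hypothesis ec_mid : forall t m w, ec (ei (t, (s t (iN m), s t (iW w)))) = m (+) w.

Definition ang t k l : angle T := (t, (s t (others k l).1, s t (others k l).2)).
Definition tbe t := ec (ei (t, (s t (iN false), s t (iN true)))).
Definition tal t := ec (ei (t, (s t (iW false), s t (iW true)))).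
Definition top_face t w := s t (iW (~~ w)).
Definition cross t w : T * bool :=
  let i := top_face t w in let t1 := adj G t i in
  (t1, glue G t i i == s t1 (iN false)).

Arguments cross : simpl never.

Lemma s_genuine t k l : k != l -> genuine (t, (s t k, s t l)).
Proof. by move=> kl; rewrite /genuine /= (inj_eq perm_inj). Qed.

Lemma ang_genuine t k l : k != l -> genuine (ang t k l).
Proof. by move=> kl; apply/s_genuine/others_neq. Qed.

Lemma iN_iW m w : iN m != iW w. Proof. by case: m w => [] []. Qed.
Lemma iN_neq m : iN (~~ m) != iN m. Proof. by case: m. Qed.
Lemma iW_neq m : iW (~~ m) != iW m. Proof. by case: m. Qed.

Lemma colour_s t k l : k != l ->
  ec (ei (t, (s t k, s t l))) = face_colour (tbe t) (tal t) k l.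
Proof.
have fl i j : i != j -> ei (t, (s t j, s t i)) = ei (t, (s t i, s t j)).
  by move=> ij; rewrite -[LHS]ei_flip // s_genuine // eq_sym.
move=> kl; have [m [w]] : exists m w, [\/ (k = iN m /\ l = iN (~~ m)),
   (k = iW w /\ l = iW (~~ w)), (k = iN m /\ l = iW w) | (k = iW w /\ l = iN m)].
  elim/ord4P: k kl => kl; elim/ord4P: l kl => // _;
   [> exists false, false | exists false, false | exists false, true
    | exists true, false | exists true, false | exists true, true
    | exists false, false | exists true, false | exists true, false
    | exists false, true | exists true, true | exists true, true];
   by [constructor 1|constructor 2|constructor 3|constructor 4].
case=> -[-> ->].
- by case: m => /=; rewrite /face_colour // fl.
- by case: w => /=; rewrite /face_colour // fl.
- by rewrite ec_mid; case: m w => [] [].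
- by rewrite fl ?iN_iW // ec_mid; case: m w => [] [].
Qed.

Section Cross.
Variables (t : T) (w : bool).
Let i := top_face t w.
Let t1 := (cross t w).1.
Let m := (cross t w).2.
Definition transfer : 'S_4 := (s t * glue G t i * (s t1)^-1)%g.
Local Notation tau := transfer.

Lemma s_transfer k : s t1 (tau k) = glue G t i (s t k).
Proof. by rewrite /tau !permM permKV. Qed.

Lemma odd_transfer : odd_perm tau.
Proof.
by rewrite /tau !odd_permM odd_permV (negPf (s_even _)) (negPf (s_even _)) (glue_odd HG).
Qed.

Lemma transfer_face : tau (iW (~~ w)) = iN (~~ m).
Proof.
apply: (@perm_inj _ (s t1)); rewrite s_transfer -/(top_face t w) -/i.
have d : ~~ up t1 (glue G t i i) by rewrite (up_adj HT) negbK s_top.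
rewrite /m /cross /= -/i -/t1; case: eqP => //= ne.
have [k kE] : exists k, glue G t i i = s t1 k.
  by exists ((s t1)^-1%g (glue G t i i)); rewrite permKV.
rewrite kE in d ne *; congr (s t1 _); elim/ord4P: k kE d ne => // _ /negP d.
- by case: (d (s_top t1 false)).
- by case: (d (s_top t1 true)).
Qed.

Lemma cross_rot k :
  rot (t, (s t k, s t (iW (~~ w)))) = (t1, (s t1 (tau (iW (~~ w))), s t1 (tau k))).
Proof. by rewrite !s_transfer. Qed.

Lemma transferP : [/\ tbe t1 = tal t, tau (iN (w (+) tal t)) = iW (m (+) tal t),
  tau (iN (~~ (w (+) tal t))) = iN m & tau (iW w) = iW (~~ (m (+) tal t))].
Proof.
apply: (glue_odd_perm odd_transfer transfer_face) => k kf.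
have e : ec (ei (t, (s t k, s t (iW (~~ w))))) =
    ec (ei (t1, (s t1 (tau k), s t1 (tau (iW (~~ w)))))).
  rewrite -ei_rot ?s_genuine // cross_rot // -ei_flip ?s_genuine //.
  by rewrite eq_sym (inj_eq perm_inj).
rewrite !colour_s ?(inj_eq perm_inj) // transfer_face in e.
have kf' : tau k != iN (~~ m) by rewrite -transfer_face (inj_eq perm_inj).
move: e kf'; move: (tau k) => k'.
by case: (w) kf => /=; elim/ord4P: k => //; case: (m) => /=; elim/ord4P: k' => //.
Qed.

Lemma cross_ang k l : k != l -> k != iW (~~ w) -> l != iW (~~ w) ->
  fconnect rot (ang t k l) (ang t1 (tau k) (tau l)) /\
  theta (ang t1 (tau k) (tau l)) + dlt (t, i) = theta (ang t k l).
Proof.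
move=> kl kf lf; have ga := ang_genuine t kl.
have ga1 : genuine (ang t1 (tau k) (tau l)).
  by apply: ang_genuine; rewrite (inj_eq perm_inj).
have aE : ang t1 (tau k) (tau l) =
    (t1, (s t1 (tau (others k l).2), s t1 (tau (others k l).1))).
  by rewrite /ang others_odd // odd_transfer.
have on := others_neq kl.
rewrite eq_sym in kf; rewrite eq_sym in lf; have [e|e] := others_face kl kf lf.
- have r : rot (flip (ang t k l)) = flip (ang t1 (tau k) (tau l)).
    by rewrite aE /ang /flip /= -e -[RHS]cross_rot.
  split.
    rewrite connect_sym_rot // -{1}[ang t1 _ _]flipK -r.
    by rewrite -[X in fconnect _ _ X](rot_flip HG); apply: fconnect1.
  rewrite -theta_flip // -r theta_rot ?genuine_flip // theta_flip //.
  by rewrite /exit /= -e subrK.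
- have r : rot (ang t k l) = ang t1 (tau k) (tau l).
    by rewrite aE /ang -e -[RHS]cross_rot.
  split; first by rewrite -r fconnect1.
  by rewrite -r theta_rot // /exit /= -e subrK.
Qed.

End Cross.

Lemma ei_connect x y : genuine x -> fconnect rot x y -> ei y = ei x.
Proof.
move=> gx /iter_findex <-; move: (findex _ _ _) => k.
by elim: k => //= k IHk; rewrite ei_rot // genuine_iter.
Qed.

Lemma ang_flip t k l : k != l -> ang t l k = flip (ang t k l).
Proof. by move=> kl; rewrite /ang othersC. Qed.

Lemma ei_angC t k l : k != l -> ei (ang t l k) = ei (ang t k l).
Proof. by move=> kl; rewrite ang_flip // ei_flip // ang_genuine. Qed.

Lemma theta_angC t k l : k != l -> theta (ang t l k) = theta (ang t k l).
Proof. by move=> kl; rewrite ang_flip // theta_flip // ang_genuine. Qed.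

Lemma cross_edge t w k l : k != l -> k != iW (~~ w) -> l != iW (~~ w) ->
  let a := ang (cross t w).1 (transfer t w k) (transfer t w l) in
  ei a = ei (ang t k l) /\ theta a + dlt (t, top_face t w) = theta (ang t k l).
Proof.
move=> kl kf lf; have [c e] := cross_ang t kl kf lf.
by split=> //; apply: ei_connect c; apply: ang_genuine.
Qed.

Definition a_b t := ang t (iW false) (iW true).
Definition a_a t := ang t (iN false) (iN true).
Definition a_q t m w := ang t (iN m) (iW w).

Lemma a_bE t w : ei (ang t (iW w) (iW (~~ w))) = ei (a_b t) /\
  theta (ang t (iW w) (iW (~~ w))) = theta (a_b t).
Proof.
by case: w; split; [apply: ei_angC | apply: theta_angC | reflexivity | reflexivity].
Qed.

Lemma a_aE t w : ei (ang t (iN w) (iN (~~ w))) = ei (a_a t) /\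
  theta (ang t (iN w) (iN (~~ w))) = theta (a_a t).
Proof.
by case: w; split; [apply: ei_angC | apply: theta_angC | reflexivity | reflexivity].
Qed.

Lemma a_bot t : bottom_diagonal up (a_b t).
Proof. by rewrite /bottom_diagonal /= (s_bot t false) (s_bot t true). Qed.
Lemma a_top t : top_diagonal up (a_a t).
Proof. by rewrite /top_diagonal /= (s_top t false) (s_top t true). Qed.

Lemma b_inj : injective (fun t => ei (a_b t)).
Proof.
move=> t1 t2 /ei_inj[]; rewrite ?ang_genuine // => c.
  have [y [_ yu]] := unique_diag HG HT false (ang_genuine t1 (k:=iW false) (l:=iW true) isT).
  have e1 := yu _ (conj (connect0 _ _) (a_bot t1)).
  by have := yu _ (conj c (a_bot t2)); rewrite e1 => -[].
have gx : genuine (flip (a_b t1)) by rewrite genuine_flip ang_genuine.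
have [y [_ yu]] := unique_diag HG HT false gx.
have bf : bottom_diagonal up (flip (a_b t1)) by rewrite diag_flip a_bot.
have e1 := yu _ (conj (connect0 _ _) bf).
by have := yu _ (conj c (a_bot t2)); rewrite e1 => -[].
Qed.

Lemma a_inj : injective (fun t => ei (a_a t)).
Proof.
move=> t1 t2 /ei_inj[]; rewrite ?ang_genuine // => c.
  have [y [_ yu]] := unique_diag HG HT true (ang_genuine t1 (k:=iN false) (l:=iN true) isT).
  have e1 := yu _ (conj (connect0 _ _) (a_top t1)).
  by have := yu _ (conj c (a_top t2)); rewrite e1 => -[].
have gx : genuine (flip (a_a t1)) by rewrite genuine_flip ang_genuine.
have [y [_ yu]] := unique_diag HG HT true gx.
have bf : top_diagonal up (flip (a_a t1)) by rewrite diag_flip a_top.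
have e1 := yu _ (conj (connect0 _ _) bf).
by have := yu _ (conj c (a_top t2)); rewrite e1 => -[].
Qed.

Lemma cross_face t w : s (cross t w).1 (iN (~~ (cross t w).2)) =
  glue G t (top_face t w) (top_face t w).
Proof. by rewrite -transfer_face s_transfer. Qed.

Definition back_face (f : T * bool) : 'I_4 := s f.1 (iN (~~ f.2)).

Lemma uncross t w : adj G (cross t w).1 (back_face (cross t w)) = t /\
  glue G (cross t w).1 (back_face (cross t w)) (back_face (cross t w)) = top_face t w.
Proof. by rewrite /back_face cross_face /= (adjK HG) (glueK HG) permK. Qed.

Lemma cross_inj : injective (fun f => cross f.1 f.2).
Proof.
move=> [t w] [t' w'] e; have {}e : cross t w = cross t' w' by exact: e.
have [a1 g1] := uncross t w; have [a2 g2] := uncross t' w'.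
have et : t = t' by rewrite -[LHS]a1 -[RHS]a2 e.
subst t'; congr (_, _); move: g1; rewrite e g2 => /perm_inj.
by case: w w' {e g2 a1 a2} => [] [].
Qed.

Lemma cross_U t w : let t1 := (cross t w).1 in let m := (cross t w).2 in
  ei (a_b t1) = ei (a_q t (w (+) tal t) w) /\
  theta (a_b t1) + dlt (t, top_face t w) = theta (a_q t (w (+) tal t) w).
Proof.
have [_ e1 _ e2] := transferP t w; have := @cross_edge t w (iN (w (+) tal t)) (iW w).
rewrite e1 e2 iN_iW iN_iW eq_sym iW_neq => /(_ isT isT isT) /=.
by have [-> ->] := a_bE (cross t w).1 ((cross t w).2 (+) tal t).
Qed.

Lemma cross_L t w : let t1 := (cross t w).1 in let m := (cross t w).2 in
  ei (a_q t1 m (m (+) tbe t1)) = ei (a_a t) /\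
  theta (a_q t1 m (m (+) tbe t1)) + dlt (t, top_face t w) = theta (a_a t).
Proof.
have [e0 e1 e2 _] := transferP t w.
have := @cross_edge t w (iN (~~ (w (+) tal t))) (iN (w (+) tal t)).
rewrite e1 e2 !iN_iW iN_neq => /(_ isT isT isT) /=.
rewrite e0.
by have := a_aE t (~~ (w (+) tal t)); rewrite negbK => -[-> ->].
Qed.

Lemma cross_S t w : let t1 := (cross t w).1 in let m := (cross t w).2 in
  ei (a_q t1 m (~~ (m (+) tbe t1))) = ei (a_q t (~~ (w (+) tal t)) w) /\
  theta (a_q t1 m (~~ (m (+) tbe t1))) + dlt (t, top_face t w) =
    theta (a_q t (~~ (w (+) tal t)) w).
Proof.
have [e0 _ e1 e2] := transferP t w.
have := @cross_edge t w (iN (~~ (w (+) tal t))) (iW w).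
rewrite e1 e2 iN_iW iN_iW eq_sym iW_neq => /(_ isT isT isT) /=.
by rewrite e0.
Qed.

Lemma ec_aq t m w : ec (ei (a_q t m w)) = m (+) w.
Proof.
rewrite /a_q /ang others_NW; case: ifP => e /=; first by rewrite ec_mid addbN addNb negbK.
rewrite -ei_flip; last by apply: s_genuine; rewrite eq_sym iN_iW.
by rewrite /flip /= ec_mid addbN addNb negbK.
Qed.

Notation un := (@enum_val T predT).
Notation rk := (@enum_rank T).
Definition icross (f : 'I_n * bool) : 'I_n * bool :=
  let c := cross (un f.1) f.2 in (rk c.1, c.2).

Lemma icross_inj : injective icross.
Proof.
move=> [t w] [t' w'] e.
have e1 : (cross (un t) w).1 = (cross (un t') w').1 by exact: enum_rank_inj (congr1 fst e).
have e2 : (cross (un t) w).2 = (cross (un t') w').2 by move: (congr1 snd e).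
have /(@cross_inj (un t, w) (un t', w')) : cross (un t) w = cross (un t') w'.
  by rewrite [LHS]surjective_pairing e1 e2 -surjective_pairing.
by case=> /enum_val_inj -> ->.
Qed.

Lemma unK t : un (rk t) = t. Proof. exact: enum_rankK. Qed.

Definition flat : flat_veering C n.
Proof.
refine (@FlatVeering C n (fun i => ei (a_b (un i))) (fun i => theta (a_b (un i)))
  (fun i => ei (a_a (un i))) (fun i => theta (a_a (un i)))
  (fun i m w => ei (a_q (un i) m w)) (fun i m w => theta (a_q (un i) m w))
  (fun i => tbe (un i)) (fun i => tal (un i)) ec icross
  (fun f => dlt (un f.1, top_face (un f.1) f.2))
  _ _ icross_inj _ _ _ _ _ _ _).
- by move=> t1 t2 /b_inj/enum_val_inj.
- by move=> t1 t2 /a_inj/enum_val_inj.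
- by [].
- by [].
- by move=> t m w; apply: ec_aq.
- by move=> t w; rewrite /= unK; have [] := transferP (un t) w.
- move=> t w; have := cross_U (un t) w.
  by rewrite /icross /= unK.
- move=> t w; have := cross_L (un t) w.
  by rewrite /icross /= unK.
- move=> t w; have := cross_S (un t) w.
  by rewrite /icross /= unK.
Defined.

Notation bot := (bot G up).

Definition climb_half x : T * bool := let y := bot x in (y.1, y.2.1 == s y.1 (iN false)).
Arguments climb_half : simpl never.
Definition ihw (t : 'I_n) m w : 'I_n * bool :=
  let h := climb_half (a_q (un t) m w) in (rk h.1, h.2).

Lemma down_face t i : ~~ up t i -> exists m, i = s t (iN m).
Proof.
have [k ->] : exists k, i = s t k by exists ((s t)^-1%g i); rewrite permKV.
elim/ord4P: k => d; [by exists false|by exists true|..]; case/negP: d.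
  exact: (s_top t false).
exact: (s_top t true).
Qed.

Lemma climb_half_connect x y : genuine x -> fconnect rot x y ->
  climb_half y = climb_half x.
Proof. by move=> gx xy; rewrite /climb_half (bot_connect HG HT gx xy). Qed.

Lemma climb_half_bot t c : climb_half (ang t (iW c) (iW (~~ c))) = (t, ~~ c).
Proof.
have cc : iW c != iW (~~ c) by rewrite eq_sym iW_neq.
have aE : ang t (iW c) (iW (~~ c)) = (t, (s t (iN c), s t (iN (~~ c)))).
  by have := others_WW (~~ c); rewrite negbK /ang => ->.
have b : bottom_diagonal up (ang t (iW c) (iW (~~ c))).
  by rewrite aE /bottom_diagonal /= !s_bot.
rewrite /climb_half (bot_bottom HG HT (ang_genuine t cc) b) aE /= (inj_eq perm_inj).
by case: c {cc b aE}.
Qed.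

Lemma climb_half_ei x : genuine x -> ei (a_b (climb_half x).1) = ei x.
Proof.
move=> gx; have [xb bb] := botP HG HT gx.
have gb : genuine (bot x) by rewrite (genuine_connect xb).
rewrite -(ei_connect gx xb) /climb_half; case: (bot x) bb gb => t [i j].
rewrite /bottom_diagonal /= => /andP[/down_face[m ->] /down_face[m1 ->]] g.
have -> : m1 = ~~ m by move: g; rewrite /genuine /= (inj_eq perm_inj); case: m m1 => [] [].
case: m {g} => //=; rewrite -ei_flip //.
exact: s_genuine.
Qed.

Lemma climb_U t w : let t1 := (cross t w).1 in let m := (cross t w).2 in
  climb_half (a_q t (w (+) tal t) w) = (t1, ~~ (m (+) tbe t1)).
Proof.
have [e0 e1 _ e2] := transferP t w.
have [] := @cross_ang t w (iN (w (+) tal t)) (iW w).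
- exact: iN_iW.
- exact: iN_iW.
- by rewrite eq_sym iW_neq.
rewrite e1 e2 => c _ /=.
rewrite -(climb_half_connect _ c) ?ang_genuine ?iN_iW //.
by rewrite climb_half_bot e0.
Qed.

Lemma climb_S t w : let t1 := (cross t w).1 in let m := (cross t w).2 in
  climb_half (a_q t (~~ (w (+) tal t)) w) = climb_half (a_q t1 m (~~ (m (+) tbe t1))).
Proof.
have [e0 _ e1 e2] := transferP t w.
have [] := @cross_ang t w (iN (~~ (w (+) tal t))) (iW w).
- exact: iN_iW.
- exact: iN_iW.
- by rewrite eq_sym iW_neq.
rewrite e1 e2 => c _ /=.
by rewrite -(climb_half_connect _ c) ?ang_genuine ?iN_iW // e0.
Qed.

Definition tladder (f : T * bool) := cross f.1 (~~ (f.2 (+) tbe f.1)).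

(* As long as the colours of the two diagonals agree, the ladder turns around a
   fixed edge without ever meeting its bottom diagonal. *)
Definition ladder_angle (f : T * bool) : angle T :=
  (f.1, (s f.1 (iN (~~ f.2)), s f.1 (iW (f.2 (+) tbe f.1)))).

Lemma ladder_angle_rot f : tal f.1 = tbe f.1 ->
  rot (ladder_angle f) = ladder_angle (tladder f).
Proof.
case: f => t m /= e; set w := ~~ (m (+) tbe t).
have [e0 e1 _ _] := transferP t w.
have := cross_rot t w (iN (~~ m)); rewrite transfer_face negbK.
have -> : iN (~~ m) = iN (w (+) tal t) by rewrite /w e; case: (m); case: (tbe t).
rewrite e1 -e0 /tladder /ladder_angle /= => ->.
by [].
Qed.

Lemma tladder_hinge f : exists k, let t := (iter k tladder f).1 in tal t != tbe t.
Proof.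
apply: contrapT => H.
have {}H k : tal (iter k tladder f).1 = tbe (iter k tladder f).1.
  by apply/eqP/negPn/negP => ne; apply: H; exists k.
have r k : iter k rot (ladder_angle f) = ladder_angle (iter k tladder f).
  by elim: k => //= k ->; rewrite ladder_angle_rot.
have gy : genuine (ladder_angle f) by apply/s_genuine/iN_iW.
have [/iter_findex <-] := botP HG HT gy.
by rewrite r => /andP[_] /=; rewrite s_top.
Qed.

Lemma iter_icross k (t : 'I_n) b : iter k (ladder flat) (t, b) =
  let f := iter k tladder (un t, b) in (rk f.1, f.2).
Proof.
elim: k => [|k IHk] /=; first by rewrite enum_valK.
by rewrite IHk /ladder /= /icross /= unK.
Qed.

Definition flat_climbing : climbing flat.
Proof.
refine (@Climbing C n flat ihw (fun i m w => ((ihw i m w).1, ~~ (ihw i m w).2)) _ _ _ _ _).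
- move=> t m w; rewrite /= unK climb_half_ei //.
  exact/ang_genuine/iN_iW.
- by [].
- move=> t w; change (ihw t (w (+) tal (un t)) w = (rk (cross (un t) w).1,
    ~~ ((cross (un t) w).2 (+) tbe (un (rk (cross (un t) w).1))))).
  by rewrite unK /ihw climb_U.
- move=> t w; change (ihw t (~~ (w (+) tal (un t))) w = ihw (rk (cross (un t) w).1)
    (cross (un t) w).2 (~~ ((cross (un t) w).2 (+) tbe (un (rk (cross (un t) w).1))))).
  by rewrite /ihw climb_S unK.
- case=> t b; have [k kP] := tladder_hinge (un t, b).
  by exists k; rewrite iter_icross /= unK.
Defined.

End Flat.

Arguments cross : simpl never.

Section Opposite.
Variables (T : finType) (G : gluing T) (up : T -> 'I_4 -> bool).
Hypotheses (HG : ideal_triangulation G) (HT : transverse_taut G up).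
Local Notation rot := (Defs.rot G).
Variables (C : zmodType) (dlt : T * 'I_4 -> C).
Hypothesis dlt_adj : forall t i, dlt (adj G t i, glue G t i i) = - dlt (t, i).
Local Notation n := #|T|.
Implicit Types (x y : angle T) (t : T).
Variables (theta : angle T -> C) (ei : angle T -> 'I_n) (ec : 'I_n -> bool).
Hypothesis theta_rot : forall x, genuine x -> theta (rot x) = theta x - exit dlt x.
Hypothesis theta_flip : forall x, genuine x -> theta (flip x) = theta x.
Hypothesis ei_rot : forall x, genuine x -> ei (rot x) = ei x.
Hypothesis ei_flip : forall x, genuine x -> ei (flip x) = ei x.
Hypothesis ei_inj : forall x y, genuine x -> genuine y -> ei x = ei y ->
  fconnect rot x y \/ fconnect rot (flip x) y.
Variable s : T -> 'S_4.
Hypothesis s_even : forall t, ~~ odd_perm (s t).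
Hypothesis s_top : forall t w, up t (s t (iW w)).
Hypothesis s_bot : forall t m, ~~ up t (s t (iN m)).
Hypothesis ec_mid : forall t m w, ec (ei (t, (s t (iN m), s t (iW w)))) = m (+) w.

Definition op_up t i := ~~ up t i.
Definition quarter_turn : 'S_4 := (tperm (iN false) (iW false) * tperm (iN true) (iW true))%g.
Definition op_s t : 'S_4 := (quarter_turn * s t)%g.

Lemma quarter_N m : quarter_turn (iN m) = iW m.
Proof. by rewrite !permE /=; case: m; rewrite !permE. Qed.
Lemma quarter_W m : quarter_turn (iW m) = iN m.
Proof. by rewrite !permE /=; case: m; rewrite !permE. Qed.

Lemma op_s_N t m : op_s t (iN m) = s t (iW m). Proof. by rewrite permM quarter_N. Qed.
Lemma op_s_W t w : op_s t (iW w) = s t (iN w). Proof. by rewrite permM quarter_W. Qed.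

Lemma op_s_even t : ~~ odd_perm (op_s t).
Proof. by rewrite !odd_permM !odd_tperm (negPf (s_even t)). Qed.
Lemma op_s_top t w : op_up t (op_s t (iW w)). Proof. by rewrite op_s_W /op_up s_bot. Qed.
Lemma op_s_bot t m : ~~ op_up t (op_s t (iN m)). Proof. by rewrite op_s_N /op_up negbK s_top. Qed.

Lemma op_taut : transverse_taut G op_up.
Proof.
split=> [t i|t|e eE]; first by rewrite /op_up (up_adj HT).
  have := cardsC [set i | up t i]; rewrite (two_top HT) card_ord => /eqP.
  rewrite (eqn_add2l 2 _ 2) => /eqP e; rewrite -[RHS]e.
  by apply: eq_card => i; rewrite !inE.
rewrite -[RHS](angle_sum HT eE); apply: eq_card => a; rewrite !inE.
by rewrite /top_diagonal /bottom_diagonal /op_up !negbK orbC.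
Qed.

Lemma op_ec_mid t m w : ec (ei (t, (op_s t (iN m), op_s t (iW w)))) = m (+) w.
Proof.
by rewrite op_s_N op_s_W -ei_flip ?ec_mid 1?addbC // /genuine /= (inj_eq perm_inj) eq_sym iN_iW.
Qed.

Notation v := (flat HG HT theta_rot theta_flip ei_rot ei_flip ei_inj s_even s_top s_bot ec_mid).
Notation v' := (flat HG op_taut theta_rot theta_flip ei_rot ei_flip ei_inj
  op_s_even op_s_top op_s_bot op_ec_mid).

Lemma a_q_op t m w : a_q op_s t w m = flip (a_q s t m w).
Proof.
rewrite /a_q /ang !others_NW addbC; case: ifP => _ /=.
  by rewrite op_s_N op_s_W.
by rewrite op_s_N op_s_W.
Qed.

Lemma a_b_op t : a_b op_s t = a_a s t.
Proof.
rewrite /a_b /a_a /ang.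
have -> : others (iW false) (iW true) = (iN false, iN true) by exact: (others_WW true).
have -> : others (iN false) (iN true) = (iW false, iW true) by exact: (others_NN true).
by rewrite /= !(op_s_N t false) (op_s_N t true).
Qed.

Lemma a_a_op t : a_a op_s t = a_b s t.
Proof.
rewrite /a_b /a_a /ang.
have -> : others (iW false) (iW true) = (iN false, iN true) by exact: (others_WW true).
have -> : others (iN false) (iN true) = (iW false, iW true) by exact: (others_NN true).
by rewrite /= !(op_s_W t false) (op_s_W t true).
Qed.

Lemma top_face_op (f : T * bool) : top_face op_s f.1 f.2 = back_face s f.
Proof. by rewrite /top_face op_s_W. Qed.

Lemma cross_op t w : cross G op_s (cross G s t w).1 (cross G s t w).2 = (t, w).
Proof.
have [e1 e2] := uncross HG HT s_top t w.
rewrite -[LHS]/(adj G (cross G s t w).1 (top_face op_s (cross G s t w).1 (cross G s t w).2),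
  glue G (cross G s t w).1 (top_face op_s (cross G s t w).1 (cross G s t w).2)
    (top_face op_s (cross G s t w).1 (cross G s t w).2) ==
  op_s (adj G (cross G s t w).1 (top_face op_s (cross G s t w).1 (cross G s t w).2)) (iN false)).
rewrite top_face_op e1 e2 op_s_N (inj_eq perm_inj).
by case: w {e1 e2}.
Qed.

Lemma flat_opposite : opposite v v'.
Proof.
have aq t m w : genuine (a_q s t m w) by apply/ang_genuine/iN_iW.
split.
- by move=> t; rewrite /= a_b_op.
- by move=> t; rewrite /= a_b_op.
- by move=> t; rewrite /= a_a_op.
- by move=> t; rewrite /= a_a_op.
- by move=> t m w; rewrite /= a_q_op ei_flip.
- by move=> t m w; rewrite /= a_q_op theta_flip.
- by move=> t; rewrite /= /tbe -[LHS]/(ec (ei (a_b op_s _))) a_b_op.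
- by move=> t; rewrite /= -[LHS]/(ec (ei (a_a op_s _))) a_a_op.
- by [].
- move=> [t w]; pose c := cross G s (enum_val t) w.
  change ((enum_rank (cross G op_s (enum_val (enum_rank c.1)) c.2).1,
    (cross G op_s (enum_val (enum_rank c.1)) c.2).2) = (t, w)).
  by rewrite unK cross_op enum_valK.
- move=> [t w]; pose c := cross G s (enum_val t) w.
  change (dlt (enum_val (enum_rank c.1), top_face op_s (enum_val (enum_rank c.1)) c.2) =
    - dlt (enum_val t, top_face s (enum_val t) w)).
  by rewrite unK (top_face_op c) /back_face (cross_face HT s_top) -dlt_adj.
Qed.

End Opposite.

Arguments cross : simpl never.

Section Cocycle.
Variables (T : finType) (G : gluing T).
Hypothesis HG : ideal_triangulation G.
Local Notation C := (chain_class G).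
Implicit Types (t : T) (u : T -> C).

Definition evaluate u (f : {ffun T -> int}) : C := \sum_t u t *~ f t.
Lemma evaluate_zmod u : zmod_morphism (evaluate u).
Proof.
move=> f g; rewrite /evaluate -sumrB; apply: eq_bigr => t _.
by rewrite !ffunE mulrzBr.
Qed.
HB.instance Definition _ u := GRing.isZmodMorphism.Build _ _ (evaluate u) (evaluate_zmod u).

Lemma evaluate_point u t : evaluate u (point t) = u t.
Proof.
rewrite /evaluate (bigD1 t) //= ffunE eqxx mulr1z big1 ?addr0 // => t' /negPf ne.
by rewrite ffunE ne mulr0z.
Qed.

Lemma class_of_sum c : class_of G c = \sum_s dlt G s *~ c s.
Proof.
have cE : c = \sum_s dual_edge s *~ c s.
  apply/ffunP => s; rewrite sum_ffunE (bigD1 s) //= ffunMzE ffunE eqxx intz.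
  rewrite big1 ?addr0 // => op_s ne; rewrite ffunMzE ffunE eq_sym (negPf ne).
  exact: mul0rz.
rewrite {1}cE [LHS](raddf_sum (\pi_C)%qT); apply: eq_bigr => s _.
exact: raddfMz.
Qed.

Lemma coboundary_trivial u :
    (forall t i, u (adj G t i) = u t + dlt G (t, i)) -> forall h : H1_free G, h = 0.
Proof.
move=> uE [x xP]; apply: val_inj => /=; move/asboolP: (xP) => [c bc <-].
rewrite class_of_sum -[RHS](raddf0 (evaluate u)) -bc raddf_sum.
apply: eq_bigr => -[t i] _ /=.
have -> : dlt G (t, i) = evaluate u (point (adj G t i) - point t).
  by rewrite evaluate_zmod !evaluate_point uE addrAC subrr add0r.
exact/esym/raddfMz.
Qed.

Variable up : T -> 'I_4 -> bool.
Hypothesis up_adj : forall t i, up (adj G t i) (glue G t i i) = ~~ up t i.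

Lemma no_twisted_section (z : T -> cring G) (h : H1_free G) : h != 0 ->
    (forall t i, up t i -> exists b : bool,
      z (adj G t i) = (-1) ^+ b * @cx _ G (dlt G (t, i)) * z t) ->
  forall t, z t = 0.
Proof.
move=> h0 zE t0; apply/eqP/negPn/negP => z0; move/eqP: h0; apply.
have lead_adj t i l : up t i -> leading (@pos _ G) (z t) l ->
    leading (@pos _ G) (z (adj G t i)) (dlt G (t, i) + l).
  move=> ti lt; have [b ->] := zE t i ti.
  by have [] := leading_monomial (@pos0 _ G) (@posD _ G) b (dlt G (t, i)) lt.
have lead_neq0 (p : cring G) l : leading (@pos _ G) p l -> p != 0.
  by case=> pl _; apply: contraNneq pl => ->; rewrite mcoeff0.
have z_adj t i : z t != 0 -> z (adj G t i) != 0.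
  move=> nz; have [ti|ti] := boolP (up t i).
    have [l lP] := leadingP (@posD _ G) (@posT _ G) nz.
    exact: lead_neq0 (lead_adj _ _ _ ti lP).
  apply: contraNneq nz => e; have := zE (adj G t i) (glue G t i i).
  rewrite up_adj ti adjK // e => /(_ isT)[b ->].
  apply/eqP; exact: mulr0.
have z_neq0 t : z t != 0.
  have /connectP[p] := triang_connected HG t0 t.
  elim: p t0 z0 => [|t1 p IHp] t0 z0 /=; first by move=> _ ->.
  case/andP=> /existsP[i /eqP <-]; apply: IHp.
  exact: z_adj.
pose lt t := cid (leadingP (@posD _ G) (@posT _ G) (z_neq0 t)).
have u_up t i : up t i -> sval (lt (adj G t i)) = sval (lt t) + dlt G (t, i).
  move=> ti; apply: (leading_unique (@pos0 _ G) (@posD _ G) (svalP (lt _))).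
  by rewrite addrC; apply: lead_adj => //; apply: svalP.
apply: (@coboundary_trivial (fun t => sval (lt t))) => t i.
have [|ti] := boolP (up t i); first exact: u_up.
have := u_up (adj G t i) (glue G t i i); rewrite up_adj ti adjK // dlt_adj.
by move=> /(_ isT) ->; rewrite subrK.
Qed.
End Cocycle.

Section Minors.
Variables (T : finType) (G : gluing T) (up : T -> 'I_4 -> bool).
Variable colour : {set angle T} -> edge_colour.
Hypotheses (HG : ideal_triangulation G) (HT : transverse_taut G up).
Hypothesis HV : veering G up colour.
Local Notation n := #|T|.
Implicit Types (t : T) (x y : angle T).

Lemma compass t : exists s : 'S_4,
  [/\ ~~ odd_perm s, forall w, up t (s (iW w)) & forall m, ~~ up t (s (iN m))].
Proof.
have /eqP/cards2P[a [b [ab E]]] := two_top HT t.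
have /cards2P[c [d [cd E1]]] : #|~: [set i | up t i]| == 2%N.
  have := cardsC [set i | up t i]; rewrite (two_top HT) card_ord => /eqP.
  by rewrite (eqn_add2l 2 _ 2).
have upE i : up t i = (i == a) || (i == b).
  by have := congr1 (fun S : {set 'I_4} => i \in S) E; rewrite !inE.
have dnE i : ~~ up t i = (i == c) || (i == d).
  by have := congr1 (fun S : {set 'I_4} => i \in S) E1; rewrite !inE.
have ac : a != c by apply/eqP => e; have := dnE a; rewrite upE -e !eqxx.
have ad : a != d by apply/eqP => e; have := dnE a; rewrite upE -e !eqxx orbT.
have bc : b != c by apply/eqP => e; have := dnE b; rewrite upE -e !eqxx orbT.
have bd : b != d by apply/eqP => e; have := dnE b; rewrite upE -e !eqxx !orbT.
have fi : injective (val4 c d a b).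
  move: ab cd ac ad bc bd => /eqP ab /eqP cd /eqP ac /eqP ad /eqP bc /eqP bd.
  by move=> i j; elim/ord4P: i; elim/ord4P: j => //= e; exfalso; eauto using esym.
pose s0 := perm fi.
have s0P : (forall w, up t (s0 (iW w))) /\ (forall m, ~~ up t (s0 (iN m))).
  split=> [w|m]; rewrite permE.
    by rewrite upE; case: w; rewrite /val4 /= eqxx ?orbT.
  by rewrite dnE; case: m; rewrite /val4 /= eqxx ?orbT.
have [odd0|even0] := boolP (odd_perm s0); last by exists s0; case: s0P.
exists (tperm (iN false) (iN true) * s0)%g; case: s0P => top0 bot0.
split=> [|w|m]; first by rewrite odd_permM odd_tperm odd0.
  by rewrite permM tpermD ?top0 // iN_iW.
by rewrite permM; case: m; rewrite ?tpermL ?tpermR.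
Qed.

Definition cs t : 'S_4 := sval (cid (compass t)).
Lemma cs_even t : ~~ odd_perm (cs t). Proof. by rewrite /cs; case: cid => s []. Qed.
Lemma cs_top t w : up t (cs t (iW w)). Proof. by rewrite /cs; case: cid => s []. Qed.
Lemma cs_bot t m : ~~ up t (cs t (iN m)). Proof. by rewrite /cs; case: cid => s []. Qed.

Definition edge_index x : 'I_n := enum_rank (bot G up x).1.
Definition bottom_edge t : angle T := (t, (cs t (iN false), cs t (iN true))).
Definition edge_blue (k : 'I_n) : bool :=
  blue (colour (edge_of G (bottom_edge (enum_val k)))).
Definition label := theta G up (dlt G).

Lemma edge_index_rot x : genuine x -> edge_index (Defs.rot G x) = edge_index x.
Proof. by move=> gx; rewrite /edge_index (bot_rot HG HT). Qed.
Lemma edge_index_flip x : genuine x -> edge_index (flip x) = edge_index x.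
Proof. by move=> gx; rewrite /edge_index (bot_flip HG HT). Qed.

Lemma bottom_edgeP x : bottom_diagonal up x -> genuine x ->
  x = bottom_edge x.1 \/ x = flip (bottom_edge x.1).
Proof.
case: x => t [i j] /andP[/= di dj] g.
have [m mE] := @down_face _ up (cs) cs_top t i di.
have [m' mE'] := @down_face _ up (cs) cs_top t j dj.
rewrite mE mE' /genuine /= (inj_eq perm_inj) in g *.
by case: m m' g {mE mE'} => [] [] // _; [right|left].
Qed.

Lemma edge_of_connect x y : fconnect (Defs.rot G) x y -> edge_of G y = edge_of G x.
Proof.
move/iter_findex <-; move: (findex _ _ _) => k.
by elim: k => //= k IHk; rewrite edge_of_rot.
Qed.

Lemma edge_index_inj x y : genuine x -> genuine y -> edge_index x = edge_index y ->
  fconnect (Defs.rot G) x y \/ fconnect (Defs.rot G) (flip x) y.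
Proof.
move=> gx gy /enum_rank_inj e.
have [xb bb] := botP HG HT gx; have [yb bb'] := botP HG HT gy.
have [gb gb'] : genuine (bot G up x) /\ genuine (bot G up y).
  by rewrite !(genuine_connect xb) (genuine_connect yb).
have [E|E] : bot G up y = bot G up x \/ bot G up y = flip (bot G up x).
  have := bottom_edgeP bb gb; have := bottom_edgeP bb' gb'; rewrite e.
  by case=> -> [] ->; rewrite ?flipK; auto.
- by left; apply: connect_trans xb _; rewrite connect_sym_rot // -E.
- right; apply: connect_trans (flip_connect HG xb) _.
  by rewrite connect_sym_rot // -E.
Qed.

Lemma edge_blueE x : genuine x -> edge_blue (edge_index x) = blue (colour (edge_of G x)).
Proof.
move=> gx; have [xb bb] := botP HG HT gx.
rewrite /edge_blue /edge_index enum_rankK -(edge_of_connect xb).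
have gb : genuine (bot G up x) by rewrite (genuine_connect xb).
have [e|e] := bottom_edgeP bb gb; first by rewrite [in RHS]e.
by rewrite [in RHS]e edge_of_flip.
Qed.

Lemma edge_blue_mid t m w :
  edge_blue (edge_index (t, (cs t (iN m), cs t (iW w)))) = m (+) w.
Proof.
have [h1 h2 h3 h4] := HV (cs_even t) (cs_top t false) (cs_top t true).
rewrite edge_blueE; last by apply/s_genuine/iN_iW.
by case: m w => [] []; rewrite /= ?h1 ?h2 ?h3 ?h4.
Qed.

Lemma label_rot x : genuine x -> label (Defs.rot G x) = label x - exit (dlt G) x.
Proof. exact: (theta_rot HG HT (@dlt_loop _ G)). Qed.

Lemma label_flip x : genuine x -> label (flip x) = label x.
Proof. exact: (theta_flip HG HT (@dlt_adj _ G) (@dlt_loop _ G)). Qed.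

Definition taut_flat : flat_veering (chain_class G) n :=
  flat HG HT label_rot label_flip edge_index_rot edge_index_flip edge_index_inj
    cs_even cs_top cs_bot edge_blue_mid.

Lemma gluing_Km_inj (up1 : T -> 'I_4 -> bool) (s : T -> 'S_4)
    (v : flat_veering (chain_class G) n) (h : H1_free G) : h != 0 ->
    (forall t i, up1 (adj G t i) (glue G t i i) = ~~ up1 t i) ->
    (forall t m, ~~ up1 t (s t (iN m))) ->
    (forall t w, (gl v (enum_rank t, w)).1 = enum_rank (adj G t (top_face s t w))) ->
    (forall t w, dl v (enum_rank t, w) = dlt G (t, top_face s t w)) ->
  forall z : 'cV[cring G]_n, Km (@cx _ G) v *m z = 0 -> z = 0.
Proof.
move=> h0 ua dn gE dE; apply: Km_inj => z zE k; rewrite -[k]enum_valK.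
apply: (no_twisted_section HG ua (z := z \o enum_rank) h0) => t i ti.
have [w ->] : exists w, i = top_face s t w.
  have [k' kE] : exists k', i = s t k' by exists ((s t)^-1%g i); rewrite permKV.
  rewrite kE in ti *; elim/ord4P: k' ti {kE} => ti.
  - by case/negP: (dn t false).
  - by case/negP: (dn t true).
  - by exists true.
  - by exists false.
have [b] := zE (enum_rank t) w; rewrite gE dE => e; exists b.
exact: e.
Qed.

Theorem taut_flat_minor_sym (h : H1_free G) : h != 0 ->
  forall u, bar_sym (@cbar _ G) (@cx _ G) (\det (colsub u (Dm (@cx _ G) taut_flat))).
Proof.
move=> h0; apply: (flat_veering_minor_sym (@gx0 _) (@gxD _) (@gr_bar_gx _) (@gx_inj _) (@gr_barK _)
  (@cbar_sym_sq _ G) (flat_opposite HG HT (@dlt_adj _ G) label_rot label_flip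
    edge_index_rot edge_index_flip edge_index_inj cs_even cs_top cs_bot edge_blue_mid)).
- exact: flat_climbing.
- exact: flat_climbing.
- apply: (gluing_Km_inj h0 (up_adj HT) cs_bot).
    by move=> t w; rewrite /= enum_rankK.
  by move=> t w; rewrite /= enum_rankK.
- apply: (gluing_Km_inj h0 (up_adj (op_taut HT)) (op_s_bot cs_top)).
    by move=> t w; rewrite /= enum_rankK.
  by move=> t w; rewrite /= enum_rankK.
Qed.

End Minors.

(** * The taut matrix *)

Section Transport.
Variables (R : comNzRingType) (m n N : nat).
Variables (p : 'I_m -> R) (q : 'I_m -> R) (D : 'M[R]_(n, N)).
Variables (rho : 'I_m -> 'I_n) (kap : 'I_m -> 'I_N).

Lemma det_rescaled : m = n -> injective rho -> exists (b : bool) u,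
  \det (\matrix_(i, j) (p i * q j * D (rho i) (kap j))) =
    (-1) ^+ b * (\prod_i p i) * (\prod_j q j) * \det (colsub u D).
Proof.
move=> mn ri; have mnD : \det (\matrix_(i, j) (p i * q j * D (rho i) (kap j))) =
    (\prod_i p i) * (\prod_j q j) * \det (\matrix_(i, j) D (rho i) (kap j)).
  have -> : \matrix_(i, j) (p i * q j * D (rho i) (kap j)) =
      diag_mx (\row_i p i) *m (\matrix_(i, j) D (rho i) (kap j)) *m diag_mx (\row_j q j).
    apply/matrixP => i j; rewrite mul_mx_diag mxE mul_diag_mx !mxE.
    by rewrite -!mulrA [q j * _]mulrC.
  rewrite !det_mulmx !det_diag mulrAC; congr (_ * _ * _).
  - by apply: eq_bigr => i _; rewrite mxE.
  - by apply: eq_bigr => i _; rewrite mxE.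
rewrite {}mnD; move: D rho kap ri; case: _ / mn => A r k ri.
exists (perm ri), k.
have -> : \matrix_(i, j) A (r i) (k j) = row_perm (perm ri) (colsub k A).
  by apply/matrixP => i j; rewrite !mxE permE.
by rewrite row_permE det_mulmx det_perm; move: ((-1) ^+ _) => e; ring.
Qed.
End Transport.

Section Embedding.
Variables (T : finType) (G : gluing T).
Local Notation H := (H1_free G).
Local Notation C := (chain_class G).

Definition emb : {additive H -> C} := (\val : H -> C).
Lemma emb_inj : injective emb. Proof. exact: val_inj. Qed.
Definition remb : {rmorphism group_ring H -> group_ring C} := gr_map emb.

Lemma mcoeff_remb p h : (remb p)@_(emb h) = p@_h.
Proof.
rewrite /remb /= /gr_map raddf_sum /= [in RHS](monalgE p) raddf_sum /=.
by apply: eq_bigr => k _; rewrite !mcoeffU (inj_eq emb_inj).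
Qed.

Lemma remb_supp p c : (remb p)@_c != 0 -> exists h, c = emb h.
Proof.
move=> pc; apply: contrapT => nc; move/eqP: pc; apply.
rewrite /remb /= /gr_map raddf_sum /= big1 // => k _.
by rewrite mcoeffU; case: eqP => // e; case: nc; exists k.
Qed.

Lemma remb_inj : injective remb.
Proof. by move=> p q e; apply/malgP => h; rewrite -!mcoeff_remb e. Qed.

Lemma remb_bar p : remb (gr_bar p) = gr_bar (remb p).
Proof.
have rD q r : remb (q + r) = remb q + remb r by exact: raddfD.
have bD (K : zmodType) (q r : group_ring K) : gr_bar (q + r) = gr_bar q + gr_bar r.
  exact: raddfD.
have rU a h : remb << a *g h >> = << a *g emb h >> by exact: gr_mapU.
pose P q := remb (gr_bar q) = gr_bar (remb q).
rewrite (monalgE p) -/(P _); apply: (big_ind P) => [|q r Pq Pr|h _].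
- by rewrite /P !raddf0.
- rewrite /P (bD _ q r) (rD (gr_bar q)) (rD q) (bD _ (remb q)).
  exact: (congr2 _ Pq Pr).
- apply: etrans (congr1 remb (gr_barU p@_h h)) _; apply: etrans (rU _ _) _.
  apply: esym; apply: etrans (congr1 (@gr_bar C) (rU p@_h h)) _.
  apply: etrans (gr_barU _ _) _.
  exact: (congr1 (fun c => << p@_h *g c >>) (esym (raddfN emb h))).
Qed.

Lemma H1_integral (p q : group_ring H) : p * q = 0 -> p = 0 \/ q = 0.
Proof.
move=> /(congr1 remb); rewrite rmorphM rmorph0.
case/(gr_integral (@pos0 _ G) (@posD _ G) (@posT _ G))/orP => /eqP e; [left|right].
  by apply: remb_inj; rewrite e rmorph0.
by apply: remb_inj; rewrite e rmorph0.
Qed.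

Lemma bar_sym_descent (p : group_ring H) :
  bar_sym (@cbar _ G) (@cx _ G) (remb p) ->
  exists (b : bool) h, gr_bar p = (-1) ^+ b * gx h * p.
Proof.
have [->|p0] := eqVneq p 0; first by exists false, 0; rewrite raddf0 mulr0.
case=> _ [b [c ->]] E; have {}E : gr_bar (remb p) = (-1) ^+ b * gx c * remb p by exact: E.
have [g pg] : exists g, p@_g != 0.
  apply: contrapT => np; move/eqP: p0; apply; apply/malgP => g.
  by rewrite mcoeff0; apply/eqP/negPn/negP => pg; apply: np; exists g.
have cg : (remb (gr_bar p))@_(c + emb g) != 0.
  rewrite remb_bar E -mulrA; have nz : (gx c * remb p)@_(c + emb g) != 0.
    by rewrite mcoeff_gx_mul addrAC subrr add0r mcoeff_remb.
  case: (b); last by rewrite mul1r; exact: nz.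
  by rewrite mulN1r mcoeffN oppr_eq0; exact: nz.
have [h hE] := remb_supp cg; exists b, (h - g); apply: remb_inj.
have rgx : remb (gx (h - g)) = gx c.
  apply: etrans (gr_mapU _ _ _) _; congr << _ *g _ >>.
  by apply: etrans (raddfB emb h g) _; rewrite -hE addrK.
have rs : remb ((-1) ^+ b) = (-1) ^+ b by exact: rmorph_sign.
apply: etrans (remb_bar p) _; apply: etrans E _; apply: esym.
apply: etrans (rmorphM remb _ p) _; apply: etrans (congr1 ( *%R^~ _) (rmorphM remb _ _)) _.
by rewrite rs rgx.
Qed.

End Embedding.

Section Gcd.
Variables (T : finType) (G : gluing T).
Local Notation H := (H1_free G).

Lemma gcd_symmetric (S : group_ring H -> Prop) (g : group_ring H) :
  (forall a, S a -> exists (b : bool) h, gr_bar a = (-1) ^+ b * gx h * a) ->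
  is_gcd S g -> gr_symmetric g.
Proof.
move=> Ssym [g_dvd g_max]; have [g0|gn0] := eqVneq g 0.
  exists 1; first exact: unitr1.
  by rewrite g0 raddf0 mulr0.
have [c gE] : ring_dvd (gr_bar g) g.
  apply: g_max => a Sa; have [c aE] := g_dvd a Sa; have [b [h baE]] := Ssym a Sa.
  have bE : gr_bar a = gr_bar c * gr_bar g by rewrite aE; exact: rmorphM.
  exists ((-1) ^+ b * gx (- h) * gr_bar c); apply: esym.
  apply: etrans (esym (mulrA _ _ _)) _; rewrite -bE baE.
  have key (R : comNzRingType) (s x y d : R) : s * s = 1 -> y * x = 1 -> s * y * (s * x * d) = d.
    by move=> ss yx; transitivity (s * s * (y * x) * d); [ring | rewrite ss yx !mul1r].
  apply: key; first by rewrite -signr_addb addbb.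
  by apply: etrans (esym (gxD _ _)) _; rewrite addNr; exact: gx0.
have bgE : gr_bar g = gr_bar c * g.
  rewrite {1}gE; apply: etrans (rmorphM (@gr_bar H) _ _) _.
  by congr (_ * _); exact: gr_barK.
exists c; last exact: gE.
apply/asboolP; exists (gr_bar c).
have cg : g * (1 - gr_bar c * c) = 0.
  rewrite mulrBr mulr1 {1}gE bgE.
  by move: (gr_bar c) => d; ring.
have [g0|/eqP] := H1_integral cg; first by case/eqP: gn0.
by rewrite subr_eq0 eq_sym => /eqP.
Qed.

Lemma trivial_symmetric (g : group_ring H) : (forall h : H, h = 0) -> gr_symmetric g.
Proof.
move=> H0; exists 1; first exact: unitr1.
rewrite mul1r; apply/malgP => h; rewrite mcoeff_gr_bar.
by rewrite (H0 h) oppr0.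
Qed.

End Gcd.

Section Cover.
Variables (T : finType) (V : veering_triangulation T) (t0 : T).
Local Notation G := (vt_gluing V).
Local Notation up := (vt_up V).
Local Notation C := (chain_class G).
Local Notation Tfab := (fab_tet G t0).
Local Notation Gfab := (fab_gluing G t0).
Local Notation proj := (@fab_proj_angle T G t0).
Let HG := vt_triang V.
Let HT := vt_taut V.
Let HV := @vt_veering T V.
Implicit Types (A B : angle Tfab) (h : H1_free G).

Lemma fab_tet_eq (x y : Tfab) :
  fab_proj x = fab_proj y -> fab_class x = fab_class y -> x = y.
Proof.
case: x y => [p c pc] [p' c' pc'] /= ep ec; subst p' c'.
by congr FabTet; apply: Prop_irrelevance.
Qed.

Lemma proj_rot A : proj (Defs.rot Gfab A) = Defs.rot G (proj A).
Proof. by case: A => x [i j]. Qed.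

Lemma class_rot A : fab_class (Defs.rot Gfab A).1 =
  fab_class A.1 + dlt G ((proj A).1, (proj A).2.2).
Proof. by case: A => x [i j]. Qed.

Definition position A : C := fab_class A.1 + label G up (proj A).

Lemma position_same_edge A B : same_edge Gfab A B ->
  genuine (proj A) = genuine (proj B) /\
  (genuine (proj A) -> position A = position B).
Proof.
elim=> {A B} [A B [->|->]|A|A B _ [g e]|A B D _ [g e] _ [g' e']].
- rewrite proj_rot genuine_rot; split=> [|gA]; first by [].
  rewrite /position proj_rot class_rot (label_rot HG HT gA) addrACA.
  have -> : dlt G ((proj A).1, (proj A).2.2) - exit (dlt G) (proj A) = 0 by exact: subrr.
  exact: esym (addr0 _).
- split=> [|gA]; first by rewrite -[RHS]genuine_flip.
  by rewrite /position -(label_flip HG HT gA).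
- by split.
- by split=> [|gB]; rewrite ?g //; apply/esym/e; rewrite g.
- split=> [|gA]; first by rewrite g g'.
  by rewrite e // e' // -g.
Qed.

Lemma lift_same_edge B y : same_edge G (proj B) y ->
  exists2 B', same_edge Gfab B B' & proj B' = y.
Proof.
have lift k A : exists2 A', same_edge Gfab A A' & proj A' = iter k (Defs.rot G) (proj A).
  elim: k => [|k [A' sA' eA']]; first by exists A; [exact: rst_refl|].
  exists (Defs.rot Gfab A'); last by rewrite proj_rot eA'.
  by apply: rst_trans sA' _; apply: rst_step; left.
case/(same_edgeP HG) => /iter_findex <-; first exact: lift.
have [A' sA' <-] := lift (findex (Defs.rot G) (flip (proj B)) y) (flip B).
exists A' => //; apply: rst_trans sA'.
by apply: rst_step; right.
Qed.

Lemma deck_transitive (x y : Tfab) : fab_proj x = fab_proj y ->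
  exists h, fab_deck h y = x.
Proof.
move=> e; have hP : fab_class x - fab_class y \in @cycle_class T G.
  apply/asboolP; have [c bc ec] := fab_tetP x; have [d bd ed] := fab_tetP y.
  exists (c - d); last by rewrite class_ofB ec ed.
  by rewrite boundaryB bc bd e subrr.
exists (H1Free hP); apply: fab_tet_eq => //=.
exact: subrK.
Qed.

Lemma deck_same_edge h A B : same_edge Gfab A B ->
  same_edge Gfab (fab_deck_angle h A) (fab_deck_angle h B).
Proof.
elim=> {A B} [A B [->|->]|A|A B _ e|A B D _ e _ e'].
- apply: rst_step; left; case: A => x [i j] /=.
  congr (_, _); apply: fab_tet_eq => //=.
  exact: addrA.
- by apply: rst_step; right.
- exact: rst_refl.
- exact: rst_sym.
- exact: rst_trans e e'.
Qed.

Variable lE : {set angle T} -> angle Tfab.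
Hypothesis lEP : edge_lift lE.

Lemma edge_coordP A : genuine (proj A) ->
  same_edge Gfab (fab_deck_angle (edge_coord lE A) (lE (edge_of G (proj A)))) A.
Proof.
move=> gA; set B := lE _.
have eE : edge_of G (proj A) \in edges G by apply/imsetP; exists (proj A); rewrite ?inE.
have sB : same_edge G (proj B) (proj A).
  have : proj A \in edge_of G (proj B) by rewrite (lEP eE) inE; apply/asboolP/rst_refl.
  by rewrite inE => /asboolP.
have [B' sB' eB'] := lift_same_edge sB.
have [h hE] : exists h, fab_deck h B'.1 = A.1.
  by apply: deck_transitive; move/(congr1 fst): eB' => /= ->.
have P : same_edge Gfab (fab_deck_angle h B) A.
  have -> : A = fab_deck_angle h B'.
    have e2 : B'.2 = A.2 := congr1 snd eB'.
    by rewrite /fab_deck_angle hE e2; case: (A).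
  exact: deck_same_edge.
exact: (classical_sets.xgetPex 0 (ex_intro (fun h => same_edge Gfab (fab_deck_angle h B) A) h P)).
Qed.

Lemma edge_coord_position A : genuine (proj A) ->
  h1_val (edge_coord lE A) = position A - position (lE (edge_of G (proj A))).
Proof.
move=> gA; have sP := edge_coordP gA.
have [g e] := position_same_edge sP.
have {}e := e (etrans g gA); rewrite -{}e.
apply/eqP; rewrite eq_sym subr_eq; apply/eqP.
exact: esym (addrA _ _ _).
Qed.

End Cover.

Lemma if_scale (S : comNzRingType) (b : bool) (z s p c l : S) :
  (b -> z = s * (p * c * l)) -> (if b then z else 0) = p * c * (s * l * b%:R).
Proof.
by case: b => [->|_]; rewrite ?mulr1 ?mulr0 // [LHS]mulrCA.
Qed.

Lemma gx_position (K : zmodType) (a b l : K) :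
  gx (a + b - l) = gx (- l) * gx a * gx b :> group_ring K.
Proof. by rewrite -!gxD addrC addrA. Qed.

Lemma Dm_fk (C : zmodType) (R : idomainType) (x : C -> R) n (v : flat_veering C n) f e :
  Dm x v e (fk f) = x (cb v f.1) * (e == eb v f.1)%:R
    - x (cq v f.1 f.2 false) * (e == eq_ v f.1 f.2 false)%:R
    - x (cq v f.1 f.2 true) * (e == eq_ v f.1 f.2 true)%:R.
Proof. by rewrite mxE fkK -!(vecE x) /dcol !mxE. Qed.

Section MinorDescent.
Variables (T : finType) (V : veering_triangulation T) (t0 : T).
Local Notation G := (vt_gluing V).
Local Notation up := (vt_up V).
Local Notation n := #|T|.
Local Notation E := (edges G).
Local Notation F := (triangles up).
Local Notation C := (chain_class G).
Local Notation Tfab := (fab_tet G t0).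
Local Notation proj := (@fab_proj_angle T G t0).
Let HG := vt_triang V.
Let HT := vt_taut V.
Let HV := @vt_veering T V.
Local Notation v := (taut_flat HG HT HV).
Local Notation R := (cring G).
Local Notation X := (@cx _ G).
Local Notation ei := (edge_index G up).
Local Notation lab := (label G up).
Local Notation cs := (cs HT).
Implicit Types (x y : angle T).
Variables (lE : {set angle T} -> angle Tfab) (lF : T * 'I_4 -> Tfab * 'I_4).
Hypotheses (lEP : edge_lift lE) (lFP : triangle_lift lF).

Lemma edge_index_edge_of x y : genuine x -> genuine y ->
  (edge_of G x == edge_of G y) = (ei x == ei y).
Proof.
move=> gx gy; apply/eqP/eqP => [e|/(edge_index_inj HG HT gx gy)[c|c]].
- have : y \in edge_of G x by rewrite e edge_ofP // connect0.
  rewrite edge_ofP // => /orP[] c; apply: esym.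
    exact: (ei_connect (edge_index_rot HG HT) gx c).
  rewrite (ei_connect (edge_index_rot HG HT) _ c) ?genuine_flip //.
  exact: edge_index_flip.
- exact: esym (edge_of_connect c).
- by rewrite (edge_of_connect c) edge_of_flip.
Qed.

Definition lift_angle (e : 'I_#|E|) : angle T := proj (lE (enum_val e)).

Lemma lift_angle_edge e : edge_of G (lift_angle e) = enum_val e.
Proof. exact/lEP/enum_valP. Qed.

Lemma genuine_edge_of x y : edge_of G x = edge_of G y -> genuine x = genuine y.
Proof.
move=> e; have : y \in edge_of G x by rewrite e edge_ofP // connect0.
by rewrite edge_ofP // => /orP[] /genuine_connect ->; rewrite ?genuine_flip.
Qed.

Lemma lift_angle_genuine e : genuine (lift_angle e).
Proof.
have /imsetP[a] := enum_valP e; rewrite inE => ga ea.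
by rewrite (@genuine_edge_of _ a) // lift_angle_edge.
Qed.

Definition rho (e : 'I_#|E|) : 'I_n := ei (lift_angle e).

Lemma rho_eq e x : genuine x -> (edge_of G x == enum_val e) = (rho e == ei x).
Proof.
move=> gx; rewrite -lift_angle_edge eq_sym edge_index_edge_of //.
exact: lift_angle_genuine.
Qed.

Lemma rho_inj : injective rho.
Proof.
move=> e e' /eqP; rewrite -edge_index_edge_of ?lift_angle_genuine //.
by rewrite !lift_angle_edge => /eqP/enum_val_inj.
Qed.

Lemma bottom_edge_bottom t : bottom_diagonal up (bottom_edge HT t) /\ genuine (bottom_edge HT t).
Proof.
rewrite /bottom_diagonal /genuine /= (inj_eq perm_inj).
by rewrite (cs_bot HT t false) (cs_bot HT t true).
Qed.

Lemma card_edges : #|E| = #|T|.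
Proof.
apply/eqP; rewrite eqn_leq -[X in (_ <= X)%N]card_ord -{1}[#|E|]card_ord.
rewrite (leq_card _ rho_inj) /=.
rewrite -cardsT -(@card_imset _ _ (fun t => edge_of G (bottom_edge HT t))).
  apply/subset_leq_card/subsetP => _ /imsetP[t _ ->].
  by apply/imsetP; exists (bottom_edge HT t) => //; rewrite inE; case: (bottom_edge_bottom t).
move=> t t' /eqP; have [[b g] [b' g']] := (bottom_edge_bottom t, bottom_edge_bottom t').
rewrite edge_index_edge_of // /edge_index !bot_bottom // => /eqP/enum_rank_inj.
by [].
Qed.

Definition kap (c : 'I_#|F|) : 'I_n * bool :=
  let f := enum_val c in (enum_rank f.1, f.2 == cs f.1 (iN false)).

Lemma kapE c : (enum_val c).2 = cs (enum_val c).1 (iN (~~ (kap c).2)).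
Proof.
have := enum_valP c; rewrite inE /kap; case: (enum_val c) => t i /= ti.
have [m ->] := @down_face _ up cs (cs_top HT) t i ti.
by rewrite (inj_eq perm_inj); case: m.
Qed.

Definition emb_ring : {rmorphism group_ring (H1_free G) -> R} := remb G.

Definition edge_term (e : 'I_#|E|) x : R :=
  (if bottom_diagonal up x then 1 else -1) * X (lab x) * (rho e == ei x)%:R.

Lemma emb_ring_gx (b : bool) h : emb_ring << (if b then 1 else -1) *g h >> =
  (if b then 1 else -1) * X (emb G h).
Proof.
have -> : emb_ring << (if b then 1 else -1) *g h >> =
   << (if b then 1 else -1) *g emb G h >> :> group_ring C by exact: gr_mapU.
case: b; first by rewrite mul1r.
by rewrite mulN1r; apply: monalgUN.
Qed.

Lemma sum_other_faces (M : zmodType) (P : 'I_4 -> M) m :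
  \sum_(k | k != iN (~~ m)) P k = P (iN m) + P (iW false) + P (iW true).
Proof.
rewrite (bigD1 (iN m)) /=; last by case: m.
rewrite (bigD1 (iW false)) /=; last by case: m.
rewrite (bigD1 (iW true)) /=; last by case: m.
rewrite big_pred0 ?addr0 ?addrA // => k.
by case: m; elim/ord4P: k.
Qed.

Lemma emb_coeff e c : emb_ring (taut_coeff lE (lF (enum_val c)) (enum_val e)) =
  X (- position (lE (enum_val e))) * X (fab_class (lF (enum_val c)).1) *
  \sum_(k | k != iN (~~ (kap c).2))
    edge_term e ((enum_val c).1, (cs (enum_val c).1 (iN (~~ (kap c).2)), cs (enum_val c).1 k)).
Proof.
have [e1 e2] : fab_proj (lF (enum_val c)).1 = (enum_val c).1 /\
    (lF (enum_val c)).2 = (enum_val c).2.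
  by have := lFP (enum_valP c); case: (enum_val c) => t i [-> ->].
have kE := kapE c; move: e1 e2 kE; case: (enum_val c) => t i; move: (kap c).2 => m.
case: (lF _) => x j /= e1 e2 kE.
rewrite /taut_coeff [X in X = _](raddf_sum emb_ring) mulr_sumr.
rewrite (reindex_inj (@perm_inj _ (cs t))) /= e2 kE e1.
rewrite big_mkcond [RHS]big_mkcond /=; apply: eq_bigr => k _.
rewrite (inj_eq perm_inj); case: eqVneq => //= km.
have gx : genuine (t, (cs t (iN (~~ m)), cs t k)) by apply: s_genuine; rewrite eq_sym.
rewrite /edge_term -(rho_eq e gx); apply: if_scale => /eqP q.
apply: etrans (emb_ring_gx _ _) _; apply: (congr1 ( *%R _)).
have gA : genuine (proj (x, (cs t (iN (~~ m)), cs t k))) by exact: gx.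
have := edge_coord_position lEP gA; rewrite {1}/position /fab_proj_angle /= e1 q => eE.
apply: etrans (congr1 X eE) _; exact: gx_position.
Qed.

Lemma edge_term_b e t m : edge_term e (t, (cs t (iN (~~ m)), cs t (iN m))) =
  X (lab (a_b cs t)) * (rho e == ei (a_b cs t))%:R.
Proof.
have g : genuine (t, (cs t (iN (~~ m)), cs t (iN m))) by apply/s_genuine/iN_neq.
have b : bottom_diagonal up (t, (cs t (iN (~~ m)), cs t (iN m))).
  by rewrite /bottom_diagonal /= !cs_bot.
have [-> ->] : lab (a_b cs t) = lab (t, (cs t (iN (~~ m)), cs t (iN m))) /\
    ei (a_b cs t) = ei (t, (cs t (iN (~~ m)), cs t (iN m))).
  rewrite /a_b /ang (others_WW true : others (iW false) (iW true) = (iN false, iN true)).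
  case: m g b => [_ _|g _]; first by split.
  by split; [exact: (label_flip HG HT g) | exact: (edge_index_flip HG HT g)].
by rewrite /edge_term b mul1r.
Qed.

Lemma edge_term_q e t m w : edge_term e (t, (cs t (iN (~~ m)), cs t (iW (~~ w)))) =
  - (X (lab (a_q cs t m w)) * (rho e == ei (a_q cs t m w))%:R).
Proof.
have g : genuine (t, (cs t (iN (~~ m)), cs t (iW (~~ w)))) by apply/s_genuine/iN_iW.
have b : ~~ bottom_diagonal up (t, (cs t (iN (~~ m)), cs t (iW (~~ w)))).
  by rewrite /bottom_diagonal /= cs_top andbF.
have [-> ->] : lab (a_q cs t m w) = lab (t, (cs t (iN (~~ m)), cs t (iW (~~ w)))) /\
    ei (a_q cs t m w) = ei (t, (cs t (iN (~~ m)), cs t (iW (~~ w)))).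
  rewrite /a_q /ang others_NW; case: ifP => _; first by split.
  by split; [exact: (label_flip HG HT g) | exact: (edge_index_flip HG HT g)].
by rewrite /edge_term (negPf b) mulN1r mulNr.
Qed.

Lemma Dm_entry e c : Dm X v (rho e) (fk (kap c)) =
  \sum_(k | k != iN (~~ (kap c).2))
    edge_term e ((enum_val c).1, (cs (enum_val c).1 (iN (~~ (kap c).2)), cs (enum_val c).1 k)).
Proof.
rewrite sum_other_faces edge_term_b (edge_term_q e _ _ true) (edge_term_q e _ _ false).
apply: etrans (Dm_fk X v (kap c) (rho e)) _.
change (X (lab (a_b cs (enum_val (enum_rank (enum_val c).1)))) *
    (rho e == ei (a_b cs (enum_val (enum_rank (enum_val c).1))))%:R
  - X (lab (a_q cs (enum_val (enum_rank (enum_val c).1)) (kap c).2 false)) *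
    (rho e == ei (a_q cs (enum_val (enum_rank (enum_val c).1)) (kap c).2 false))%:R
  - X (lab (a_q cs (enum_val (enum_rank (enum_val c).1)) (kap c).2 true)) *
    (rho e == ei (a_q cs (enum_val (enum_rank (enum_val c).1)) (kap c).2 true))%:R = 
   X (lab (a_b cs (enum_val c).1)) * (rho e == ei (a_b cs (enum_val c).1))%:R
  - X (lab (a_q cs (enum_val c).1 (kap c).2 true)) *
    (rho e == ei (a_q cs (enum_val c).1 (kap c).2 true))%:R
  - X (lab (a_q cs (enum_val c).1 (kap c).2 false)) *
    (rho e == ei (a_q cs (enum_val c).1 (kap c).2 false))%:R).
rewrite enum_rankK; exact: addrAC.
Qed.

Lemma emb_minor f : exists (b : bool) (p : 'I_#|E| -> C) (q : 'I_#|E| -> C) u,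
  emb_ring (\det (colsub f (taut_matrix lE lF))) =
  (-1) ^+ b * (\prod_i X (p i)) * (\prod_j X (q j)) * \det (colsub u (Dm X v)).
Proof.
pose p (e : 'I_#|E|) := - position (lE (enum_val e)).
pose q (e : 'I_#|E|) := fab_class (lF (enum_val (f e))).1.
have [b [u detE]] := det_rescaled (fun e => X (p e)) (fun e => X (q e)) (Dm X v)
  (fun e => fk (kap (f e))) card_edges rho_inj.
exists b, p, q, u; apply: etrans detE.
apply: etrans (esym (det_map_mx emb_ring _)) _; congr (\det _).
apply/matrixP => i j; rewrite [LHS]mxE [RHS]mxE.
have -> : colsub f (taut_matrix lE lF) i j = taut_coeff lE (lF (enum_val (f j))) (enum_val i).
  by rewrite !mxE.
by apply: etrans (emb_coeff i (f j)) _; rewrite Dm_entry.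
Qed.

Lemma taut_minor_sym (h : H1_free G) f : h != 0 -> exists (b : bool) k,
  gr_bar (\det (colsub f (taut_matrix lE lF))) =
  (-1) ^+ b * gx k * \det (colsub f (taut_matrix lE lF)).
Proof.
move=> h0; apply: bar_sym_descent.
have [b [p [q [u minorE]]]] := emb_minor f.
suff : bar_sym (@cbar _ G) X (emb_ring (\det (colsub f (taut_matrix lE lF)))) by exact.
rewrite minorE; apply: bar_symMl; last exact: (taut_flat_minor_sym HG HT HV h0).
all: try exact: gx0; try exact: gxD; try exact: gr_bar_gx.
have prod_mono (r : 'I_#|E| -> C) : monomial X (\prod_i X (r i)).
  apply: (big_ind (monomial X)) => [|y z|i _].
  - exact: (monomial1 (@gx0 _)).
  - exact: (monomialM (@gxD _)).
  - exact: (monomialx X (r i)).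
apply: (monomialM (@gxD _)); last exact: prod_mono.
apply: (monomialM (@gxD _)); last exact: prod_mono.
exact: (monomial_sign (@gx0 _)).
Qed.

End MinorDescent.

Theorem corollary5p12 (T : finType) (V : veering_triangulation T)
    (Theta : group_ring (H1_free V)) :
  is_taut_polynomial Theta -> gr_symmetric Theta.
Proof.
case=> t0 [lE [lF [lEP lFP ThetaP]]].
have [[h /eqP h0]|H0] := pselect (exists h : H1_free V, h <> 0); last first.
  by apply: trivial_symmetric => h; apply: contrapT => h0; apply: H0; exists h.
apply: gcd_symmetric ThetaP => _ [f _ ->].
exact: (taut_minor_sym lEP lFP f h0).
Qed.
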